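(* For the stability conditions on the heart $\mathrm{mod}\,A_3^{\otimes5}$ with central charges $Z_x$ of quintic periods near the large complex structure limit $x=0$ (the family $\mathcal S_0$), the quotients $\frac{\Pi_B(x)[i]}{\Pi_B(x)[1]}$ give wall-crossings of second kind which are different from ones of dilation and rotation. Explicitly: normalizing the central charges to $Z_x/\Pi_B(x)[1]$, which on simple representations are integral linear combinations of $1$ and the quotients $\frac{\Pi_B(x)[i]}{\Pi_B(x)[1]}$, $i=2,3,4$, the deformation of these quotients obtained by letting $x$ vary near $0$ gives deformations of the stability conditions between which there are non-trivial wall-crossings of second kind that are different from ones of dilation and rotation.
   Context: **Quiver.** $A_3^{\otimes5}$ is the quiver with vertices $s=\{s_1,\dots,s_5\}$, $0\le s_i\le3$, an arrow $s\to s'$ whenever $s'$ is obtained from $s$ by raising one $s_i$ by $1$, and all squares commuting; $\mathrm{mod}\,A_3^{\otimes5}$ is its category of finite-dimensional complex representations, a heart of $\mathcal T=D^b(\mathrm{mod}\,A_3^{\otimes5})\cong D^b_G(\mathrm{Coh}\,X)$, where $X$ is the Fermat quintic threefold and $G\cong\mathbb Z_5^5/\mathbb Z_5$ acts diagonally by fifth roots of unity. The simple representation at vertex $s$ is also written $s$; forgetting equivariance it becomes $\tau^{-\sum s_i}(\mathcal O_X)$, with $\tau(E)=\mathcal O(1)\otimes T_{\mathcal O_X}(E)$ ($T_{\mathcal O_X}$ the spherical twist). **Central charges.** Let $w(x,p)=\sum_{n\ge0}\frac{\Gamma(1+5(n+p))}{\Gamma(1+(n+p))^5}x^{n+p}$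 and $w_k(x)=\partial_p^kw(x,p)|_{p=0}$. Let $\Pi_B={}^t(w^{(0)},w^{(1)},w^{(2)},w^{(3)})$ with $w^{(0)}=w(x,0)$, $w^{(1)}=\frac{w_1}{2\pi i}$, $w^{(2)}=\frac{5w_2}{2!(2\pi i)^2}+\frac{11}2\frac{w_1}{2\pi i}$, $w^{(3)}=-\frac{5w_3}{3!(2\pi i)^3}-\frac{50}{12}\frac{w_1}{2\pi i}$, and $$M_\infty=\begin{pmatrix}1&0&0&-1\\-1&1&0&1\\-3&-5&1&3\\5&-8&1&-4\end{pmatrix}.$$ $[j]$ denotes the $j$-th component (counted from $1$). Near $x=0$, $Z_x(s)=(M_\infty^{\sum s_i}\Pi_B(x))[4]$; up to an overall sign common to all objects this is $\int_X\mathrm{ch}(s)\,w(x,\frac J{2\pi i})\,\mathrm{Todd}\,X$, $J$ the hyperplane class. **Stability condition.** A stability condition on $\mathcal T$ consists of a heart $\mathcal A$ of a bounded $t$-structure and a homomorphism $Z:K(\mathcal T)\to\mathbb C$, with a family of nonzero semistable objects of $\mathcal A$ such that: (1) each semistable $Q$ has $Z(Q)=m(Q)\exp(\phi_Qi)$, $m(Q)>0$, phase $\phi_Q\in\mathbb R$; (2) $\mathrm{Ext}^1(Q,Q')\neq0$ for semistable $Q,Q'$ implies $|\phi_Q-\phi_{Q'}|<\pi$; (3) $\phi_{Q'}>\phi_Q$ implies $\mathrm{Hom}(Q',Q)=0$; (4) each nonzero $E\in\mathcal A$ has a filtration $0=E_n\subset\dots\subset E_0=E$ in $\mathcal A$ with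 semistable $Q_i=E_i/E_{i+1}$ and $\phi_{Q_{i+1}}>\phi_{Q_i}$. Stable means semistable and not a non-trivial extension of semistable objects of the same phase. **The family.** $\mathcal S_0$ is the set of stability conditions on the heart $\mathrm{mod}\,A_3^{\otimes5}$ with central charge $Z_x$ for $x\neq 0$ close to $0$, whose stable objects are the simple representations $s$, with phases depending only on $\sum s_i$ and strictly increasing in $\sum s_i$. **Deformation, wall-crossing.** A deformation from $\sigma$ to $\sigma'$ on a heart $\mathcal A$ is a family $\sigma_t$, $t\in[0,1]$, of stability conditions on $\mathcal A$ with $\sigma_0=\sigma$, $\sigma_1=\sigma'$, whose central charges and phases of stable objects vary continuously. For a stability condition $\sigma$ on $\mathcal A$ and $\phi\in\mathbb R$, $\mathcal A^\sigma_\phi$ is the heart given by the extension-closed full subcategory of $\mathcal T$ generated by semistable $Q\in\mathcal A$ with $\phi_Q>\phi$ and $Q[1]$ for semistable $Q\in\mathcal A$ with $\phi_Q\le\phi$. There is a non-trivial wall-crossing of second kind between $\sigma$ and $\sigma'$ if $\mathcal A^\sigma_\phi\ne\mathcal A^{\sigma'}_\phi$ for some $\phi$. Dilation and rotation by $re^{i\theta}$ ($r>0,\theta\in\mathbb R$) replaces $Z$ by $re^{i\theta}Z$ and each phase $\phi_Q$ by $\phi_Q+\theta$, keeping heart and semistable objects. The wall-crossing is different from ones of dilation and rotation if, for every dilation and rotation $\sigma''$ of $\sigma$, there is still some $\phi$ with $\mathcal A^{\sigma''}_\phi\neq\mathcal A^{\sigma'}_\phi$. *)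

(* Defs.v *)
From mathcomp Require Import all_boot all_order all_algebra.
From mathcomp Require Import all_classical all_reals all_analysis.
From mathcomp Require Import complex zify.

Set Implicit Arguments.
Unset Strict Implicit.
Unset Printing Implicit Defensive.

Import Order.TTheory GRing.Theory Num.Theory.
Import numFieldNormedType.Exports.

Local Open Scope classical_set_scope.
Local Open Scope complex_scope.
Local Open Scope ring_scope.

Definition vertex := {ffun 'I_5 -> 'I_4}.

Definition degree (s : vertex) : nat := (\sum_i s i)%N.

Definition arrow (s s' : vertex) : bool :=
  [exists i, (s' i == (s i).+1 :> nat) &&
             [forall j, (j != i) ==> (s' j == s j)]].

Section Representations.
Variable R : realType.
Local Notation C := R[i].

Record rep := Rep {
  rspace :> vertex -> vectType C;
  rmap : forall s s', arrow s s' -> 'Hom(rspace s, rspace s');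
  rmap_square : forall s a b s' (sa : arrow s a) (as' : arrow a s')
      (sb : arrow s b) (bs' : arrow b s'),
    (rmap as' \o rmap sa = rmap bs' \o rmap sb)%VF }.

Record rhom (V W : rep) := RHom {
  rhom_fun :> forall s, 'Hom(V s, W s);
  rhom_nat : forall s s' (a : arrow s s'),
    (rhom_fun s' \o rmap V a = rmap W a \o rhom_fun s)%VF }.

Definition zero_rhom (V W : rep) : rhom V W.
Proof.
exists (fun=> 0) => s s' a.
by apply/lfunP => v; rewrite !comp_lfunE !zero_lfunE linear0.
Defined.

Definition opp_rhom (V W : rep) (f : rhom V W) : rhom V W.
Proof.
exists (fun s => - f s) => s s' a.
by rewrite comp_lfunNl comp_lfunNr rhom_nat.
Defined.

Definition is_zero (V : rep) : Prop := forall s, \dim {: V s} = 0%N.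

Definition rep_iso (V W : rep) : Prop :=
  exists f : rhom V W,
    forall s, lker (f s) = 0%VS /\ limg (f s) = fullv.

Definition is_ses (X Y Z : rep) (f : rhom X Y) (g : rhom Y Z) : Prop :=
  forall s, [/\ lker (f s) = 0%VS, limg (f s) = lker (g s)
              & limg (g s) = fullv].

Definition ses (X Y Z : rep) : Prop :=
  exists (f : rhom X Y) (g : rhom Y Z), is_ses f g.

Definition hom_vanishes (V W : rep) : Prop :=
  forall (f : rhom V W) s, f s = 0.

(* Yoneda's Ext^1(Q, Q'): a nonzero class is a non-split extension
   0 -> Q' -> E -> Q -> 0. *)
Definition ext1_nonzero (Q Q' : rep) : Prop :=
  exists (E : rep) (f : rhom Q' E) (g : rhom E Q),
    is_ses f g /\ ~ exists h : rhom Q E, forall s, (g s \o h s = \1)%VF.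

Lemma comp_lfun00 (U V W : vectType C) :
  ((0 : 'Hom(V, W)) \o (0 : 'Hom(U, V)) = 0)%VF.
Proof. by apply/lfunP => v; rewrite comp_lfunE !zero_lfunE. Qed.

Definition zero_rep : rep.
Proof.
by exists (fun=> 'rV[C]_0) (fun _ _ _ => 0) => *; rewrite !comp_lfun00.
Defined.

Definition simple (s : vertex) : rep.
Proof.
by exists (fun s' => 'rV[C]_(s' == s)) (fun _ _ _ => 0) => *;
  rewrite !comp_lfun00.
Defined.

(* T = D^b(mod A_3^{(x)5}) has the bounded complexes as objects; two of them are isomorphic in T iff
   they are joined by a roof of quasi-isomorphisms, and every distinguished
   triangle is isomorphic in T to the one given by a short exact sequence of
   bounded complexes. A strict full subcategory of T is thus a predicate on
   bounded complexes that is invariant under roofs. *)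

Record cpx := Cpx {
  cterm :> int -> rep;
  cdiff : forall i, rhom (cterm i) (cterm (i + 1));
  cdiffK : forall i s, (cdiff (i + 1) s \o cdiff i s = 0)%VF;
  cbounded : exists N : nat, forall i, (N < `|i|)%N -> is_zero (cterm i) }.

Record cmap (X Y : cpx) := CMap {
  cmap_fun :> forall i, rhom (X i) (Y i);
  cmap_comm : forall i s,
    (cmap_fun (i + 1) s \o cdiff X i s = cdiff Y i s \o cmap_fun i s)%VF }.

(* [f] is injective and surjective on H^(i+1) = ker d^(i+1) / im d^i *)
Definition quasi_iso (X Y : cpx) (f : cmap X Y) : Prop :=
  forall i s,
    (forall v, v \in lker (cdiff X (i + 1) s) ->
       f (i + 1) s v \in limg (cdiff Y i s) -> v \in limg (cdiff X i s)) /\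
    (forall w, w \in lker (cdiff Y (i + 1) s) ->
       exists2 v, v \in lker (cdiff X (i + 1) s) &
                  w - f (i + 1) s v \in limg (cdiff Y i s)).

Definition iso_T (X Y : cpx) : Prop :=
  exists (W : cpx) (f : cmap W X) (g : cmap W Y), quasi_iso f /\ quasi_iso g.

Definition ses_cpx (X Y Z : cpx) : Prop :=
  exists (f : cmap X Y) (g : cmap Y Z), forall i, is_ses (f i) (g i).

Definition stalk (Q : rep) : cpx.
Proof.
exists (fun i => if i == 0 then Q else zero_rep) (fun _ => zero_rhom _ _).
- by move=> i s; apply: comp_lfun00.
- by exists 0%N; case=> [[|n]|n] //= _ s; rewrite dimvf /dim /= mul1n.
Defined.

Definition shift_cpx (X : cpx) : cpx.
Proof.
exists (fun i => X (i + 1)) (fun i => opp_rhom (cdiff X (i + 1))).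
- by move=> i s; rewrite /= comp_lfunNl comp_lfunNr opprK cdiffK.
- by have [N bN] := cbounded X; exists N.+1 => i iN; apply: bN; lia.
Defined.

(* The extension-closed strict full subcategory of T generated by G; "ext" is
   closure under the middle term of a distinguished triangle. *)
Inductive ext_closure (G : cpx -> Prop) : cpx -> Prop :=
| ext_closure_gen X of G X : ext_closure G X
| ext_closure_zero : ext_closure G (stalk zero_rep)
| ext_closure_iso X Y of iso_T X Y & ext_closure G X : ext_closure G Y
| ext_closure_ext X Y Z of ses_cpx X Y Z & ext_closure G X & ext_closure G Z :
    ext_closure G Y.

(* The heart is fixed to be mod A_3^{(x)5}, embedded in T by stalk. *)

Definition cis (theta : R) : C := cos theta +i* sin theta.

Record stability := Stability {
  (* a homomorphism K(T) -> C, given on objects of T: invariant under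
     isomorphism and additive on distinguished triangles *)
  central_charge : cpx -> C;
  charge_iso : forall X Y, iso_T X Y -> central_charge X = central_charge Y;
  charge_ses : forall X Y Z, ses_cpx X Y Z ->
    central_charge Y = central_charge X + central_charge Z;
  semistable : rep -> Prop;
  phase : rep -> R; (* only meaningful on semistable objects *)
  semistable_nonzero : forall Q, semistable Q -> ~ is_zero Q;
  semistable_iso : forall Q Q', rep_iso Q Q' -> semistable Q -> semistable Q';
  charge_phase : forall Q, semistable Q ->
    exists2 m : R, 0 < m & central_charge (stalk Q) = m%:C * cis (phase Q);
  phase_ext : forall Q Q', semistable Q -> semistable Q' ->
    ext1_nonzero Q Q' -> `|phase Q - phase Q'| < pi;
  phase_hom : forall Q Q', semistable Q -> semistable Q' ->
    phase Q < phase Q' -> hom_vanishes Q' Q;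
  filtration : forall E, ~ is_zero E ->
    exists (n : nat) (F Q : nat -> rep),
      [/\ F 0%N = E, is_zero (F n),
          forall i, (i < n)%N -> semistable (Q i) /\ ses (F i.+1) (F i) (Q i)
        & forall i, (i.+1 < n)%N -> phase (Q i) < phase (Q i.+1)] }.

(* semistable objects are nonzero, so the extensions excluded below are the
   ones by two nonzero objects *)
Definition stable (sigma : stability) (Q : rep) : Prop :=
  semistable sigma Q /\
  ~ exists Q1 Q2 : rep,
      [/\ semistable sigma Q1 /\ semistable sigma Q2,
          phase sigma Q1 = phase sigma Q, phase sigma Q2 = phase sigma Q
        & ses Q1 Q Q2].

(* objects of the heart A^sigma_phi *)
Definition tilted_heart (sigma : stability) (phi : R) : cpx -> Prop :=
  ext_closure (fun X => exists2 Q, semistable sigma Q &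
    (phi < phase sigma Q /\ X = stalk Q) \/
    (phase sigma Q <= phi /\ X = shift_cpx (stalk Q))).

Definition same_heart (H H' : cpx -> Prop) : Prop := forall X, H X <-> H' X.

Definition wall_crossing2 (sigma sigma' : stability) : Prop :=
  exists phi,
    ~ same_heart (tilted_heart sigma phi) (tilted_heart sigma' phi).

Definition dilation_rotation (r theta : R) (sigma sigma'' : stability) : Prop :=
  [/\ forall X,
        central_charge sigma'' X = r%:C * cis theta * central_charge sigma X,
      forall Q, semistable sigma'' Q <-> semistable sigma Q
    & forall Q, semistable sigma Q ->
        phase sigma'' Q = phase sigma Q + theta].

Definition not_dilation_rotation (sigma sigma' : stability) : Prop :=
  forall (r theta : R) (sigma'' : stability),
    0 < r -> dilation_rotation r theta sigma sigma'' ->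
    wall_crossing2 sigma'' sigma'.

Definition continuous_on_C (D : set R) (f : R -> C) : Prop :=
  {within D, continuous (fun t => complex.Re (f t))} /\
  {within D, continuous (fun t => complex.Im (f t))}.

Definition deformation (sigma sigma' : stability) (fam : R -> stability) :
    Prop :=
  [/\ fam 0 = sigma, fam 1 = sigma',
      forall X, continuous_on_C `[0, 1] (fun t => central_charge (fam t) X)
    & forall Q, {within [set t | 0 <= t <= 1 /\ stable (fam t) Q],
                 continuous (fun t => phase (fam t) Q)}].

(* Because of x^(n+p), everything is a function of a choice l of log x, that
   is, of a point of the universal cover of the punctured disc. *)

Definition expC (z : C) : C :=
  (expR (complex.Re z))%:C * cis (complex.Im z).

Definition Gamma (z : R) : R :=
  \int[lebesgue_measure]_(t in `]0%R, +oo[) (t `^ (z - 1) * expR (- t)).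

Definition Cseries (u : nat -> C) : C :=
  limn (series (fun n => complex.Re (u n))) +i*
  limn (series (fun n => complex.Im (u n))).

Definition Cderive1n (k : nat) (f : R -> C) (p : R) : C :=
  derive1n k (fun q => complex.Re (f q)) p +i*
  derive1n k (fun q => complex.Im (f q)) p.

(* w(x, p) for x = exp l *)
Definition w (l : C) (p : R) : C :=
  Cseries (fun n =>
    (Gamma (1 + 5 * (n%:R + p)) / Gamma (1 + (n%:R + p)) ^+ 5)%:C *
    expC ((n%:R + p)%:C * l)).

Definition w_ (k : nat) (l : C) : C := Cderive1n k (w l) 0.

Definition two_pi_i : C := 0 +i* (2 * pi).

Definition Pi_B (l : C) : 'cV[C]_4 :=
  \col_i [:: w l 0;
             w_ 1 l / two_pi_i;
             5 * w_ 2 l / (2 * two_pi_i ^+ 2) + 11 / 2 * (w_ 1 l / two_pi_i);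
             - (5 * w_ 3 l / (6 * two_pi_i ^+ 3))
               - 50 / 12 * (w_ 1 l / two_pi_i)]`_i.

Definition M_infty : 'M[C]_4 :=
  \matrix_(i, j) ((nth [::] [:: [::  1;  0; 0; -1];
                                [:: -1;  1; 0;  1];
                                [:: -3; -5; 1;  3];
                                [::  5; -8; 1; -4]] i)`_j : int)%:~R.

(* Indices are shifted by one: the component [j] has index j - 1. *)
Definition Z_x (l : C) (s : vertex) : C :=
  (M_infty ^+ degree s *m Pi_B l) ord_max 0.

Definition quotient_B (l : C) (i : 'I_4) : C := Pi_B l i 0 / Pi_B l 0 0.

(* The charges of the simple objects determine the homomorphism on K(T). *)
Definition S0 (l : C) (sigma : stability) : Prop :=
  [/\ forall s, central_charge sigma (stalk (simple s)) = Z_x l s,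
      forall Q, stable sigma Q <-> exists s, rep_iso Q (simple s),
      forall s s', degree s = degree s' ->
        phase sigma (simple s) = phase sigma (simple s')
    & forall s s', (degree s < degree s')%N ->
        phase sigma (simple s) < phase sigma (simple s')].

(* sigma is a member of S_0 at x = exp l whose charge Z_x is rescaled to
   Z_x / Pi_B(x)[1] *)
Definition normalized (l : C) (sigma : stability) : Prop :=
  exists (sigma0 : stability) (r theta : R),
    [/\ S0 l sigma0, 0 < r, r%:C * cis theta = (Pi_B l 0 0)^-1
      & dilation_rotation r theta sigma0 sigma].

(* |x| < r and |arg x| <= A on the universal cover of the punctured disc *)
Definition near0 (A r : R) (l : C) : Prop :=
  expR (complex.Re l) < r /\ `|complex.Im l| <= A.

Definition path_near0 (A r : R) (l : R -> C) : Prop :=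
  continuous_on_C `[0, 1] l /\ forall t, 0 <= t <= 1 -> near0 A r (l t).

Definition deforms_along (l : R -> C) (sigma sigma' : stability)
    (fam : R -> stability) : Prop :=
  deformation sigma sigma' fam /\
  forall t, 0 <= t <= 1 -> normalized (l t) (fam t).

End Representations.

(* Main.v *)
(* A representation supported in a single degree d = sum s_i is a sum of simples,
   so a stability condition is determined by charges Z_d and phases phi_d as soon
   as 0 < phi_{d+1} - phi_d < pi: a nonsplit extension can only go from degree d
   to d + 1, and the degree filtration is the Harder-Narasimhan filtration. Such
   phases exist once Z_0 / Pi_B[1] and all the ratios Z_{d+1} / Z_d lie in the open
   upper half plane, and they then vary continuously with the charges.

   With y = - Re (log x), the quotients Pi_B[i] / Pi_B[1] are a multiple of
   (log x)^(i-1) up to O(y^(i-2)). In Im (Z_{d+1} conj Z_d) the square of the top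
   quotient cancels, and what is left is a positive integer (a minor of two
   consecutive rows of the powers of M_infty) times Im (Pi_B[3] conj Pi_B[4]), of
   order y^5 and positive, up to O(y^4). The asymptotics follow from
   w(x, p) = x^p H(x, p), where H is differentiated in p term by term: the ratio of
   consecutive coefficients of H is a polynomial in 1 / (p + n + 1), so all their
   derivatives grow at most geometrically, and the Gamma function is smooth by
   differentiation under the integral sign, after shifting its argument by the
   functional equation.

   The argument of Z_1 / Z_0 stays below pi but tends to pi at x = 0, so it differs
   at two points of a real ray. If all the tilted hearts of two such stability
   conditions agreed, then so would their phases: the Euler characteristic at a
   vertex s is non-positive on the heart when the phase of s is at most the cut,
   and positive on s. *)

Require Import Defs.
From mathcomp Require Import all_boot all_order all_algebra.
From mathcomp Require Import all_classical all_reals all_analysis.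
From mathcomp Require Import complex measurable_realfun zify ring lra.

Set Implicit Arguments.
Unset Strict Implicit.
Unset Printing Implicit Defensive.

Import Order.TTheory GRing.Theory Num.Theory.
Import numFieldNormedType.Exports.

Local Open Scope complex_scope.
Local Open Scope ring_scope.

(** * Euler characteristics *)

Section EulerCharacteristic.
Variable R : realType.
Local Notation C := R[i].

(** One radius must serve every point with |arg x| <= A, so all estimates are bounds in powers of y
    whose constants are uniform on a half-strip of values of log x. The analytic obstacle is to
    bound three p-derivatives of the coefficients for all n at once: only the coefficient at n = 0
    is estimated through Gamma itself, and the exact ratio carries the bound from n to n + 1 at the
    cost of a fixed factor. The sign comes from the powers of 2 pi i: the leading coefficients of
    Pi_B[3] / Pi_B[1] and Pi_B[4] / Pi_B[1] are real and purely imaginary, so their cross term keeps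
    an imaginary part of full order y^5. The square of the top quotient enters Z_1 conj Z_0 with
    coefficient -4, which makes the real part of order - y^6 against an imaginary part O(y^5); this
    drives the argument to pi. No branch of the logarithm of a charge is chosen: phases are sums of
    arguments in (0, pi) of successive ratios. Since the last rows of the powers of M_infty have
    period 5, the charges can be treated in every natural degree by five cases. *)

Lemma dim_ses (X Y Z : rep R) (f : rhom X Y) (g : rhom Y Z) s :
  is_ses f g -> \dim {: Y s} = (\dim {: X s} + \dim {: Z s})%N.
Proof.
move=> /(_ s)[kf fg img].
rewrite -(limg_ker_dim (g s)) capfv img -fg.
by rewrite -(limg_ker_dim (f s) fullv) kf capv0 dimv0 add0n.
Qed.

Lemma dim_rep_iso (V W : rep R) s :
  rep_iso V W -> \dim {: V s} = \dim {: W s}.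
Proof.
case=> f /(_ s)[kf imf].
by rewrite -imf -(limg_ker_dim (f s) fullv) kf capv0 dimv0 add0n.
Qed.

(** Injectivity gives f(Z) :&: B' = f(B) and places the kernel of f on Z inside B; surjectivity
    gives f(Z) + B' = Z'. The conclusion is dim Z / B = dim Z' / B' without subtraction of
    naturals. *)
Lemma dim_subquotient_iso (V W : vectType C) (Z B : {vspace V})
    (Z' B' : {vspace W}) (f : 'Hom(V, W)) :
  (B <= Z)%VS -> (B' <= Z')%VS -> (f @: Z <= Z')%VS -> (f @: B <= B')%VS ->
  (forall v, v \in Z -> f v \in B' -> v \in B) ->
  (forall w, w \in Z' -> exists2 v, v \in Z & w - f v \in B') ->
  (\dim Z + \dim B' = \dim Z' + \dim B)%N.
Proof.
move=> BZ BZ' fZ fB inj surj.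
have sumE : (f @: Z + B')%VS = Z'.
  apply/eqP; rewrite eqEsubv subv_add fZ BZ' /=; apply/subvP => w /surj[v vZ wv].
  by apply/memv_addP; exists (f v); [exact: memv_img|exists (w - f v);
    rewrite // addrC subrK].
have capE : (f @: Z :&: B')%VS = (f @: B)%VS.
  apply/eqP; rewrite eqEsubv subv_cap fB limgS // !andbT.
  apply/subvP => w /memv_capP[/memv_imgP[v vZ ->] fv].
  by apply: memv_img; exact: inj.
have kerE : (Z :&: lker f)%VS = (B :&: lker f)%VS.
  apply/eqP; rewrite eqEsubv [X in _ && X]capvS // andbT subv_cap capvSr andbT.
  apply/subvP => v /memv_capP[vZ]; rewrite memv_ker => /eqP fv0.
  by apply: inj; rewrite // fv0 mem0v.
have := dimv_sum_cap (f @: Z)%VS B'; rewrite sumE capE.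
by have := limg_ker_dim f Z; have := limg_ker_dim f B; rewrite kerE; lia.
Qed.

(** The window is -N <= i <= N with i = k - N; the exponent k + N is a natural number of the same
    parity as i. *)
Definition altsum N (D : int -> nat) : int :=
  \sum_(k < N.*2.+1) (-1) ^+ (k + N) * (D (k%:Z - N%:Z))%:Z.

Lemma altsum_widen N M D : (N <= M)%N ->
  (forall i, (N < `|i|)%N -> D i = 0%N) -> altsum M D = altsum N D.
Proof.
move=> /subnK <- D0; elim: (M - N)%N => // m IH.
rewrite addSn -[RHS]IH /altsum doubleS big_ord_recl big_ord_recr /=.
rewrite [D (0 - _)]D0; last by lia.
rewrite [D ((m + N).*2.+2%:Z - _)]D0; last by lia.
rewrite mulr0 add0r mulr0 addr0; apply: eq_bigr => k _.
have -> : (bump 0 k + (m + N).+1 = (k + (m + N)).+2)%N by rewrite /bump; lia.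
rewrite !exprS mulN1r mulN1r opprK.
congr (_ * (D _)%:Z). by rewrite /bump; lia.
Qed.

(* [D i = z i + b i] is the splitting of dimensions by cycles and boundaries,
   [z (i + 1) - b i] being the dimension of cohomology. *)
Lemma altsum_cohomology N (z b z' b' : int -> nat) :
  (forall i, (N <= `|i|)%N -> (z i + b i = 0)%N) ->
  (forall i, (N <= `|i|)%N -> (z' i + b' i = 0)%N) ->
  (forall i, (z (i + 1)%R + b' i = z' (i + 1)%R + b i)%N) ->
  altsum N (fun i => (z i + b i)%N) = altsum N (fun i => (z' i + b' i)%N).
Proof.
move=> D0 D0' zb; apply/eqP; rewrite -subr_eq0 -sumrB; apply/eqP.
(* By [zb], z - z' at i + 1 equals b - b' at i, so the alternating terms telescope and only the last
   boundary discrepancy survives. *)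
suff tele n : \sum_(k < n) ((-1) ^+ (k + N)
      * (z (k%:Z - N%:Z)%R + b (k%:Z - N%:Z)%R)%N%:Z - (-1) ^+ (k + N)
      * (z' (k%:Z - N%:Z)%R + b' (k%:Z - N%:Z)%R)%N%:Z) = - (-1) ^+ (n + N)
      * ((b (n%:Z - N%:Z - 1))%:Z - (b' (n%:Z - N%:Z - 1))%:Z).
  rewrite tele; have := D0 (N.*2.+1%:Z - N%:Z - 1); have := D0' (N.*2.+1%:Z - N%:Z - 1).
  by move=> /(_ ltac:(lia))/eqP; rewrite addn_eq0 => /andP[_ /eqP->]
    /(_ ltac:(lia))/eqP; rewrite addn_eq0 => /andP[_ /eqP->]; rewrite subrr mulr0.
elim: n => [|n IH].
  rewrite big_ord0; have := D0 (0%:Z - N%:Z - 1); have := D0' (0%:Z - N%:Z - 1).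
  by move=> /(_ ltac:(lia))/eqP; rewrite addn_eq0 => /andP[_ /eqP->]
    /(_ ltac:(lia))/eqP; rewrite addn_eq0 => /andP[_ /eqP->]; rewrite subrr mulr0.
rewrite big_ord_recr /= IH; have := zb (n%:Z - N%:Z - 1); rewrite subrK.
have -> : n.+1%:Z - N%:Z - 1 = n%:Z - N%:Z by lia.
rewrite addSn exprS mulN1r opprK => e.
rewrite -mulrBr mulNr addrC -mulrBr; congr (_ * _); move: e.
set z1 := z _; set z1' := z' _; set b1 := b (_ - 1); set b1' := b' (_ - 1).
by lia.
Qed.

Definition cpx_dim (X : cpx R) s (i : int) : nat := \dim {: X i s}.

(** [cbounded] only asserts that a bound exists, so one is chosen; [euler_charE] shows that every
    bound gives the same value. *)
Definition euler_char (X : cpx R) s : int :=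
  altsum (projT1 (cid (cbounded X))) (cpx_dim X s).

Lemma euler_charE (X : cpx R) s N :
  (forall i, (N < `|i|)%N -> is_zero (X i)) ->
  euler_char X s = altsum N (cpx_dim X s).
Proof.
rewrite /euler_char; case: cid => M /= XM XN.
rewrite -(altsum_widen (leq_maxl M N)) => [|i iM]; last exact: XM.
by apply: altsum_widen => [|i iN]; [exact: leq_maxr|exact: XN].
Qed.

Lemma cpx_common_bound (X Y : cpx R) : exists N, forall i, (N < `|i|)%N ->
  is_zero (X i) /\ is_zero (Y i).
Proof.
have [[M XM] [N YN]] := (cbounded X, cbounded Y).
by exists (maxn M N) => i; rewrite gtn_max => /andP[iM iN]; split; [exact: XM|exact: YN].
Qed.

Lemma euler_char_quasi_iso (X Y : cpx R) (f : cmap X Y) s :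
  quasi_iso f -> euler_char X s = euler_char Y s.
Proof.
move=> qf; have [N XY] := cpx_common_bound X Y.
(* The window is one wider than the support: the telescoping needs the terms at its two ends to
   vanish. *)
have XN i : (N.+1 < `|i|)%N -> is_zero (X i) by move=> iN; have [] := XY i (ltnW iN).
have YN i : (N.+1 < `|i|)%N -> is_zero (Y i) by move=> iN; have [] := XY i (ltnW iN).
rewrite (euler_charE s XN) (euler_charE s YN).
have dimE (W : cpx R) : cpx_dim W s =
    (fun i => \dim (lker (cdiff W i s)) + \dim (limg (cdiff W i s)))%N.
  by apply/funext => i; rewrite /cpx_dim -(limg_ker_dim (cdiff W i s) fullv) capfv.
rewrite !dimE; apply: altsum_cohomology => i.
- by move=> Ni; have [/(_ s) + _] := XY i Ni; rewrite -/(cpx_dim X s i) dimE.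
- by move=> Ni; have [_ /(_ s)] := XY i Ni; rewrite -/(cpx_dim Y s i) dimE.
have BZ (W : cpx R) : (limg (cdiff W i s) <= lker (cdiff W (i + 1) s))%VS.
  apply/subvP => _ /memv_imgP[v _ ->]; rewrite memv_ker.
  by rewrite -comp_lfunE cdiffK zero_lfunE.
have [inj surj] := qf i s.
apply: (dim_subquotient_iso (BZ X) (BZ Y) _ _ inj surj).
- apply/subvP => _ /memv_imgP[v + ->]; rewrite !memv_ker => /eqP dv.
  by rewrite -comp_lfunE -cmap_comm comp_lfunE dv linear0.
- apply/subvP => _ /memv_imgP[_ /memv_imgP[v _ ->] ->].
  by rewrite -comp_lfunE cmap_comm comp_lfunE memv_img // memvf.
Qed.

Lemma euler_char_iso (X Y : cpx R) s :
  iso_T X Y -> euler_char X s = euler_char Y s.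
Proof.
by case=> W [f [g [qf qg]]];
  rewrite -(euler_char_quasi_iso s qf) (euler_char_quasi_iso s qg).
Qed.

Lemma euler_char_ses (X Y Z : cpx R) s : ses_cpx X Y Z ->
  euler_char Y s = euler_char X s + euler_char Z s.
Proof.
case=> f [g fg].
have [N XZ] := cpx_common_bound X Z.
rewrite !(@euler_charE _ s N) => [|i /XZ[//]|i /XZ[//]|i /XZ[X0 Z0] t].
  by rewrite /altsum -big_split /=; apply: eq_bigr => k _;
    rewrite -mulrDr -PoszD /cpx_dim (dim_ses s (fg _)).
by rewrite (dim_ses t (fg i)) X0 Z0.
Qed.

Lemma euler_char_stalk (Q : rep R) s : euler_char (stalk Q) s = \dim {: Q s}.
Proof.
rewrite (@euler_charE _ s 0) => [|[[|i]|i] // _ t]; last 2 first.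
- by rewrite /= dimvf /dim /= mul1n.
- by rewrite /= dimvf /dim /= mul1n.
by rewrite /altsum big_ord_recl big_ord0 /= mul1r addr0.
Qed.

Lemma euler_char_shift_stalk (Q : rep R) s :
  euler_char (shift_cpx (stalk Q)) s = - (\dim {: Q s})%:Z.
Proof.
have z0 t : \dim {: zero_rep R t} = 0%N by rewrite dimvf /dim /= mul1n.
rewrite (@euler_charE _ s 1) => [|i i1 t]; last first.
  by rewrite /=; case: eqP => [|_]; [lia|exact: (z0 t)].
rewrite /altsum /cpx_dim /shift_cpx /stalk /= !big_ord_recl big_ord0 /= (z0 s).
by rewrite !mulr0 !addr0 expr1 mulN1r.
Qed.

Lemma euler_char_zero s : euler_char (stalk (zero_rep R)) s = 0.
Proof. by rewrite euler_char_stalk dimvf /dim /= mul1n. Qed.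

End EulerCharacteristic.

(** * Representations graded by degree *)

Section GradedPieces.
Variable R : realType.
Local Notation C := R[i].

Lemma degree_arrow s s' : arrow s s' -> degree s' = (degree s).+1.
Proof.
case/existsP=> i /andP[/eqP si /forallP sj].
rewrite /degree [LHS](bigD1 i) //= si [in RHS](bigD1 i) //= -addSn; congr (_ + _)%N.
by apply: eq_bigr => j ji; have /implyP/(_ ji)/eqP-> := sj j.
Qed.

Lemma degree_le15 s : (degree s <= 15)%N.
Proof.
rewrite /degree (leq_trans (n := (\sum_(i < 5) 3)%N)) //;
  last by rewrite sum_nat_const card_ord.
by apply: leq_sum => i _; rewrite -ltnS ltn_ord.
Qed.

Lemma lfun_dim0l (V W : vectType C) (f : 'Hom(V, W)) : \dim {: V} = 0%N -> f = 0.
Proof.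
move=> /eqP; rewrite dimv_eq0 => /eqP V0; apply/lfunP => v.
by have := memvf v; rewrite V0 memv0 => /eqP->; rewrite !linear0.
Qed.

Lemma lfun_dim0r (V W : vectType C) (f : 'Hom(V, W)) : \dim {: W} = 0%N -> f = 0.
Proof.
move=> /eqP; rewrite dimv_eq0 => /eqP W0; apply/lfunP => v; rewrite zero_lfunE.
by have := memvf (f v); rewrite W0 memv0 => /eqP.
Qed.

Definition supported (d : nat) (V : rep R) : Prop :=
  forall s, degree s <> d -> \dim {: V s} = 0%N.

(** An arrow raises the degree by one, so its source and target cannot both carry a nonzero
    space. *)
Lemma rmap_supported d (V : rep R) s s' (a : arrow s s') :
  supported d V -> rmap V a = 0.
Proof.
move=> Vd; case: (eqVneq (degree s) d) => [sd|/eqP sd].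
  by apply/lfun_dim0r/Vd; rewrite (degree_arrow a) sd; lia.
exact/lfun_dim0l/Vd.
Qed.

Lemma supported_unique d d' (V : rep R) :
  ~ is_zero V -> supported d V -> supported d' V -> d = d'.
Proof.
move=> V0 Vd Vd'; apply/eqP/negP => /negP dd'; apply: V0 => s.
by case: (eqVneq (degree s) d) => [sd|/eqP/Vd//]; apply: Vd'; rewrite sd; exact/eqP.
Qed.

Lemma hom_vanishes_supported d d' (V W : rep R) : d <> d' ->
  supported d V -> supported d' W -> hom_vanishes V W.
Proof.
move=> dd' Vd Wd' f s; case: (eqVneq (degree s) d) => [sd|/eqP/Vd sd].
  by apply/lfun_dim0r/Wd'; rewrite sd.
exact: lfun_dim0l.
Qed.

(* An extension of [Q] by [Q'] can only be non-split along an arrow from the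
   degree of [Q] to that of [Q']: otherwise any family of linear sections is a
   morphism, since all the maps it has to commute with vanish. *)
Lemma ext1_supported d d' (Q Q' : rep R) : supported d Q -> supported d' Q' ->
  ext1_nonzero Q Q' -> d' = d.+1.
Proof.
move=> Qd Qd' [E [f [g [fg nosplit]]]]; apply/eqP/negP => /negP dd'.
have nat s s' (a : arrow s s') :
    ((g s')^-1 \o rmap Q a = rmap E a \o (g s)^-1)%VF.
  rewrite (rmap_supported a Qd) comp_lfun0r.
  case: (eqVneq (degree s) d) => [sd|/eqP/Qd sd]; last first.
    by rewrite (lfun_dim0l (_ \o _)%VF).
  rewrite (lfun_dim0r (rmap E a)) ?comp_lfun0l // (dim_ses s' fg).
  rewrite Qd ?Qd' // (degree_arrow a) sd; last by lia.
  by apply/eqP; rewrite eq_sym.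
apply: nosplit; exists (RHom nat) => s /=; apply/lfunP => v.
by have [_ _ img] := fg s; rewrite comp_lfunE id_lfunE limg_lfunVK // img memvf.
Qed.

(** * Sub- and quotient representations *)

Section Subrepresentation.
Variables (V : rep R) (U : forall s, {vspace V s}).
Hypothesis U_stable : forall s s' (a : arrow s s') v,
  v \in U s -> rmap V a v \in U s'.

Let incl s : 'Hom(subvs_of (U s), V s) := linfun vsval.
Let retr s : 'Hom(V s, subvs_of (U s)) := linfun (vsproj (U s)).
(** The quotient by [U s] is realised on the complement [(U s)^C]: [proj] is the projection along
    [U s], [sect] the inclusion. *)
Let proj s : 'Hom(V s, subvs_of (U s)^C) :=
  (linfun (vsproj (U s)^C) \o daddv_pi (U s)^C (U s))%VF.
Let sect s : 'Hom(subvs_of (U s)^C, V s) := linfun vsval.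

Let inclE s u : incl s u = vsval u. Proof. by rewrite lfunE. Qed.

Let inclK s v : v \in U s -> incl s (retr s v) = v.
Proof. by move=> vU; rewrite inclE lfunE vsprojK. Qed.

Let incl_inj s : injective (incl s).
Proof. by move=> u v; rewrite !inclE => /val_inj. Qed.

Let cap0 s : ((U s)^C :&: U s)%VS = 0%VS.
Proof. by rewrite capvC capv_compl. Qed.

Let proj_eq0 s v : (proj s v == 0) = (v \in U s).
Proof.
have /(daddv_pi_add (cap0 s)) vE :
  v \in ((U s)^C + U s)%VS by rewrite addvC addv_complf memvf.
rewrite /proj comp_lfunE lfunE /=; apply/eqP/idP => [p0|vU].
  by rewrite -vE -(vsprojK (memv_pi _ _ _)) p0 linear0 add0r memv_pi.
suff -> : daddv_pi (U s)^C (U s) v = 0 by rewrite linear0.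
by move: vE; rewrite [X in _ + X]daddv_pi_id ?capv_compl // => /(canRL (addrK _));
  rewrite subrr.
Qed.

Let projK s u : proj s (sect s u) = u.
Proof.
rewrite /proj comp_lfunE !lfunE /= daddv_pi_id ?cap0 //; last exact: subvsP.
by rewrite vsvalK.
Qed.

Definition subrep : rep R.
Proof.
exists (fun s => subvs_of (U s)) (fun s s' a => retr s' \o rmap V a \o incl s)%VF.
move=> s a b s' sa as' sb bs'; apply/lfunP => u.
have uU : incl s u \in U s by rewrite inclE subvsP.
apply: incl_inj; rewrite !comp_lfunE !inclK ?U_stable ?inclE ?U_stable ?subvsP //.
by rewrite -!comp_lfunE (rmap_square V sa as' sb bs').
Defined.

Let quotmap s s' (a : arrow s s') := (proj s' \o rmap V a \o sect s)%VF.

(** The difference of v and [sect s (proj s v)] lies in [U s], which the arrow maps into the kernel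
    [U s'] of [proj s']. *)
Let quotmapE s s' (a : arrow s s') v : quotmap a (proj s v) = proj s' (rmap V a v).
Proof.
have -> : quotmap a (proj s v) = proj s' (rmap V a (sect s (proj s v))).
  by rewrite /quotmap !comp_lfunE.
apply/eqP; rewrite -subr_eq0 -linearB proj_eq0 -linearB U_stable //.
by rewrite -proj_eq0 linearB /= projK subrr.
Qed.

Definition quotrep : rep R.
Proof.
exists (fun s => subvs_of (U s)^C) (fun s s' a => quotmap a).
move=> s a b s' sa as' sb bs'; apply/lfunP => u.
rewrite -[u]projK [LHS]comp_lfunE [RHS]comp_lfunE !quotmapE; congr (proj _ _).
by rewrite -!comp_lfunE (rmap_square V sa as' sb bs').
Defined.

Lemma subrep_ses : ses subrep V quotrep.
Proof.
have fnat s s' (a : arrow s s') : (incl s' \o rmap subrep a = rmap V a \o incl s)%VF.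
  apply/lfunP => u; rewrite !comp_lfunE inclK // U_stable //.
  by rewrite inclE subvsP.
have gnat s s' (a : arrow s s') : (proj s' \o rmap V a = rmap quotrep a \o proj s)%VF.
  by apply/lfunP => v; rewrite [LHS]comp_lfunE -quotmapE [RHS]comp_lfunE.
exists (@RHom R subrep V incl fnat), (@RHom R V quotrep proj gnat) => s; split => /=.
- by apply/eqP/lker0P; exact: incl_inj.
- apply/eqP; rewrite eqEsubv; apply/andP; split; apply/subvP => v.
    by move=> /memv_imgP[u _ ->]; rewrite memv_ker proj_eq0 inclE subvsP.
  rewrite memv_ker proj_eq0 => vU; rewrite -(inclK vU).
  by apply: memv_img; exact: memvf.
- apply/eqP; rewrite eqEsubv subvf /=; apply/subvP => u _.
  by rewrite -(projK u) memv_img // memvf.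
Qed.

Lemma dim_subrep s : \dim {: subrep s} = \dim (U s).
Proof. by rewrite dimvf. Qed.

Lemma dim_quotrep s : \dim {: quotrep s} = (\dim {: V s} - \dim (U s))%N.
Proof. by rewrite dimvf /= -dimv_compl. Qed.

End Subrepresentation.

End GradedPieces.

(** * Stability conditions determined by the degree *)

Section GradedStability.
Import VectorInternalTheory.
Variable R : realType.
Local Notation C := R[i].

Definition graded (V : rep R) : Prop :=
  ~ is_zero V /\ exists d, supported d V.

(** The default 0 is returned when V is not supported in one degree. A zero V is supported in every
    degree, whence the nonvanishing assumption of [rep_degreeE]. *)
Definition rep_degree (V : rep R) : nat := xget 0%N [set d | supported d V]%classic.

Lemma rep_degreeE d (V : rep R) : ~ is_zero V -> supported d V -> rep_degree V = d.
Proof.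
move=> V0 Vd; rewrite /rep_degree; case: xgetP => [e _ /= Ve|/(_ d)//].
exact: supported_unique Ve Vd.
Qed.

(** The map is the identity in coordinates, written as [pid_mx] because the two dimensions are equal
    only by a proof. *)
Lemma lfun_iso_of_dim (V W : vectType C) : \dim {: V} = \dim {: W} ->
  exists2 f : 'Hom(V, W), lker f = 0%VS & limg f = fullv.
Proof.
rewrite !dimvf => VW.
pose f : 'Hom(V, W) := linfun (r2v \o (mulmxr (pid_mx (dim W)) \o v2r)).
have f_inj : lker f = 0%VS.
  apply/eqP/lker0P => u v; rewrite !lfunE /= => /(can_inj r2vK).
  move: (v2r u) (v2r v) (can_inj (@v2rK _ V) (x1 := u) (x2 := v)).
  rewrite -VW => x y xy; rewrite pid_mx_1 !mulmx1; exact: xy.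
exists f => //; apply/eqP; rewrite eqEdim subvf /=.
by have := limg_ker_dim f fullv; rewrite f_inj capv0 dimv0 add0n !dimvf VW => ->.
Qed.

(** All arrows act by zero on both sides, so any family of linear isomorphisms is a morphism. *)
Lemma rep_iso_of_dim d (V W : rep R) : supported d V -> supported d W ->
  (forall s, \dim {: V s} = \dim {: W s}) -> rep_iso V W.
Proof.
move=> Vd Wd VW.
have f_ s : {f : 'Hom(V s, W s) | lker f = 0%VS /\ limg f = fullv}.
  by apply: cid; have [f f0 f1] := lfun_iso_of_dim (VW s); exists f.
have nat s s' (a : arrow s s') :
    (projT1 (f_ s') \o rmap V a = rmap W a \o projT1 (f_ s))%VF.
  by rewrite (rmap_supported a Vd) (rmap_supported a Wd) comp_lfun0l comp_lfun0r.
exists (RHom nat) => s; exact: projT2 (f_ s).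
Qed.

Lemma dim_simple s s' : \dim {: simple R s s'} = (s' == s).
Proof. by rewrite dimvf /dim /= mul1n. Qed.

Lemma simple_supported s : supported (degree s) (simple R s).
Proof. by move=> s' ss'; rewrite dim_simple; case: eqP => // ss; rewrite ss in ss'. Qed.

Lemma simple_neq0 s : ~ is_zero (simple R s).
Proof. by move/(_ s); rewrite dim_simple eqxx. Qed.

Lemma not_is_zeroP (V : rep R) : ~ is_zero V -> exists s, (0 < \dim {: V s})%N.
Proof.
move=> V0; apply: contrapT => V_; apply: V0 => s; apply/eqP; rewrite -leqn0 leqNgt.
by apply/negP => Vs; apply: V_; exists s.
Qed.

Lemma ses_supported d (X Y Z : rep R) : ses X Y Z -> supported d Y ->
  supported d X /\ supported d Z.
Proof.
by case=> f [g fg] Yd; split=> s /Yd; rewrite (dim_ses s fg); lia.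
Qed.

(** Since arrows act by zero, a line at a single vertex is a subrepresentation. If its quotient
    vanishes, V has the dimensions of a simple and is isomorphic to it. *)
Lemma supported_indecomposable d (V : rep R) : ~ is_zero V -> supported d V ->
  (forall s, ~ rep_iso V (simple R s)) ->
  exists V1 V2 : rep R, [/\ ~ is_zero V1, ~ is_zero V2 & ses V1 V V2].
Proof.
move=> V0 Vd Vsimple; have [s Vs] := not_is_zeroP V0.
pose U s' : {vspace V s'} := if s' == s then <[vpick fullv]>%VS else 0%VS.
have dimU s' : \dim (U s') = (s' == s).
  rewrite /U; case: eqP => [->|_]; rewrite ?dimv0 // dim_vline vpick0 -dimv_eq0.
  by rewrite -lt0n Vs.
have Ust s1 s2 (a : arrow s1 s2) v : v \in U s1 -> rmap V a v \in U s2.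
  by rewrite (rmap_supported a Vd) zero_lfunE mem0v.
have sd : degree s = d by apply/eqP/negP => /negP/eqP/Vd; lia.
exists (subrep Ust), (quotrep Ust); split; last exact: subrep_ses.
  by move/(_ s); rewrite dim_subrep dimU eqxx.
move=> Q0; apply: (Vsimple s); apply: rep_iso_of_dim Vd _ _ => [|s'].
  by rewrite -sd; exact: simple_supported.
have := Q0 s'; rewrite dim_quotrep dimU dim_simple => /eqP; rewrite subn_eq0 => Vs'.
apply/eqP; rewrite eqn_leq Vs' /=; by case: eqP => // ->.
Qed.

(** Arrows raise the degree, so the part of degree above b is a subrepresentation, with quotient
    concentrated in degree b. Degrees are at most 15, so [16 - b] serves for the induction; the
    lower bound on the [d i] yields their strict increase when a step is prepended. *)
Lemma degree_filtration b (E : rep R) : ~ is_zero E ->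
  (forall s, (degree s < b)%N -> \dim {: E s} = 0%N) ->
  exists (n : nat) (F Q : nat -> rep R) (d : nat -> nat),
  [/\ F 0%N = E, is_zero (F n),
      forall i, (i < n)%N ->
        [/\ ~ is_zero (Q i), supported (d i) (Q i) & ses (F i.+1) (F i) (Q i)],
      forall i, (i.+1 < n)%N -> (d i < d i.+1)%N
    & forall i, (i < n)%N -> (b <= d i)%N].
Proof.
move kE : (16 - b)%N => k; elim: k b kE E => [|k IH] b kb E E0 Eb.
  by case: E0 => s; apply: Eb; have := degree_le15 s; lia.
have [Eb'|Eb'] := pselect (forall s, (degree s < b.+1)%N -> \dim {: E s} = 0%N).
  have [|n [F [Q [d [F0 Fn FQ dd bd]]]]] := IH b.+1 _ E E0 Eb'; first by lia.
  by exists n, F, Q, d; split=> // i ni; rewrite ltnW // bd.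
pose U s : {vspace E s} := if (b < degree s)%N then fullv else 0%VS.
have Ust s1 s2 (a : arrow s1 s2) v : v \in U s1 -> rmap E a v \in U s2.
  rewrite /U (degree_arrow a); case: (ltnP b (degree s1)) => [bs|_].
    by rewrite ifT ?memvf // ltnS ltnW.
  by rewrite memv0 => /eqP->; rewrite linear0 mem0v.
have Q0b : supported b (quotrep Ust).
  move=> s sb; rewrite dim_quotrep /U; case: ltnP => [_|bs]; first by rewrite subnn.
  by rewrite Eb //; lia.
have Q00 : ~ is_zero (quotrep Ust).
  move=> Q0; apply: Eb' => s; rewrite ltnS => sb.
  by have := Q0 s; rewrite dim_quotrep /U ltnNge sb /= dimv0 subn0.
have QE := subrep_ses Ust.
have [S0|S0] := pselect (is_zero (subrep Ust)).
  exists 1%N, (fun i => if i is _.+1 then subrep Ust else E), (fun=> quotrep Ust),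
    (fun=> b).
  by split=> // -[].
have Sb s : (degree s < b.+1)%N -> \dim {: subrep Ust s} = 0%N.
  by rewrite ltnS dim_subrep /U ltnNge => ->; rewrite dimv0.
have [|n [F [Q [d [F0 Fn FQ dd bd]]]]] := IH b.+1 _ _ S0 Sb; first by lia.
exists n.+1, (fun i => if i is j.+1 then F j else E),
  (fun i => if i is j.+1 then Q j else quotrep Ust),
  (fun i => if i is j.+1 then d j else b); split=> // -[|i] //.
- by move=> _; rewrite F0.
- exact: FQ.
- by rewrite ltnS; exact: bd.
- by rewrite ltnS; exact: dd.
- by move/bd/ltnW.
Qed.

(** The object enters only through its Euler characteristics, which supply the invariance and
    additivity required of a homomorphism on K(T). *)
Definition graded_charge (zeta : nat -> C) (X : cpx R) : C :=
  \sum_s (euler_char X s)%:~R * zeta (degree s).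

Lemma graded_charge_simple zeta s :
  graded_charge zeta (stalk (simple R s)) = zeta (degree s).
Proof.
rewrite /graded_charge (bigD1 s) //= big1 => [|s' /negPf ss'].
  by rewrite addr0 euler_char_stalk dim_simple eqxx mul1r.
by rewrite euler_char_stalk dim_simple ss' mul0r.
Qed.

Lemma graded_chargeZ (c : C) zeta X :
  graded_charge (fun d => c * zeta d) X = c * graded_charge zeta X.
Proof. by rewrite /graded_charge mulr_sumr; apply: eq_bigr => s _; rewrite mulrCA. Qed.

Section Construction.
Variables (zeta : nat -> C) (phi : nat -> R).
Hypothesis zeta_phi : forall d, exists2 m : R, 0 < m & zeta d = m%:C * cis (phi d).
Hypothesis phi_step : forall d, phi d < phi d.+1 < phi d + pi.

Let graded_phase (V : rep R) : R := phi (rep_degree V).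

Let phi_mono : {mono phi : d d' / (d < d')%N >-> d < d'}.
Proof.
have up d d' : (d < d')%N -> phi d < phi d'.
  elim: d' => // d' IH; have /andP[dd _] := phi_step d'.
  by rewrite ltnS leq_eqVlt => /predU1P[->//|/IH/lt_trans]; apply.
move=> d d'; case: (ltngtP d d') => [/up//|/up dd|->]; last by rewrite ltxx.
by apply/negbTE; rewrite -leNgt ltW.
Qed.

Definition graded_stability : stability R.
Proof.
refine (@Stability R (graded_charge zeta) _ _ graded graded_phase _ _ _ _ _ _).
- by move=> X Y XY; apply: eq_bigr => s _; rewrite (euler_char_iso s XY).
- move=> X Y Z XYZ; rewrite -big_split; apply: eq_bigr => s _ /=.
  by rewrite (euler_char_ses s XYZ) intrD mulrDl.
- by move=> Q [].
- move=> Q Q' QQ' [Q0 [d Qd]]; split=> [Q'0|].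
    by apply: Q0 => s; rewrite (dim_rep_iso s QQ').
  by exists d => s /Qd; rewrite (dim_rep_iso s QQ').
- move=> Q [Q0 [d Qd]]; have [m m0 zd] := zeta_phi d.
  (* All simples of degree d share one charge, so the mass is the total dimension of Q times the
     modulus m of [zeta d]. *)
  exists ((\sum_s \dim {: Q s})%N%:R * m).
    rewrite mulr_gt0 // ltr0n; have [s Qs] := not_is_zeroP Q0.
    by rewrite (bigD1 s) //= addn_gt0 Qs.
  rewrite /graded_phase (rep_degreeE Q0 Qd) rmorphM /= rmorph_nat -mulrA -zd.
  rewrite natr_sum mulr_suml; apply: eq_bigr => s _; rewrite euler_char_stalk.
  case: (eqVneq (degree s) d) => [->//|/eqP/Qd->]; by rewrite !mul0r.
- move=> Q Q' [Q0 [d Qd]] [Q'0 [d' Q'd']] /(ext1_supported Qd Q'd') dd'.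
  rewrite /graded_phase (rep_degreeE Q0 Qd) (rep_degreeE Q'0 Q'd') dd'.
  by have := phi_step d; rewrite ltr_norml; lra.
- move=> Q Q' [Q0 [d Qd]] [Q'0 [d' Q'd']].
  rewrite /graded_phase (rep_degreeE Q0 Qd) (rep_degreeE Q'0 Q'd') phi_mono => dd'.
  by apply: hom_vanishes_supported Q'd' Qd => d'd; rewrite d'd ltnn in dd'.
- move=> E E0; have [//|n [F [Q [d [F0 Fn FQ dd _]]]]] := degree_filtration (b := 0) E0.
  exists n, F, Q; split=> // i ni; have [Q0 Qd FF] := FQ _ ni.
    by split=> //; split=> //; exists (d i).
  have [Qi0 Qid _] := FQ _ (ltnW ni).
  by rewrite /graded_phase (rep_degreeE Q0 Qd) (rep_degreeE Qi0 Qid) phi_mono dd.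
Defined.

Lemma graded_stability_phase d Q : ~ is_zero Q -> supported d Q ->
  phase graded_stability Q = phi d.
Proof. by move=> Q0 Qd; rewrite /= /graded_phase (rep_degreeE Q0 Qd). Qed.

(** A simple has total dimension one, which two nonzero constituents would exceed. Conversely a
    non-simple Q of one degree splits off a line, and both constituents have its phase. *)
Lemma graded_stability_stable Q :
  stable graded_stability Q <-> exists s, rep_iso Q (simple R s).
Proof.
split=> [[[Q0 [d Qd]] Qst]|[s Qs]].
  apply: contrapT => Qsimple; apply: Qst.
  have [//|V1 [V2 [V10 V20 V12]]] := supported_indecomposable Q0 Qd.
    by move=> s Qs; apply: Qsimple; exists s.
  have [V1d V2d] := ses_supported V12 Qd.
  exists V1, V2; split=> //.
  - by split; split=> //; exists d.
  - by rewrite !(@graded_stability_phase d).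
  - by rewrite !(@graded_stability_phase d).
have dimQ s' : \dim {: Q s'} = (s' == s) by rewrite (dim_rep_iso s' Qs) dim_simple.
split.
  split; first by move/(_ s); rewrite dimQ eqxx.
  by exists (degree s) => s' /simple_supported; rewrite dimQ dim_simple.
case=> Q1 [Q2 [[[/not_is_zeroP[s1 Q1s1] _] [/not_is_zeroP[s2 Q2s2] _]] _ _ [f [g fg]]]].
have := dim_ses s1 fg; have := dim_ses s2 fg; rewrite !dimQ.
by do 2![case: eqP => [?|_]; subst]; lia.
Qed.

End Construction.

Lemma graded_stability_rotation r theta zeta phi zp ps zeta' phi' zp' ps' :
  (forall d, zeta' d = r%:C * cis theta * zeta d) ->
  (forall d, phi' d = phi d + theta) ->
  dilation_rotation r theta (@graded_stability zeta phi zp ps)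
    (@graded_stability zeta' phi' zp' ps').
Proof.
move=> zz pp; split=> // [X|Q _]; last exact: pp.
by rewrite /= -graded_chargeZ; apply: eq_bigr => s _; rewrite zz.
Qed.

(** A property rather than an equation with [graded_stability], so that it also covers an arbitrary
    rotation [sigma''], of which only the charge, the semistable objects and their phases are
    known. *)
Definition graded_with (phi : nat -> R) (sigma : stability R) : Prop :=
  (forall Q, semistable sigma Q <-> graded Q) /\
  forall d Q, ~ is_zero Q -> supported d Q -> phase sigma Q = phi d.

(** The inequality passes to extensions, so generators suffice: an unshifted one has phase above x
    and thus vanishes at s, a shifted one counts negatively. *)
Lemma tilted_heart_euler_char_le0 sigma phi x s X : graded_with phi sigma ->
  phi (degree s) <= x -> tilted_heart sigma x X -> euler_char X s <= 0.
Proof.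
move=> [sst ph] xs; elim=> {X} [X [Q Qss QX]||X Y XY _|X Y Z XYZ _ X0 _ Z0].
- have [Q0 [d Qd]] := (sst Q).1 Qss; case: QX => [[Qx ->]|[_ ->]]; last first.
    by rewrite euler_char_shift_stalk oppr_le0.
  rewrite euler_char_stalk Qd // => sd.
  by move: Qx; rewrite (ph d) // ltNge -sd xs.
- by rewrite euler_char_zero.
- by rewrite (euler_char_iso s XY).
- by rewrite (euler_char_ses s XYZ) -[0]addr0 lerD.
Qed.

(** Cut at [phi' (degree s)]. If s had a larger phase for [sigma], it would lie unshifted in the
    heart of [sigma], while its Euler characteristic 1 excludes it from that of [sigma']. *)
Lemma tilted_hearts_phase_le sigma phi sigma' phi' s :
  graded_with phi sigma -> graded_with phi' sigma' ->
  (forall x, same_heart (tilted_heart sigma x) (tilted_heart sigma' x)) ->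
  phi (degree s) <= phi' (degree s).
Proof.
move=> gs gs' hh; rewrite leNgt; apply/negP => ps.
suff /hh/(tilted_heart_euler_char_le0 gs' (lexx (phi' (degree s)))) :
    tilted_heart sigma (phi' (degree s)) (stalk (simple R s)).
  by rewrite euler_char_stalk dim_simple eqxx.
apply: ext_closure_gen; exists (simple R s).
  apply/gs.1; split; first exact: simple_neq0.
  by exists (degree s); exact: simple_supported.
by left; rewrite (gs.2 (degree s)) //; [exact: simple_neq0|exact: simple_supported].
Qed.

(** A rotation adds the same angle to every phase, so phase differences between two degrees are
    invariant under it. *)
Lemma graded_not_dilation_rotation sigma phi sigma' phi' s s' :
  graded_with phi sigma -> graded_with phi' sigma' ->
  phi (degree s) - phi (degree s') <> phi' (degree s) - phi' (degree s') ->
  not_dilation_rotation sigma sigma'.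
Proof.
move=> gs gs' pp r theta sigma'' r0 [_ sst ph]; apply: contrapT => nowall.
have gs'' : graded_with (fun d => phi d + theta) sigma''.
  split=> [Q|d Q Q0 Qd]; first by split=> [/sst/gs.1//|/gs.1/sst].
  by rewrite ph ?(gs.2 d) //; apply/gs.1; split=> //; exists d.
have hh x : same_heart (tilted_heart sigma'' x) (tilted_heart sigma' x).
  by apply: contrapT => hx; apply: nowall; exists x.
have hh' x : same_heart (tilted_heart sigma' x) (tilted_heart sigma'' x).
  by move=> X; split=> /hh.
have e t : phi' (degree t) = phi (degree t) + theta.
  by apply/eqP; rewrite eq_le (tilted_hearts_phase_le t gs' gs'') //
    (tilted_hearts_phase_le t gs'' gs').
by apply: pp; rewrite !e; lra.
Qed.

Lemma dilation_rotation_id (sigma : stability R) : dilation_rotation 1 0 sigma sigma.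
Proof.
by split=> // [X|Q _]; rewrite ?addr0 // mul1r /cis cos0 sin0 mul1r.
Qed.

Lemma not_dilation_rotation_wall (sigma sigma' : stability R) :
  not_dilation_rotation sigma sigma' -> wall_crossing2 sigma sigma'.
Proof. by move/(_ 1 0 sigma ltr01 (dilation_rotation_id sigma)). Qed.

End GradedStability.

(** * The Gamma function *)

Section Gamma.
Variable R : realType.
Local Open Scope classical_set_scope.
Local Notation mu := (@lebesgue_measure R).

Definition gamma_fun (z t : R) : R := t `^ (z - 1) * expR (- t).

(** Extended-real valued, so that the functional equation can be proved first and then used to
    obtain finiteness. *)
Definition gammaE (z : R) : \bar R := (\int[mu]_(t in `](0%R : R),
  +oo[) (gamma_fun z t)%:E)%E.

Lemma gamma_fun_ge0 z t : 0 <= gamma_fun z t.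
Proof. by rewrite mulr_ge0 ?powR_ge0 ?expR_ge0. Qed.

Lemma derivable_powRl (y t : R) : 0 < t -> derivable (fun a : R => a `^ y) t 1.
Proof. by move=> t0; apply: ex_derive; exact: is_derive1_powR. Qed.

Lemma continuous_powRl (y t : R) : 0 < t -> {for t, continuous (fun a : R => a `^ y)}.
Proof.
move=> t0; apply: differentiable_continuous; apply/derivable1_diffP.
exact: derivable_powRl.
Qed.

Lemma continuous_expRN (t : R) : {for t, continuous (fun a : R => expR (- a))}.
Proof.
by apply: (@continuous_comp _ _ _ (@GRing.opp R) (@expR R));
  [exact: opp_continuous|exact: continuous_expR].
Qed.

Lemma is_derive_NexpRN (t : R) :
  is_derive t (1 : R) (fun a : R => - expR (- a)) (expR (- t)).
Proof.
rewrite [X in is_derive _ _ _ X](_ : _ = - (expR (- t) * - 1)); last by ring.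
exact: is_deriveN (is_derive1_comp (is_derive_expR (- t)) (is_deriveNid t 1)).
Qed.

Lemma continuous_gamma_fun z t : 0 < t -> {for t, continuous (gamma_fun z)}.
Proof.
by move=> t0; apply: cvgM; [exact: continuous_powRl|exact: continuous_expRN].
Qed.

Lemma measurable_gamma_fun z : measurable_fun `](0%R : R), +oo[ (gamma_fun z).
Proof.
apply: open_continuous_measurable_fun; first exact: interval_open.
by move=> t; rewrite inE /= in_itv /= andbT; exact: continuous_gamma_fun.
Qed.

(** The m-th power of x / m <= exp (x / m) gives (x / m)^m <= exp x; for m = 0 the claim is z <= -1
    with 0^0 = 1. *)
Lemma powR_expRN_le (z x : R) (m : nat) : 1 <= x -> z + 1 <= m%:R ->
  x `^ z * expR (- x) <= m%:R ^+ m / x.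
Proof.
move=> x1 zm; have x0 : 0 < x by rewrite (lt_le_trans _ x1).
case: m zm => [|m] zm.
  have /ler_powR/(_ _ _ (_ : z <= -1)) : 1 <= x by [].
  move=> /(_ ltac:(lra)) xz; rewrite expr0 mul1r -(powR_inv1 (ltW x0)).
  by rewrite (le_trans _ xz) // ler_piMr ?powR_ge0 // -expR0 ler_expR; lra.
have xm : (x / m.+1%:R) ^+ m.+1 <= expR x.
  rewrite -[X in expR X](@divfK _ m.+1%:R) ?pnatr_eq0 // expRM_natr.
  rewrite lerXn2r ?nnegrE ?expR_ge0 //; first by rewrite divr_ge0 // ltW.
  by rewrite (le_trans _ (expR_ge1Dx _)) // lerDr.
rewrite expRN ler_pdivrMr ?expR_gt0 //.
apply: (@le_trans _ _ (m.+1%:R ^+ m.+1 / x * (x / m.+1%:R) ^+ m.+1)); last first.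
  by apply: ler_wpM2l => //; rewrite divr_ge0 ?exprn_ge0 // ltW.
have c0 : m.+1%:R ^+ m.+1 != 0 :> R by rewrite expf_neq0 ?pnatr_eq0.
rewrite expr_div_n [x ^+ _]exprS.
have -> : m.+1%:R ^+ m.+1 / x * (x * x ^+ m / m.+1%:R ^+ m.+1) = x ^+ m.
  by field; rewrite c0 gt_eqF.
rewrite -powR_mulrn; last exact: ltW.
by apply: ler_powR => //; move: zm; rewrite -natr1; lra.
Qed.

(** Integration by parts on compact intervals exhausting the half-line; the integrals converge
    monotonically and the boundary terms tend to 0. *)
Lemma gammaE_rec z : 0 < z -> gammaE (z + 1) = (z%:E * gammaE z)%E.
Proof.
move=> z0.
(* The shift by 2 ensures a n < 1 < b n already at n = 0. *)
pose a n : R := n.+2%:R^-1; pose b n : R := n.+2%:R.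
have a0 n : 0 < a n by rewrite invr_gt0 ltr0n.
have ab n : a n < b n by rewrite (@lt_trans _ _ 1) ?invf_lt1 ?ltr1n ?ltr0n.
pose E n := `[a n, b n]%classic.
have EI n t : E n t -> 0 < t.
  by rewrite /E /= in_itv /= => /andP[at_ _]; exact: lt_le_trans (a0 n) at_.
have EU : \bigcup_n E n = `](0%R : R), +oo[.
  apply/seteqP; split=> t; first by case=> n _ /EI; rewrite /= in_itv /= andbT.
  rewrite /= in_itv /= andbT => t0.
  have [n tn] : exists n : nat, t + t^-1 < n%:R.
    by exists (Num.trunc (t + t^-1)).+1; rewrite truncnS_gt.
  have tV0 : 0 < t^-1 by rewrite invr_gt0.
  have nn : n%:R <= n.+2%:R :> R by rewrite ler_nat; lia.
  exists n => //; rewrite /E /= in_itv /= /a /b; apply/andP; split; last by lra.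
  by rewrite -[t]invrK lef_pV2 ?posrE //; lra.
have ndE : nondecreasing_seq E.
  move=> m n mn; rewrite subsetEset => t; rewrite /E /= !in_itv /= => /andP[at_ tb].
  have mn' : m.+2%:R <= n.+2%:R :> R by rewrite ler_nat; lia.
  rewrite (le_trans tb) // (le_trans _ at_) // /a lef_pV2 ?posrE ?ltr0n //.
have cvgE y : (\int[mu]_(t in E n) (gamma_fun y t)%:E @[n --> \oo] --> gammaE y)%E.
  rewrite /gammaE -EU; apply: ge0_nondecreasing_set_cvg_integral => //.
  - by move=> n; exact: measurable_itv.
  - by move=> n; apply/measurable_EFinP;
      apply: measurable_funS (measurable_gamma_fun y) => //;
      move=> t /EI; rewrite /= in_itv /= andbT.
  - by move=> n t _; rewrite lee_fin gamma_fun_ge0.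
pose c n : R := (b n) `^ z * - expR (- b n) - (a n) `^ z * - expR (- a n).
have parts n : (\int[mu]_(t in E n) (gamma_fun (z + 1) t)%:E =
    (c n)%:E + z%:E * \int[mu]_(t in E n) (gamma_fun z t)%:E)%E.
  have within_cont (f : R -> R) : (forall t : R, 0 < t -> {for t, continuous f}) ->
      {within `[a n, b n], continuous f}.
    by move=> cf; apply: continuous_in_subspaceT => t; rewrite inE => /EI/cf.
  have cNexp (t : R) : {for t, continuous (fun t : R => - expR (- t))}.
    by apply: cvgN; exact: continuous_expRN.
  have czpow (t : R) : 0 < t -> {for t, continuous (fun t : R => z * t `^ (z - 1))}.
    by move=> t0; apply: cvgM; [exact: cvg_cst|exact: continuous_powRl].
  rewrite (_ : (\int[mu]_(t in E n) _ = \int[mu]_(t in E n) (t `^ z * expR (-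
    t))%:E)%E); last first.
    by apply: eq_integral => t _; rewrite /gamma_fun addrK.
  rewrite (@integration_by_parts R (fun t => t `^ z) (fun t => - expR (- t))
    (fun t => z * t `^ (z - 1)) (fun t => expR (- t)) (a n) (b n) (ab n)).
  - rewrite -/(c n); congr (_ + _)%E.
    rewrite -integralZl //=; [|exact: measurable_itv|].
      rewrite -integralN /=; last first.
        apply: integrable_add_def; first exact: measurable_itv.
        apply: continuous_compact_integrable; first exact: segment_compact.
        by apply: within_cont => t t0; apply: cvgM; [exact: czpow|exact: cNexp].
      by apply: eq_integral => t _; rewrite -EFinM /gamma_fun; congr EFin; ring.
      apply: continuous_compact_integrable; first exact: segment_compact.
      by apply: within_cont => t; exact: continuous_gamma_fun.
  - exact: within_cont.
  - split=> [t|//|//].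
    + by rewrite in_itv /= => /andP[at_ _]; apply: derivable_powRl;
        exact: lt_trans (a0 n) at_.
    + by apply: cvg_at_right_filter; exact: continuous_powRl.
    + by apply: cvg_at_left_filter; apply: continuous_powRl; exact: lt_trans (ab n).
  - move=> t; rewrite in_itv /= => /andP[at_ _].
    by rewrite powR_derive1 // in_itv /= andbT (lt_trans (a0 n)).
  - by apply: within_cont => t _; exact: continuous_expRN.
  - split=> [t _|//|//].
    + by apply: ex_derive; exact: is_derive_NexpRN.
    + by apply: cvg_at_right_filter; exact: cNexp.
    + by apply: cvg_at_left_filter; exact: cNexp.
  - by move=> t _; rewrite derive1E; have [_] := is_derive_NexpRN t.
have c0 : c n @[n --> \oo] --> 0.
  have aC : a n @[n --> \oo] --> 0.
    by rewrite (cvg_shiftS (@harmonic R : nat -> R)); exact: cvg_harmonic.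
  have [M zM] : exists M : nat, z + 1 <= M%:R.
    by exists (Num.trunc (z + 1)).+1; rewrite ltW // truncnS_gt.
  rewrite (_ : 0 = - 0 + 0); last by rewrite oppr0 addr0.
  rewrite (_ : c = (fun n => - (b n `^ z * expR (- b n)) + a n `^ z * expR (- a n)));
    last first.
    by apply/funext => n; rewrite /c; ring.
  have ge0 y w : 0 <= y `^ z * expR w by rewrite mulr_ge0 ?powR_ge0 ?expR_ge0.
  (* At b n the exponential dominates the power; at a n the power itself tends to 0 because z >
     0. *)
  apply: cvgD; first apply: cvgN.
    apply: (@squeeze_cvgr _ _ _ _ (cst 0) (fun n => M%:R ^+ M * a n)).
    - by near=> n; rewrite ge0 /= powR_expRN_le // ler1n.
    - exact: cvg_cst.
    - by rewrite -[X in _ --> X](mulr0 (M%:R ^+ M)); apply: cvgM => //; exact: cvg_cst.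
  apply: (@squeeze_cvgr _ _ _ _ (cst 0) (fun n => a n `^ z)).
  - near=> n; rewrite ge0 /= ler_piMr ?powR_ge0 // -expR0 ler_expR oppr_le0.
    exact: ltW.
  - exact: cvg_cst.
  - by move/cvg_at_rightP: (powR_cvg0 z0); apply; split.
have lim : ((c n)%:E + z%:E * \int[mu]_(t in E n) (gamma_fun z t)%:E @[n --> \oo]
    --> 0%:E + z%:E * gammaE z)%E.
  apply: cvgeD; first by rewrite fin_num_adde_defr.
    by apply: cvg_EFin => //; exact: nearW.
  by apply: cvgeZl => //; exact: cvgE.
rewrite -(funext parts) add0e in lim.
by apply: (cvg_unique _ (cvgE (z + 1)) lim).
Unshelve. all: by end_near. Qed.

End Gamma.

(** * Finiteness and smoothness of the Gamma function *)

Section GammaSmooth.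
Variable R : realType.
Local Open Scope classical_set_scope.
Local Notation mu := (@lebesgue_measure R).
Local Notation pos := `](0%R : R), +oo[.

Lemma gamma_fun1 (t : R) : gamma_fun 1 t = expR (- t).
Proof. by rewrite /gamma_fun subrr powRr0 mul1r. Qed.

Lemma gammaE1 : gammaE (1 : R) = 1%E.
Proof.
rewrite /gammaE integral_itv_obnd_cbnd; last first.
  by apply/measurable_EFinP; exact: measurable_gamma_fun.
rewrite (@ge0_continuous_FTC2y _ _ (fun t => - expR (- t)) _ 0).
- by rewrite oppr0 expR0 EFinN oppeK add0e.
- by move=> t _; exact: gamma_fun_ge0.
- rewrite (_ : gamma_fun 1 = fun t => expR (- t)); last by apply/funext => t;
    exact: gamma_fun1.
  by apply: continuous_subspaceT => t; exact: continuous_expRN.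
- by rewrite -oppr0; apply: cvgN; exact: cvgr_expR.
- by move=> t _; apply: ex_derive; exact: is_derive_NexpRN.
- by apply: cvg_at_right_filter; apply: cvgN; exact: continuous_expRN.
- move=> t _; rewrite gamma_fun1 derive1E.
  by have [_] := is_derive_NexpRN t.
Qed.

Lemma gammaE_nat n : gammaE (n.+1%:R : R) = (n`!%:R)%:E.
Proof.
elim: n => [|n IH]; first by rewrite gammaE1.
by rewrite -natr1 gammaE_rec ?ltr0n // IH -EFinM factS natrM mulrC.
Qed.

Lemma gammaE_ge0 (z : R) : (0 <= gammaE z)%E.
Proof. by apply: integral_ge0 => t _; rewrite lee_fin gamma_fun_ge0. Qed.

Lemma gamma_fun_le (z y t : R) : 0 < t -> 1 <= z -> z <= y ->
  gamma_fun z t <= gamma_fun 1 t + gamma_fun y t.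
Proof.
move=> t0 z1 zy; rewrite /gamma_fun -mulrDl ler_wpM2r ?expR_ge0 // subrr powRr0.
have [t1|t1] := leP t 1.
  apply: (@le_trans _ _ 1); last by rewrite lerDl powR_ge0.
  by rewrite -[leRHS](powRr0 t); apply: ger_powR; rewrite ?t0 //; lra.
apply: (@le_trans _ _ (t `^ (y - 1))); last by rewrite lerDr.
by apply: ler_powR; [exact: ltW|lra].
Qed.

(** For z >= 1 the integrand is dominated by those at 1 and at a larger integer, whose integrals are
    factorials; below 1 the functional equation reduces to z + 1. *)
Lemma gammaE_fin (z : R) : 0 < z -> gammaE z \is a fin_num.
Proof.
have ge1 (y : R) : 1 <= y -> gammaE y \is a fin_num.
  move=> y1; have [n yn] : exists n : nat, y <= n.+1%:R.
    by exists (Num.trunc y); rewrite ltW // truncnS_gt.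
  rewrite ge0_fin_numE ?gammaE_ge0 //.
  apply: (@le_lt_trans _ _ (gammaE 1 + gammaE n.+1%:R)%E); last first.
    by rewrite gammaE1 gammaE_nat -EFinD ltry.
  have mg w : measurable_fun pos (EFin \o gamma_fun w).
    by apply/measurable_EFinP; exact: measurable_gamma_fun.
  have g0 w (t : R) : pos t ->
    (0 <= (gamma_fun w t)%:E)%E by rewrite lee_fin gamma_fun_ge0.
  have mpos : measurable pos by exact: measurable_itv.
  rewrite -(ge0_integralD mu mpos (g0 1) (mg 1) (g0 _) (mg _)).
  apply: ge0_le_integral => //; first exact: g0.
  - exact: mg.
  - by apply: emeasurable_funD; exact: mg.
  - by move=> t; rewrite /= in_itv /= andbT => t0; rewrite -EFinD lee_fin gamma_fun_le.
move=> z0; have := ge1 (z + 1) ltac:(lra); rewrite gammaE_rec //.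
by case: (gammaE z) (gammaE_ge0 z) => [//|_|//]; rewrite gt0_muley ?lte_fin.
Qed.

Lemma integrable_gamma_fun (z : R) : 0 < z -> mu.-integrable pos (EFin \o gamma_fun z).
Proof.
move=> z0; apply/integrableP; split.
  by apply/measurable_EFinP; exact: measurable_gamma_fun.
under eq_integral do rewrite /= ger0_norm ?gamma_fun_ge0 //.
by rewrite -ge0_fin_numE ?gammaE_fin // gammaE_ge0.
Qed.

Lemma GammaE (z : R) : Gamma z = fine (gammaE z).
Proof. by []. Qed.

Lemma Gamma_rec (z : R) : 0 < z -> Gamma (z + 1) = z * Gamma z.
Proof. by move=> z0; rewrite !GammaE gammaE_rec // fineM // gammaE_fin. Qed.

Lemma Gamma_nat n : Gamma (n.+1%:R : R) = n`!%:R.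
Proof. by rewrite GammaE gammaE_nat. Qed.

(** The j-th derivative in z of the Gamma integrand. *)
Definition log_gamma_fun (j : nat) (z t : R) : R := ln t ^+ j * gamma_fun z t.

(** For j <= 5 and 6 <= z <= 10, |ln t|^j t^(z - 1) is at most t^(z - 1 - j) <= 1 when t <= 1, and
    at most t^(z - 1 + j) <= t^14 when t > 1. Hence the arguments 1 and 15. *)
Definition gamma_majorant (t : R) : R := gamma_fun 1 t + gamma_fun 15 t.

Lemma log_gamma_fun_le (j : nat) (z t : R) : 0 < t -> (j <= 5)%N -> 6 <= z <= 10 ->
  `|log_gamma_fun j z t| <= gamma_majorant t.
Proof.
move=> t0 j5 /andP[z6 z10].
have j5' : j%:R <= 5 :> R by rewrite ler_nat.
have j0 : 0 <= j%:R :> R by [].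
rewrite normrM normrX [`|gamma_fun _ _|]ger0_norm ?gamma_fun_ge0 //.
rewrite /gamma_majorant /gamma_fun mulrA -mulrDl.
rewrite ler_wpM2r ?expR_ge0 // subrr powRr0.
have [t1|t1] := leP t 1.
  apply: (@le_trans _ _ 1); last by rewrite lerDl powR_ge0.
  have lnt : `|ln t| <= t^-1.
    rewrite ler0_norm ?ln_le0 // -lnV ?posrE //.
    by apply: ltW; apply: ln_sublinear; rewrite invr_gt0.
  apply: (@le_trans _ _ (t^-1 ^+ j * t `^ (z - 1))).
    by rewrite ler_wpM2r ?powR_ge0 // lerXn2r // nnegrE ?invr_ge0 // ltW.
  rewrite exprVn -powR_invn; last exact: ltW.
  rewrite -powRD; last by apply/implyP => _; rewrite gt_eqF.
  by rewrite -[leRHS](powRr0 t); apply: ger_powR; rewrite ?t0 //; lra.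
apply: (@le_trans _ _ (t `^ (15 - 1))); last by rewrite lerDr.
have lnt : `|ln t| <= t.
  by rewrite ger0_norm ?ln_ge0 // ltW //; apply: ln_sublinear.
apply: (@le_trans _ _ (t ^+ j * t `^ (z - 1))).
  by rewrite ler_wpM2r ?powR_ge0 // lerXn2r // nnegrE ltW.
rewrite -powR_mulrn; last exact: ltW.
rewrite -powRD; last by apply/implyP => _; rewrite gt_eqF.
by apply: ler_powR; [exact: ltW|lra].
Qed.

Lemma integrable_gamma_majorant : mu.-integrable pos (EFin \o gamma_majorant).
Proof.
rewrite (_ : EFin \o _ = (EFin \o gamma_fun 1) \+ (EFin \o gamma_fun 15))%E //.
by apply: integrableD => //; exact: integrable_gamma_fun.
Qed.

Lemma integrable_log_gamma_fun (j : nat) (z : R) : (j <= 5)%N -> 6 <= z <= 10 ->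
  mu.-integrable pos (EFin \o log_gamma_fun j z).
Proof.
move=> j5 z610; apply: le_integrable integrable_gamma_majorant => //.
  apply/measurable_EFinP; apply: measurable_funM; last exact: measurable_gamma_fun.
  by apply: measurable_funX; apply: measurable_funTS; exact: measurable_ln.
move=> t; rewrite /= in_itv /= andbT => t0; rewrite lee_fin.
rewrite [leRHS]ger0_norm ?log_gamma_fun_le //.
by rewrite addr_ge0 ?gamma_fun_ge0.
Qed.

(** Centred at 8, so that |p| < 2 keeps the argument in [6, 10], where [gamma_majorant]
    dominates. *)
Definition log_gamma (j : nat) (p : R) : R :=
  (\int[mu]_(t in pos) log_gamma_fun j (8 + p) t)%R.

Lemma Gamma_log_gamma (p : R) : Gamma (8 + p) = log_gamma 0 p.
Proof. by apply: eq_Rintegral => t _; rewrite /log_gamma_fun expr0 mul1r. Qed.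

Lemma log_gamma_le (j : nat) (p : R) : (j <= 5)%N -> `|p| < 2 ->
  `|log_gamma j p| <= (\int[mu]_(t in pos) gamma_majorant t)%R.
Proof.
move=> j5 p2; have z610 : 6 <= 8 + p <= 10 by move: p2; rewrite ltr_norml; lra.
have int_j := integrable_log_gamma_fun j5 z610.
apply: (le_trans (le_normr_Rintegral _ int_j)) => //.
apply: le_Rintegral => //.
- exact: integrable_norm int_j.
- exact: integrable_gamma_majorant.
- by move=> t; rewrite /= in_itv /= andbT => t0; exact: log_gamma_fun_le.
Qed.

Lemma is_derive_log_gamma (j : nat) (p : R) : (j <= 4)%N -> `|p| < 2 ->
  is_derive p 1 (log_gamma j) (log_gamma j.+1 p).
Proof.
move=> j4 p2.
have dfun (t x : R) : 0 < t ->
    is_derive x 1 (fun q => log_gamma_fun j (8 + q) t) (log_gamma_fun j.+1 (8 + x) t).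
  move=> t0.
  have -> : (fun q => log_gamma_fun j (8 + q) t) =
      (fun q => (ln t ^+ j * expR (- t)) * expR (ln t * (7 + q))).
    apply/funext => q; rewrite /log_gamma_fun /gamma_fun /powR gt_eqF //.
    by rewrite /= (_ : (8 + q - 1) * ln t = ln t * (7 + q)); ring.
  have daff : is_derive x 1 (fun q => ln t * (7 + q)) (ln t).
    have H := is_deriveZ (ln t) (is_deriveD (is_derive_cst (7 :
      R) x 1) (is_derive_id x (1 : R))).
    by apply: (is_derive_eq H); rewrite /GRing.scale /= add0r mulr1.
  have H := is_deriveZ (ln t ^+ j * expR (- t)) (is_derive1_comp (is_derive_expR _) daff).
  apply: (is_derive_eq H).
  rewrite /log_gamma_fun /gamma_fun /powR gt_eqF // exprS /GRing.scale /=.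
  by rewrite (_ : (8 + x - 1) * ln t = ln t * (7 + x)); ring.
have dE (x t : R) : 0 < t -> partial1of2 (fun q => log_gamma_fun j (8 + q)) x t =
    log_gamma_fun j.+1 (8 + x) t.
  by move=> t0; rewrite partial1of2E; have [_] := dfun t x t0.
have Ip (x : R) : `](-2)%R, 2%R[%classic x -> 6 <= 8 + x <= 10.
  by rewrite /= in_itv /=; lra.
have pI : `](-2)%R, 2%R[%classic p by rewrite /= in_itv /=; move: p2; rewrite ltr_norml.
have intf (x : R) : `](-2)%R,
  2%R[%classic x -> mu.-integrable pos (EFin \o log_gamma_fun j (8 + x)).
  by move=> /Ip; apply: integrable_log_gamma_fun; exact: leq_trans j4 _.
have derf (x t : R) : `](-2)%R,
  2%R[%classic x -> pos t -> derivable (fun q : R => log_gamma_fun j (8 + q) t) x 1.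
  by move=> _; rewrite /= in_itv /= andbT => t0; apply: ex_derive; exact: dfun.
have maj0 t : 0 <= gamma_majorant t by rewrite addr_ge0 ?gamma_fun_ge0.
have maj (x t : R) : `](-2)%R, 2%R[%classic x -> pos t ->
    `|partial1of2 (fun q => log_gamma_fun j (8 + q)) x t| <= gamma_majorant t.
  by move=> /Ip xI; rewrite /= in_itv /= andbT => t0; rewrite dE ?log_gamma_fun_le.
have logE : log_gamma j = fun q =>
  (\int[mu]_(t in pos) log_gamma_fun j (8 + q) t)%R by [].
rewrite logE; apply: DeriveDef.
  by apply: (@derivable_under_integral _ _ _ mu (fun q t => log_gamma_fun j (8 + q) t)
    pos _ p (-2) 2 pI intf derf gamma_majorant maj0 integrable_gamma_majorant maj).
rewrite -derive1E.
rewrite (@differentiation_under_integral _ _ _ mu (fun q t => log_gamma_fun j (8 + q) t)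
  pos _ p (-2) 2 pI intf derf gamma_majorant maj0 integrable_gamma_majorant maj) //.
by apply: eq_Rintegral => t; rewrite inE /= in_itv /= andbT => t0; exact: dE.
Qed.

End GammaSmooth.

(** * Functions with bounded derivatives *)

Section Jets.
Variable R : realType.
Local Open Scope classical_set_scope.
Implicit Types (d B : R) (f g : R -> R) (k : nat).

(* The derivatives of [f] of order at most [k] exist and are bounded by [B] on
   the interval of radius [d] around [0]. *)
Fixpoint jet d k f B : Prop :=
  (forall p, `|p| < d -> `|f p| <= B) /\
  if k is k'.+1 then
    (forall p, `|p| < d -> derivable f p 1) /\ jet d k' (derive1 f) B
  else True.

Lemma near_lt_normr d (p : R) : `|p| < d -> \forall q \near p, `|q| < d.
Proof.
move=> pd; have dp : 0 < d - `|p| by rewrite subr_gt0.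
near=> q; have qp : `|p - q| < d - `|p|.
  by near: q; apply: (@nbhsx_ballx _ R p _ dp).
rewrite -(subrKC p q) (le_lt_trans (ler_normD _ _)) // -ltrBrDl distrC.
Unshelve. all: by end_near. Qed.

Lemma jet_ext d k f g B : (forall p, `|p| < d -> f p = g p) ->
  jet d k f B -> jet d k g B.
Proof.
elim: k f g => [|k IH] f g fg /= [fB fk].
  by split=> // p pd; rewrite -fg // fB.
have nfg p : `|p| < d -> \forall q \near p, f q = g q.
  by move=> /near_lt_normr; apply: filterS => q; exact: fg.
split; first by move=> p pd; rewrite -fg // fB.
case: fk => fd fk; split.
  by move=> p pd; apply: near_eq_derivable (fd _ pd); exact: nfg.
by apply: IH fk => p pd; rewrite !derive1E; apply: near_eq_derive; exact: nfg.
Qed.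

Lemma jet_le d k f B d' k' B' : d' <= d -> (k' <= k)%N -> B <= B' ->
  jet d k f B -> jet d' k' f B'.
Proof.
move=> dd; elim: k k' f => [|k IH] [|k'] f //= kk BB [fB fk].
- by split=> // p pd; apply: (le_trans _ BB); apply: fB; exact: lt_le_trans pd dd.
- by split=> // p pd; apply: (le_trans _ BB); apply: fB; exact: lt_le_trans pd dd.
case: fk => fd fk; split; [|split].
- by move=> p pd; apply: (le_trans _ BB); apply: fB; exact: lt_le_trans pd dd.
- by move=> p pd; apply: fd; exact: lt_le_trans pd dd.
- exact: IH fk.
Qed.

Lemma jet_bound d k f B p : jet d k f B -> `|p| < d -> `|f p| <= B.
Proof. by case: k => [|k] [fB _] /fB. Qed.

Lemma jet_ge0 d k f B : 0 < d -> jet d k f B -> 0 <= B.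
Proof.
by move=> d0 fk; apply: le_trans (normr_ge0 (f 0)) (jet_bound fk _); rewrite normr0.
Qed.

Lemma jet_derivable d k f B p : jet d k.+1 f B -> `|p| < d -> derivable f p 1.
Proof. by move=> [_ [fd _]] /fd. Qed.

Lemma jet_derive d k f B : jet d k.+1 f B -> jet d k (derive1 f) B.
Proof. by move=> [_ []]. Qed.

Lemma jet_derive1n d k j f B : jet d (k + j) f B -> jet d k f^`(j) B.
Proof.
by elim: j f => [|j IH] f; [rewrite addn0|rewrite addnS derive1Sn => /jet_derive/IH].
Qed.

(** The induction step of the closure properties below, with the derivative given by a formula
    instead of [derive1 f]. *)
Lemma jet_is_derive d k f f' B : 0 < d ->
  (forall p, `|p| < d -> `|f p| <= B) ->
  (forall p : R, `|p| < d -> is_derive p 1 f (f' p)) -> jet d k f' B ->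
  jet d k.+1 f B.
Proof.
move=> d0 fB ff' f'k; split=> //; split; first by move=> p /ff' [].
by apply: jet_ext f'k => p /ff' [_ <-]; rewrite derive1E.
Qed.

Lemma jet_cst d k (c : R) : 0 < d -> jet d k (cst c) `|c|.
Proof.
move=> d0; suff H : forall b : R, `|b| <= `|c| -> jet d k (cst b) `|c| by exact: H.
elim: k => [|k IH] b bc; first by split.
by apply: (@jet_is_derive _ _ _ (cst 0)) => //; apply: IH; rewrite normr0.
Qed.

Lemma jetD d k f g B B' : 0 < d -> jet d k f B -> jet d k g B' ->
  jet d k (fun p => f p + g p) (B + B').
Proof.
move=> d0; elim: k f g => [|k IH] f g fk gk.
  split=> // p pd; rewrite (le_trans (ler_normD _ _)) // lerD //.
    exact: jet_bound fk pd.
  exact: jet_bound gk pd.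
apply: (@jet_is_derive _ _ _ (fun p => (derive1 f) p + (derive1 g) p)) => // [p pd|p pd|].
- rewrite (le_trans (ler_normD _ _)) // lerD //; first exact: jet_bound fk pd.
  exact: jet_bound gk pd.
- rewrite !derive1E; apply: is_deriveD; apply: DeriveDef => //.
    exact: jet_derivable fk pd.
  exact: jet_derivable gk pd.
- by apply: IH; exact: jet_derive.
Qed.

(** Each use of the product rule doubles the number of products to bound, whence the factor
    [2 ^+ k]. *)
Lemma jetM d k f g B B' : 0 < d -> jet d k f B -> jet d k g B' ->
  jet d k (fun p => f p * g p) (2 ^+ k * (B * B')).
Proof.
move=> d0; elim: k f g B B' => [|k IH] f g B B' fk gk.
  split=> // p pd; rewrite expr0 mul1r normrM ler_pM //.
    exact: jet_bound fk pd.
  exact: jet_bound gk pd.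
have BB : 0 <= B * B'.
  by rewrite mulr_ge0 //; [exact: jet_ge0 fk|exact: jet_ge0 gk].
apply: (@jet_is_derive _ _ _ (fun p => f p * (derive1 g) p + g p * (derive1 f) p)) =>
  // [p pd|p pd|].
- rewrite normrM; apply: (@le_trans _ _ (B * B')).
    by rewrite ler_pM //; [exact: jet_bound fk pd|exact: jet_bound gk pd].
  by rewrite ler_peMl // exprn_ege1 // ler1n.
- rewrite !derive1E; apply: is_deriveM; apply: DeriveDef => //.
    exact: jet_derivable fk pd.
  exact: jet_derivable gk pd.
- rewrite exprS -mulrA mulr_natl mulr2n; apply: jetD => //.
    apply: IH; last exact: jet_derive.
    exact: jet_le fk.
  rewrite [B * B']mulrC; apply: IH; last exact: jet_derive.
  exact: jet_le gk.
Qed.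

Lemma jetZ d k f B (c : R) : 0 <= c -> 0 < d -> jet d k f B ->
  jet d k (fun p => c * f p) (c * B).
Proof.
move=> c0 d0; elim: k f => [|k IH] f fk.
  by split=> // p pd; rewrite normrM ger0_norm // ler_wpM2l //; exact: jet_bound fk pd.
apply: (@jet_is_derive _ _ _ (fun p => c * (derive1 f) p)) => // [p pd|p pd|].
- by rewrite normrM ger0_norm // ler_wpM2l //; exact: jet_bound fk pd.
- by rewrite derive1E; apply: is_deriveZ; apply: DeriveDef => //;
    exact: jet_derivable fk pd.
- by apply: IH; exact: jet_derive.
Qed.

Lemma jet_comp_scale d k f B (c : R) : 1 <= c -> 0 < d -> jet d k f B ->
  jet (d / c) k (fun p => f (c * p)) (c ^+ k * B).
Proof.
move=> c1 d0; have c0 : 0 < c by rewrite (lt_le_trans _ c1).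
have cd p : `|p| < d / c -> `|c * p| < d.
  by rewrite normrM gtr0_norm // ltr_pdivlMr // mulrC.
elim: k f => [|k IH] f fk; first by split=> // p /cd pd; rewrite mul1r;
  exact: jet_bound fk pd.
have B0 : 0 <= B by exact: jet_ge0 fk.
apply: (@jet_is_derive _ _ _ (fun p => c * (derive1 f) (c * p))) => [|p /cd pd|p /cd pd|].
- by rewrite divr_gt0.
- by rewrite (le_trans (jet_bound fk pd)) // ler_peMl // exprn_ege1.
- have daff : is_derive p 1 ( *%R c) c.
    have H := is_deriveZ c (is_derive_id p (1 : R)).
    by apply: (is_derive_eq H); rewrite /GRing.scale /= mulr1.
  rewrite mulrC derive1E; apply: (@is_derive1_comp R f ( *%R c) p _ c) => //.
  by apply: DeriveDef => //; exact: jet_derivable fk pd.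
- by rewrite exprS -mulrA; apply: jetZ; [lra|exact: divr_gt0|apply: IH;
    exact: jet_derive].
Qed.

Lemma jetN d k f B : 0 < d -> jet d k f B -> jet d k (fun p => - f p) B.
Proof.
move=> d0; elim: k f => [|k IH] f fk.
  by split=> // p pd; rewrite normrN; exact: jet_bound fk pd.
apply: (@jet_is_derive _ _ _ (fun p => - (derive1 f) p)) => // [p pd|p pd|].
- by rewrite normrN; exact: jet_bound fk pd.
- by rewrite derive1E; apply: is_deriveN; apply: DeriveDef => //;
    exact: jet_derivable fk pd.
- by apply: IH; exact: jet_derive.
Qed.

(** The derivative - f' (1/f) (1/f) involves 1/f only to order k, so k derivatives of 1/f bound the
    next one. *)
Lemma jet_inv_step d k f B C B' : 0 < d ->
  (forall p, `|p| < d -> f p != 0 /\ `|(f p)^-1| <= C) ->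
  (forall p, `|p| < d -> derivable f p 1) -> jet d k (derive1 f) B ->
  jet d k (fun p => (f p)^-1) B' ->
  jet d k.+1 (fun p => (f p)^-1) (Num.max C (2 ^+ k * (B * (2 ^+ k * (B' * B'))))).
Proof.
move=> d0 f0 fd fk ik.
apply: (@jet_is_derive _ _ _ (fun p => - ((derive1 f) p * ((f p)^-1 * (f p)^-1)))) =>
  // [p pd|p pd|].
- by have [_ /le_trans->] := f0 _ pd; rewrite // le_max lexx.
- have [fp0 _] := f0 _ pd.
  have H := is_deriveV fp0 (DeriveDef (fd _ pd) erefl).
  apply: (is_derive_eq H); rewrite derive1E /GRing.scale /=.
  by rewrite -exprVn expr2; ring.
- apply: (jet_le (lexx _) (leqnn _) _ (jetN d0 (jetM d0 fk (jetM d0 ik ik)))).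
  by rewrite le_max lexx orbT.
Qed.

(** The order of quantifiers is the point: B' depends neither on f nor on d, so it serves a whole
    family at once. *)
Lemma jet_inv k B C : exists B', forall d f, 0 < d ->
  (forall p, `|p| < d -> f p != 0 /\ `|(f p)^-1| <= C) ->
  (forall p, `|p| < d -> derivable f p 1) -> jet d k (derive1 f) B ->
  jet d k.+1 (fun p => (f p)^-1) B'.
Proof.
elim: k => [|k [B' IH]]; eexists=> d f d0 f0 fd fk; apply: (jet_inv_step d0 f0 fd fk).
  by split=> // p /f0[_]; exact.
apply: IH => //; exact: jet_le (lexx _) (leqnSn _) (lexx _) fk.
Qed.

End Jets.

(** * Derivatives of the hypergeometric coefficients *)

Section HypergeometricCoefficients.
Variable R : realType.
Local Open Scope classical_set_scope.

(** One bound for all members of the family; a single function is treated as a family over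
    [unit]. *)
Definition unif_jet (I : Type) (d : R) (k : nat) (F : I -> R -> R) : Prop :=
  exists B, forall i, jet d k (F i) B.

Section UniformJets.
Variables (I : Type) (d : R) (k : nat).
Hypothesis d0 : 0 < d.
Implicit Types F G : I -> R -> R.

Lemma unif_jet_cst (c : R) : unif_jet d k (fun (_ : I) (_ : R) => c).
Proof. by exists `|c| => i; exact: jet_cst. Qed.

Lemma unif_jetM F G : unif_jet d k F -> unif_jet d k G ->
  unif_jet d k (fun i p => F i p * G i p).
Proof. by move=> [B FB] [B' GB']; eexists=> i; apply: jetM. Qed.

Lemma unif_jetD F G : unif_jet d k F -> unif_jet d k G ->
  unif_jet d k (fun i p => F i p + G i p).
Proof. by move=> [B FB] [B' GB']; eexists=> i; apply: jetD. Qed.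

Lemma unif_jet_prod (J : Type) (r : seq J) (F : J -> I -> R -> R) :
  (forall j, unif_jet d k (F j)) ->
  unif_jet d k (fun i p => \prod_(j <- r) F j i p).
Proof.
move=> FJ; elim: r => [|j r [B IH]].
  by have [B HB] := unif_jet_cst 1; exists B => i; apply: jet_ext (HB i) => p _;
    rewrite big_nil.
have [B' HB'] := unif_jetM (FJ j) (ex_intro _ B IH).
by exists B' => i; apply: jet_ext (HB' i) => p _; rewrite big_cons.
Qed.

Lemma unif_jet_ext F G : (forall i p, `|p| < d -> F i p = G i p) ->
  unif_jet d k F -> unif_jet d k G.
Proof. by move=> FG [B FB]; exists B => i; apply: jet_ext (FB i) => p; exact: FG. Qed.

End UniformJets.

Lemma unif_jet_le (I : Type) (d d' : R) k (F : I -> R -> R) :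
  d' <= d -> unif_jet d k F -> unif_jet d' k F.
Proof. by move=> dd [B FB]; exists B => i;
  exact: jet_le dd (leqnn _) (lexx _) (FB i). Qed.

Lemma normr_invr_le2 (x : R) : 2^-1 <= x -> x != 0 /\ `|x^-1| <= 2.
Proof.
move=> x2; have x0 : 0 < x by lra.
by rewrite gt_eqF // gtr0_norm ?invr_gt0 // invf_ple ?posrE.
Qed.

Lemma jet_shift_inv k : exists B, forall a : R, 1 <= a ->
  jet 2^-1 k (fun p => (p + a)^-1) B.
Proof.
have [B inv] := jet_inv (R := R) k 1 2; exists B => a a1.
have da (p : R) : is_derive p 1 (fun q : R => q + a) 1.
  have H := is_deriveD (is_derive_id p (1 : R)) (is_derive_cst a p 1).
  by apply: (is_derive_eq H); rewrite addr0.
apply: (jet_le (lexx _) (leqnSn _) (lexx B)).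
apply: (inv 2^-1 (fun q => q + a)) => [|p|p _|].
- by rewrite invr_gt0.
- rewrite ltr_norml => /andP[p1 p2]; have pa : 2^-1 <= p + a by lra.
  exact: normr_invr_le2.
- by apply: ex_derive; exact: da.
- apply: (@jet_ext _ _ _ (cst 1)) => [p _|]; last by rewrite -[X in jet _ _ _ X]normr1;
    apply: jet_cst.
  by rewrite derive1E; have [_ ->] := da p.
Qed.

Lemma Gamma_shift (z : R) n : 0 < z ->
  Gamma (z + n%:R) = \prod_(i < n) (z + i%:R) * Gamma z.
Proof.
move=> z0; elim: n => [|n IH]; first by rewrite big_ord0 addr0 mul1r.
rewrite -natr1 addrA Gamma_rec ?IH ?ltr_wpDr //.
by rewrite big_ord_recr /= mulrA [_ * (z + _)]mulrC.
Qed.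

Lemma jet_log_gamma : exists B, forall k j, (j + k <= 5)%N -> jet 2 k (@log_gamma R j) B.
Proof.
exists (\int[@lebesgue_measure R]_(t in `](0%R : R), +oo[) gamma_majorant t)%R.
elim=> [|k IH] j jk; first by split=> // p p2; apply: log_gamma_le => //; lia.
apply: (@jet_is_derive _ _ _ _ (log_gamma j.+1)) => // [p p2|p p2|].
- by apply: log_gamma_le => //; lia.
- by apply: is_derive_log_gamma => //; lia.
- by apply: IH; lia.
Qed.

(** By the functional equation [Gamma (1 + p)] is [Gamma (8 + p)] divided by (p + 1) ... (p + 7),
    and these factors are at least 1/2 on the interval. *)
Lemma jet_Gamma1 : unif_jet 2^-1 3 (fun (_ : unit) (p : R) => Gamma (1 + p)).
Proof.
have h0 : 0 < 2^-1 :> R by rewrite invr_gt0.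
have G8 : unif_jet 2^-1 3 (fun (_ : unit) (p : R) => Gamma (8 + p)).
  have [B HB] := jet_log_gamma; exists B => _.
  apply: (@jet_ext _ _ _ (log_gamma 0)) => [p _|]; first by rewrite Gamma_log_gamma.
  by apply: jet_le (HB 3 0 _); rewrite // -[2^-1]mul1r ler_pdivrMr //; lra.
have Ginv : unif_jet 2^-1 3 (fun (_ : unit) (p : R) => \prod_(i < 7) (p + i.+1%:R)^-1).
  apply: (unif_jet_prod h0) => i; have [B HB] := jet_shift_inv 3.
  have i1 : 1 <= i.+1%:R :> R by rewrite ler1n.
  by exists B => _; apply: HB.
apply: unif_jet_ext (unif_jetM h0 G8 Ginv) => _ p; rewrite ltr_norml => /andP[p1 p2].
have p0 : 0 < 1 + p by lra.
rewrite (_ : 8 + p = 1 + p + 7%:R); last by ring.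
rewrite Gamma_shift // mulrAC -big_split /= big1 ?mul1r // => i _.
have i0 : 0 <= i%:R :> R by [].
have ip : 1 + p + i%:R = p + i.+1%:R by rewrite -natr1; ring.
by rewrite ip mulfV // -ip gt_eqF // ltr_wpDr.
Qed.

(** Gamma equals 1 at 1, so by continuity it stays above 1/2 on some interval, whose radius is d. *)
Lemma jet_Gamma1_inv : exists2 d : R, 0 < d <= 2^-1 &
  unif_jet d 3 (fun (_ : unit) (p : R) => (Gamma (1 + p))^-1).
Proof.
have h0 : 0 < 2^-1 :> R by rewrite invr_gt0.
have [B GB] := jet_Gamma1; have {GB}GB := GB tt.
have dG (p : R) : `|p| < 2^-1 -> derivable (fun q : R => Gamma (1 + q)) p 1.
  exact: jet_derivable GB.
have G0 : Gamma (1 + 0 : R) = 1 by rewrite addr0 (Gamma_nat R 0).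
have /cvgrPdist_lt : {for (0 : R), continuous (fun q : R => Gamma (1 + q))}.
  apply: differentiable_continuous; apply/derivable1_diffP; apply: dG.
  by rewrite normr0.
move=> /(_ _ h0)[e /= e0 eG].
have d0 : 0 < Num.min e 2^-1 by rewrite lt_min e0.
exists (Num.min e 2^-1); first by rewrite d0 ge_min lexx orbT.
have [B' inv] := jet_inv (R := R) 2 B 2; exists B' => _;
  apply: (inv _ (fun q => Gamma (1 + q))) => // [p|p|].
- rewrite lt_min => /andP[pe _]; have := eG p; rewrite /ball_ /= sub0r normrN => /(_ pe).
  rewrite G0 ltr_norml => /andP[G1 G2].
  have G12 : 2^-1 <= Gamma (1 + p) by lra.
  exact: normr_invr_le2.
- by rewrite lt_min => /andP[_]; exact: dG.
- apply: jet_derive; apply: jet_le GB => //.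
  by rewrite ge_min lexx orbT.
Qed.

Definition hyp_coef (n : nat) (p : R) : R :=
  Gamma (1 + 5 * (n%:R + p)) / Gamma (1 + (n%:R + p)) ^+ 5.

Lemma hyp_coef0 : hyp_coef 0 0 = 1.
Proof. by rewrite /hyp_coef addr0 mulr0 addr0 (Gamma_nat R 0) expr1n divr1. Qed.

(** With m = p + n + 1 this is 5m (5m - 1) (5m - 2) (5m - 3) (5m - 4) / m^5, each factor of the
    numerator being divided by one m. *)
Definition hyp_ratio (n : nat) (p : R) : R :=
  5 * \prod_(i < 4) (5 + (i%:R - 4) * (p + n.+1%:R)^-1).

(** The radius 1/10 keeps [1 + 5 * (n%:R + p)] positive; it is also the radius 1/2 of [jet_Gamma1]
    scaled by 5. *)
Lemma hyp_coefS n p : `|p| < 10^-1 -> hyp_coef n.+1 p = hyp_coef n p * hyp_ratio n p.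
Proof.
rewrite ltr_norml => /andP[p1 p2].
have n0 : 0 <= n%:R :> R by [].
have y0 : 0 < 1 + 5 * (n%:R + p) by lra.
have z0 : 0 < 1 + (n%:R + p) by lra.
have np0 : p + n.+1%:R != 0 by rewrite -natr1 gt_eqF //; lra.
rewrite /hyp_coef /hyp_ratio; move: np0; rewrite -[n.+1%:R]natr1 => np0.
rewrite (_ : 1 + 5 * (n%:R + 1 + p) = 1 + 5 * (n%:R + p) + 5%:R); last by ring.
rewrite (_ : 1 + (n%:R + 1 + p) = 1 + (n%:R + p) + 1); last by ring.
rewrite Gamma_shift // Gamma_rec // exprMn invfM !big_ord_recr !big_ord0 /=.
move: (Gamma (1 + 5 * _)) (Gamma _ ^+ 5)^-1 => u v.
move: np0; rewrite (_ : p + (n%:R + 1) = 1 + (n%:R + p)); last by ring.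
rewrite (_ : 1 + 5 * (n%:R + p) = 5 * (1 + (n%:R + p)) - 4); last by ring.
by move: (1 + _) => s s0; field.
Qed.

Lemma jet_hyp_coef : exists d C K : R, [/\ 0 < d, 0 <= C, 1 <= K &
  forall n, jet d 3 (hyp_coef n) (C * K ^+ n)].
Proof.
have [d /andP[d0 d1] Ginv] := jet_Gamma1_inv.
pose e := Num.min d 10^-1.
have e0 : 0 < e by rewrite lt_min d0 invr_gt0 ltr0n.
have ed : e <= d by rewrite ge_min lexx.
have e10 : e <= 10^-1 by rewrite ge_min lexx orbT.
have [B GB] := jet_Gamma1.
have h0 : 0 < 2^-1 :> R by rewrite invr_gt0.
have G5 : unif_jet e 3 (fun (_ : unit) (p : R) => Gamma (1 + 5 * p)).
  exists (5 ^+ 3 * B) => _; have := jet_comp_scale (c := 5) _ h0 (GB tt).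
  move=> /(_ ltac:(lra)); apply: jet_le => //; rewrite (le_trans e10) //; lra.
have c0 : unif_jet e 3 (fun _ : unit => hyp_coef 0).
  have := unif_jetM e0 G5 (unif_jet_prod e0 (index_enum 'I_5) (fun _ =>
    unif_jet_le ed Ginv)).
  apply: unif_jet_ext => _ p _; rewrite /hyp_coef add0r; congr (_ * _).
  by rewrite prodr_const card_ord exprVn.
have rj : unif_jet e 3 hyp_ratio.
  apply: (unif_jetM e0); first exact: unif_jet_cst.
  apply: (unif_jet_prod e0) => i; apply: (unif_jetD e0); first exact: unif_jet_cst.
  apply: (unif_jetM e0); first exact: unif_jet_cst.
  have [K HK] := jet_shift_inv 3; exists K => n.
  have n1 : 1 <= n.+1%:R :> R by rewrite ler1n.
  apply: jet_le (HK _ n1) => //; rewrite (le_trans e10) //; lra.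
have [C HC] := c0; have [K HK] := rj.
have C0 : 0 <= C by exact: jet_ge0 e0 (HC tt).
have K0 : 0 <= K by exact: jet_ge0 e0 (HK 0%N).
(* The factor [2 ^+ 3] is the cost of the product rule for three derivatives; the summand 1 makes
   the ratio at least 1. *)
exists e, C, (1 + 2 ^+ 3 * K); split=> //; first by rewrite lerDl mulr_ge0.
elim=> [|n IH]; first by rewrite mulr1; exact: HC tt.
apply: (@jet_ext _ _ _ (fun p => hyp_coef n p * hyp_ratio n p)) => [p pe|].
  by rewrite hyp_coefS // (lt_le_trans pe).
apply: jet_le (jetM e0 IH (HK n)) => //.
rewrite [_ ^+ n.+1]exprS; set P := (1 + 2 ^+ 3 * K) ^+ n.
have P0 : 0 <= C * P by rewrite mulr_ge0 // exprn_ge0 // addr_ge0 // mulr_ge0 //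
  exprn_ge0.
rewrite (_ : C * ((1 + 2 ^+ 3 * K) * P) = C * P * (1 + 2 ^+ 3 * K)); last by ring.
rewrite (_ : 2 ^+ 3 * (C * P * K) = C * P * (2 ^+ 3 * K)); last by ring.
by rewrite ler_wpM2l // lerDr.
Qed.

End HypergeometricCoefficients.

(** * Series with a geometric majorant *)

Section GeometricallyBoundedSeries.
Variable R : realType.
Local Open Scope classical_set_scope.
Implicit Types (u : nat -> R) (c : R).

(** With the ratio fixed at 1/2 the majorant sums to [2 * c]. *)
Definition geo_bounded c u : Prop := forall n, `|u n| <= c * 2^-1 ^+ n.

Lemma cvg_half_series c : series (fun n => c * 2^-1 ^+ n) @ \oo --> 2 * c.
Proof.
have h : `|2^-1 : R| < 1 by rewrite ger0_norm ?invf_lt1 ?ltr1n.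
have := @cvg_geometric_series R c _ h.
rewrite (_ : (1 - 2^-1)^-1 = 2 :> R) 1?mulrC //.
by rewrite -[2 in RHS]invrK; congr (_^-1); field.
Qed.

Lemma geo_bounded_cvg c u : geo_bounded c u -> cvgn (series u).
Proof.
move=> uc; apply: normed_cvg; apply: (series_le_cvg _ _ uc) => [n|n|].
- exact: normr_ge0.
- exact: le_trans (normr_ge0 _) (uc n).
- by apply/cvg_ex; exists (2 * c); exact: cvg_half_series.
Qed.

Lemma geo_bounded_lim c u : geo_bounded c u -> `|limn (series u)| <= 2 * c.
Proof.
move=> uc; have cc : cvgn (series (fun n => c * 2^-1 ^+ n)).
  by apply/cvg_ex; exists (2 * c); exact: cvg_half_series.
have nu : cvgn [normed series u].
  by apply: (series_le_cvg _ _ uc) => // n; exact: le_trans (normr_ge0 _) (uc n).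
apply: (le_trans (lim_series_norm nu)).
rewrite -(cvg_lim _ (cvg_half_series (c := c))) //.
exact: lim_series_le.
Qed.

Let cnt : {measure set nat -> \bar R} := counting.

Lemma geo_bounded_integrable c u : geo_bounded c u ->
  cnt.-integrable setT (EFin \o u).
Proof.
move=> uc; apply/integrableP; split=> //.
rewrite ge0_integral_count => [|n]; last by rewrite abse_ge0.
have cc : cvgn (series (fun n => c * 2^-1 ^+ n)).
  by apply/cvg_ex; exists (2 * c); exact: cvg_half_series.
apply: (@le_lt_trans _ _ (\sum_(n <oo) (c * 2^-1 ^+ n)%:E)%E).
  by apply: lee_nneseries => n _; rewrite ?abse_ge0 // lee_fin.
rewrite (_ : (\sum_(n <oo) _)%E = (limn (series (fun n => c * 2^-1 ^+ n)))%:E) ?ltry //.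
rewrite -EFin_lim //; apply/congr_lim/funext => n /=.
by rewrite /series /= -sumEFin.
Qed.

Lemma Rintegral_counting c u : geo_bounded c u ->
  (\int[cnt]_n u n)%R = limn (series u).
Proof.
move=> uc; rewrite /Rintegral integral_count; last first.
  have /integrableP[_] := geo_bounded_integrable uc.
  rewrite ge0_integral_count => [|n]; last by rewrite abse_ge0.
  by rewrite /summable -nneseries_esumT // => n; rewrite abse_ge0.
have := EFin_lim (geo_bounded_cvg uc) => E.
rewrite (_ : (\sum_(n <oo) _)%E = (limn (series u))%:E) //.
by rewrite -E; apply/congr_lim/funext => n /=; rewrite /series /= -sumEFin.
Qed.

(* Differentiation under the integral sign for the counting measure. *)
Lemma series_is_derive (g : nat -> R -> R) (d c p : R) :
  (forall n, jet d 1 (g n) (c * 2^-1 ^+ n)) -> `|p| < d ->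
  is_derive p 1 (fun q => limn (series (g ^~ q)))
    (limn (series (fun n => (derive1 (g n)) p))).
Proof.
move=> gj pd; have d0 : 0 < d := le_lt_trans (normr_ge0 p) pd.
have Id (x : R) : `](- d), d[%classic x <-> `|x| < d.
  by rewrite /= in_itv /= ltr_norml.
pose f x n := g n x.
pose G n := c * 2^-1 ^+ n.
have intf (x : R) : `](- d), d[%classic x -> cnt.-integrable setT (EFin \o f x).
  move=> /Id xd; apply: (@geo_bounded_integrable c) => n; exact: jet_bound (gj n) xd.
have derf (x : R) n : `](- d), d[%classic x -> setT n -> derivable (f ^~ n) x 1.
  by move=> /Id xd _; exact: jet_derivable (gj n) xd.
have G0 n : 0 <= G n by exact: jet_ge0 d0 (gj n).
have intG : cnt.-integrable setT (EFin \o G).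
  by apply: (@geo_bounded_integrable c) => n; rewrite ger0_norm // G0.
have ub (x : R) n : `](- d), d[%classic x -> setT n -> `|partial1of2 f x n| <= G n.
  by move=> /Id xd _; exact: jet_bound (jet_derive (gj n)) xd.
have FE : (\forall x \near p, \int[cnt]_n f x n = limn (series (g ^~ x)))%R.
  move/near_lt_normr: (pd); apply: filterS => x xd.
  by apply: (@Rintegral_counting c) => n; exact: jet_bound (gj n) xd.
have pI := (Id p).2 pd.
have mT : measurable (setT : set nat) by [].
have D := derivable_under_integral mT pI intf derf G0 intG ub.
have DE := differentiation_under_integral mT pI intf derf G0 intG ub.
apply: DeriveDef; first exact: near_eq_derivable FE D.
rewrite -(near_eq_derive (1 : R) FE) -derive1E DE.
apply: (@Rintegral_counting c) => n; exact: jet_bound (jet_derive (gj n)) pd.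
Qed.

Lemma series_continuous (f : nat -> R -> R) c :
  (forall n, continuous (f n)) -> (forall t, geo_bounded c (f ^~ t)) ->
  continuous (fun t => limn (series (f ^~ t))).
Proof.
move=> cf fc t.
rewrite (_ : (fun t => _) = fun t => (\int[cnt]_n f n t)%R); last first.
  by apply/funext => x; rewrite (@Rintegral_counting c).
pose g x n := f n x.
have tI : t \in `](t - 1), (t + 1)[%classic.
  by rewrite inE /= in_itv /= ltrDl ltrBlDr ltrDl ltr01.
have c0 : 0 <= c by have := fc t 0%N; rewrite expr0 mulr1; exact: le_trans.
apply: (@continuity_under_integral _ _ _ cnt g setT _ (t - 1) (t + 1) _ _
  (fun n => c * 2^-1 ^+ n)) => //.
- by move=> x _; apply: (@geo_bounded_integrable c); exact: fc.
- by apply: aeW => n _ x _; exact: cf.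
- apply: (@geo_bounded_integrable c) => n.
  by rewrite ger0_norm // mulr_ge0 // exprn_ge0 // invr_ge0.
- by move=> x _; apply: aeW => n _; exact: fc.
Qed.

End GeometricallyBoundedSeries.

(** * Expansion of the periods *)

Section PeriodExpansion.
Variable R : realType.
Local Open Scope classical_set_scope.
Local Notation C := R[i].
Local Notation Re := (@complex.Re R).
Local Notation Im := (@complex.Im R).

Lemma ReM (z w : C) : Re (z * w) = Re z * Re w - Im z * Im w.
Proof. by case: z w => [a b] [c d]. Qed.

Lemma ImM (z w : C) : Im (z * w) = Re z * Im w + Im z * Re w.
Proof. by case: z w => [a b] [c d]. Qed.

Lemma ReD (z w : C) : Re (z + w) = Re z + Re w.
Proof. by case: z w => [a b] [c d]. Qed.

Lemma ImD (z w : C) : Im (z + w) = Im z + Im w.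
Proof. by case: z w => [a b] [c d]. Qed.

Lemma Re_coef (x : R) (z : C) : Re (x%:C * z) = x * Re z.
Proof. by rewrite ReM /= mul0r subr0. Qed.

Lemma Im_coef (x : R) (z : C) : Im (x%:C * z) = x * Im z.
Proof. by rewrite ImM /= mul0r addr0. Qed.

Lemma Re_expC (q : R) (l : C) : Re (expC (q%:C * l)) = expR (q * Re l) * cos (q * Im l).
Proof. by rewrite /expC !Re_coef Im_coef. Qed.

Lemma Im_expC (q : R) (l : C) : Im (expC (q%:C * l)) = expR (q * Re l) * sin (q * Im l).
Proof. by rewrite /expC !Im_coef Re_coef. Qed.

Lemma expCD (z w : C) : expC (z + w) = expC z * expC w.
Proof.
rewrite /expC /cis ReD ImD expRD cosD sinD.
by apply/eqP; rewrite eq_complex /=; apply/andP; split; apply/eqP; ring.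
Qed.

Lemma expC0 : expC (0 : C) = 1.
Proof. by rewrite /expC /cis /= expR0 cos0 sin0 mul1r. Qed.

Definition is_cderive (p : R) (f : R -> C) (df : C) : Prop :=
  is_derive p 1 (fun q => Re (f q)) (Re df) /\
  is_derive p 1 (fun q => Im (f q)) (Im df).

Lemma is_cderive_cst p (c : C) : is_cderive p (fun=> c) 0.
Proof. by split; exact: is_derive_cst. Qed.

Lemma is_cderiveD p f g (df dg : C) : is_cderive p f df -> is_cderive p g dg ->
  is_cderive p (fun q => f q + g q) (df + dg).
Proof.
move=> [f1 f2] [g1 g2]; split.
  rewrite ReD (_ : (fun q => _) = (fun q => Re (f q) + Re (g q))).
    exact: is_deriveD.
  by apply/funext => q; rewrite ReD.
rewrite ImD (_ : (fun q => _) = (fun q => Im (f q) + Im (g q))).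
  exact: is_deriveD.
by apply/funext => q; rewrite ImD.
Qed.

Lemma is_cderiveM p f g (df dg : C) : is_cderive p f df -> is_cderive p g dg ->
  is_cderive p (fun q => f q * g q) (df * g p + f p * dg).
Proof.
move=> [f1 f2] [g1 g2]; split.
  rewrite (_ : (fun q => _) = (fun q => Re (f q) * Re (g q) - Im (f q) * Im (g q)));
    last first.
    by apply/funext => q; rewrite ReM.
  have H := is_deriveB (is_deriveM f1 g1) (is_deriveM f2 g2).
  by apply: (is_derive_eq H); rewrite /GRing.scale /= ReD !ReM; ring.
rewrite (_ : (fun q => _) = (fun q => Re (f q) * Im (g q) + Im (f q) * Re (g q)));
  last first.
  by apply/funext => q; rewrite ImM.
have H := is_deriveD (is_deriveM f1 g2) (is_deriveM f2 g1).
by apply: (is_derive_eq H); rewrite /GRing.scale /= ImD !ImM; ring.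
Qed.

Lemma is_cderive_expC p (l : C) : is_cderive p (fun q =>
  expC (q%:C * l)) (l * expC (p%:C * l)).
Proof.
have dlin (c : R) : is_derive p 1 (fun q : R => q * c) c.
  have H := is_deriveM (is_derive_id p (1 : R)) (is_derive_cst c p (1 : R)).
  by apply: (is_derive_eq H); rewrite /GRing.scale /= mulr0 add0r mulr1.
have reE q := Re_expC q l; have imE q := Im_expC q l.
have dexp := @is_derive1_comp R (@expR R) (fun q =>
  q * Re l) p _ _ (is_derive_expR (p * Re l)) (dlin (Re l)).
have dcos := @is_derive1_comp R (@cos R) (fun q =>
  q * Im l) p _ _ (is_derive_cos (p * Im l)) (dlin (Im l)).
have dsin := @is_derive1_comp R (@sin R) (fun q =>
  q * Im l) p _ _ (is_derive_sin (p * Im l)) (dlin (Im l)).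
split.
  rewrite (funext reE) ReM reE imE.
  by apply: (is_derive_eq (is_deriveM dexp dcos)); rewrite /GRing.scale /=; ring.
rewrite (funext imE) ImM reE imE.
by apply: (is_derive_eq (is_deriveM dexp dsin)); rewrite /GRing.scale /=; ring.
Qed.

Lemma Cderive1n_step (d : R) k (f g : R -> C) dg :
  (forall p, `|p| < d -> Cderive1n k f p = g p) ->
  (forall p, `|p| < d -> is_cderive p g (dg p)) ->
  forall p, `|p| < d -> Cderive1n k.+1 f p = dg p.
Proof.
move=> fg gd p pd; have [g1 g2] := gd _ pd.
rewrite /Cderive1n !derive1nS !derive1E [RHS](_ : _ = Re (dg p) +i* Im (dg p));
  last by case: (dg p).
congr (_ +i* _).
  have [_ <-] := g1; apply: near_eq_derive.
  by move/near_lt_normr: (pd); apply: filterS => q qd; rewrite -fg.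
have [_ <-] := g2; apply: near_eq_derive.
by move/near_lt_normr: (pd); apply: filterS => q qd; rewrite -fg.
Qed.

(** The j-th p-derivative of H in w(x, p) = x^p H(x, p), taken term by term. *)
Definition period_series (j : nat) (l : C) (p : R) : C :=
  Cseries (fun n => (derive1n j (@hyp_coef R n) p)%:C * expC (n%:R%:C * l)).

Lemma Re_period_series j l p : Re (period_series j l p) =
  limn (series (fun n => derive1n j (@hyp_coef R n) p * Re (expC (n%:R%:C * l)))).
Proof. by congr (limn (series _)); apply/funext => n; rewrite Re_coef. Qed.

Lemma Im_period_series j l p : Im (period_series j l p) =
  limn (series (fun n => derive1n j (@hyp_coef R n) p * Im (expC (n%:R%:C * l)))).
Proof. by congr (limn (series _)); apply/funext => n; rewrite Im_coef. Qed.

Lemma ler_expC n (l : C) :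
  `|Re (expC (n%:R%:C * l))| <= expR (Re l) ^+ n /\
  `|Im (expC (n%:R%:C * l))| <= expR (Re l) ^+ n.
Proof.
rewrite Re_expC Im_expC !normrM !(ger0_norm (expR_ge0 _)) [n%:R * _]mulrC expRM_natr.
by split; rewrite ler_piMr ?exprn_ge0 ?expR_ge0 // ler_norml ?cos_le1 ?cos_geN1
  ?sin_le1 ?sin_geN1.
Qed.

Section Expansion.
Variables (d B K : R).
Hypothesis d0 : 0 < d.
Hypothesis B0 : 0 <= B.
Hypothesis K0 : 0 <= K.
Hypothesis coef_jet : forall n, jet d 3 (@hyp_coef R n) (B * K ^+ n).
Variable l : C.
Hypothesis l_small : K * expR (Re l) <= 2^-1.

Lemma small_geo n (x : R) : `|x| <= expR (Re l) ^+ n ->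
  B * K ^+ n * `|x| <= B * 2^-1 ^+ n.
Proof.
move=> xl; apply: (@le_trans _ _ (B * K ^+ n * expR (Re l) ^+ n)).
  by rewrite ler_wpM2l // mulr_ge0 // exprn_ge0.
rewrite -mulrA -exprMn ler_wpM2l // lerXn2r // nnegrE ?invr_ge0 //.
by rewrite mulr_ge0 // expR_ge0.
Qed.

Lemma coef_le j n p : (j <= 3)%N -> `|p| < d ->
  `|derive1n j (@hyp_coef R n) p| <= B * K ^+ n.
Proof.
move=> j3 pd; have := coef_jet n; rewrite -(subnK j3) => /jet_derive1n/jet_bound; exact.
Qed.

Lemma coef_geo j (x : nat -> R) p : (j <= 3)%N -> `|p| < d ->
  (forall n, `|x n| <= expR (Re l) ^+ n) ->
  geo_bounded B (fun n => derive1n j (@hyp_coef R n) p * x n).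
Proof.
move=> j3 pd xl n; rewrite normrM; apply: le_trans (small_geo (xl n)).
by rewrite ler_wpM2r // coef_le.
Qed.

Lemma series_coef_is_derive j (x : nat -> R) (p : R) : (j <= 2)%N -> `|p| < d ->
  (forall n, `|x n| <= expR (Re l) ^+ n) ->
  is_derive p 1 (fun q => limn (series (fun n => derive1n j (@hyp_coef R n) q * x n)))
    (limn (series (fun n => derive1n j.+1 (@hyp_coef R n) p * x n))).
Proof.
move=> j2 pd xl.
pose g n q := derive1n j (@hyp_coef R n) q * x n.
have jj n : jet d 1 (derive1n j (@hyp_coef R n)) (B * K ^+ n).
  by apply: jet_derive1n; apply: jet_le (coef_jet n); rewrite // add1n.
have gj n : jet d 1 (g n) (2 * B * 2^-1 ^+ n).
  have := jetM d0 (jj n) (jet_cst 1 (x n) d0); apply: jet_le => //.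
  by rewrite expr1 -[leRHS]mulrA ler_wpM2l // small_geo.
have := series_is_derive gj pd.
rewrite (_ : (fun n => derive1 (g n) p) = (fun n =>
  derive1n j.+1 (@hyp_coef R n) p * x n)) //.
apply/funext => n; rewrite derive1nS derive1E.
have H := is_deriveM (DeriveDef (jet_derivable (jj n) pd) erefl) (is_derive_cst (x n) p
  (1 : R)).
by have [_ ->] := H; rewrite /GRing.scale /= mulr0 add0r mulrC derive1E.
Qed.

Lemma period_series_is_cderive j p : (j <= 2)%N -> `|p| < d ->
  is_cderive p (period_series j l) (period_series j.+1 l p).
Proof.
move=> j2 pd; split.
  rewrite Re_period_series (funext (Re_period_series j l)).
  by apply: series_coef_is_derive => // n; have [] := ler_expC n l.
rewrite Im_period_series (funext (Im_period_series j l)).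
by apply: series_coef_is_derive => // n; have [] := ler_expC n l.
Qed.

Lemma Cseries_lim (u v : nat -> C) (c : C) :
  (forall n, v n = c * u n) ->
  cvgn (series (fun n => Re (u n))) -> cvgn (series (fun n => Im (u n))) ->
  Cseries v = c * Cseries u.
Proof.
move=> vu cr ci; apply/eqP; rewrite eq_complex ReM ImM /Cseries /=.
set X := limn (series (fun n => Re (u n))); set Y := limn (series (fun n => Im (u n))).
apply/andP; split; apply/eqP; apply/cvg_lim => //.
  rewrite (_ : series _ = (fun N => Re c * series (fun n =>
    Re (u n)) N - Im c * series (fun n => Im (u n)) N)).
    by apply: cvgB; apply: cvgM => //; exact: cvg_cst.
  apply/funext => N; rewrite /series /= !mulr_sumr -sumrB; apply: eq_bigr => n _.
  by rewrite vu ReM.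
rewrite (_ : series _ = (fun N => Re c * series (fun n =>
  Im (u n)) N + Im c * series (fun n => Re (u n)) N)).
  by apply: cvgD; apply: cvgM => //; exact: cvg_cst.
apply/funext => N; rewrite /series /= !mulr_sumr -big_split; apply: eq_bigr => n _.
by rewrite vu ImM.
Qed.

Lemma w_period_series p : `|p| < d -> w l p = expC (p%:C * l) * period_series 0 l p.
Proof.
move=> pd; apply: Cseries_lim => [n||].
- rewrite (_ : derive1n 0 _ p = hyp_coef n p); [|by []]; rewrite /hyp_coef.
  by rewrite [(n%:R + p)%:C]rmorphD [(_ + _) * l]mulrDl expCD mulrA mulrC.
- under eq_fun do rewrite Re_coef.
  by apply: (@geo_bounded_cvg _ B); apply: coef_geo => // n; have [] := ler_expC n l.
- under eq_fun do rewrite Im_coef.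
  by apply: (@geo_bounded_cvg _ B); apply: coef_geo => // n; have [] := ler_expC n l.
Qed.

Local Notation h j := (period_series j l).

(** Leibniz's rule for exp (p l) H at p = 0, where each derivative of the exponential contributes a
    factor l. The intermediate formulas hold on all of |p| < d because they are differentiated
    again. *)
Lemma w_expansion : [/\ w l 0 = h 0 0,
  w_ 1 l = l * h 0 0 + h 1 0,
  w_ 2 l = l ^+ 2 * h 0 0 + 2 * l * h 1 0 + h 2 0 &
  w_ 3 l = l ^+ 3 * h 0 0 + 3 * l ^+ 2 * h 1 0 + 3 * l * h 2 0 + h 3 0].
Proof.
have z0 : `|0 : R| < d by rewrite normr0.
have E0 : expC ((0 : R)%:C * l) = 1 by rewrite mul0r expC0.
have W0 p : `|p| < d -> Cderive1n 0 (w l) p = expC (p%:C * l) * h 0 p.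
  by move=> pd; rewrite -w_period_series // /Cderive1n /=; case: (w l p).
have dE p := is_cderive_expC p l.
have hd j p : (j <= 2)%N -> `|p| < d -> is_cderive p (h j) (h j.+1 p).
  exact: period_series_is_cderive.
have hc (c : C) j p : (j <= 2)%N -> `|p| < d ->
  is_cderive p (fun q => c * h j q) (c * h j.+1 p).
  by move=> j2 pd; have := is_cderiveM (is_cderive_cst p c) (hd j p j2 pd);
    rewrite mul0r add0r.
have W1 := Cderive1n_step W0 (fun p pd => is_cderiveM (dE p) (hd 0 p isT pd)).
have W1' p : `|p| < d -> Cderive1n 1 (w l) p = expC (p%:C * l) * (l * h 0 p + h 1 p).
  by move=> pd; rewrite (W1 p pd); move: (expC _) (h 0 p) (h 1 p) (h 2 p) => *; ring.
have W2 := Cderive1n_step W1' (fun p pd => is_cderiveM (dE p)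
  (is_cderiveD (hc l 0 p isT pd) (hd 1 p isT pd))).
have W2' p : `|p| < d -> Cderive1n 2 (w l) p =
    expC (p%:C * l) * (l ^+ 2 * h 0 p + 2 * l * h 1 p + h 2 p).
  by move=> pd; rewrite (W2 p pd); move: (expC _) (h 0 p) (h 1 p) (h 2 p) => *; ring.
have W3 := Cderive1n_step W2' (fun p pd => is_cderiveM (dE p)
  (is_cderiveD (is_cderiveD (hc _ 0 p isT pd) (hc _ 1 p isT pd)) (hd 2 p isT pd))).
split.
- by rewrite (w_period_series z0) E0 mul1r.
- by rewrite /w_ (W1' _ z0) E0 mul1r.
- by rewrite /w_ (W2' _ z0) E0 mul1r.
- rewrite /w_ (W3 _ z0) E0.
  by move: (h 0 0) (h 1 0) (h 2 0) (h 3 0) => *; ring.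
Qed.

End Expansion.
End PeriodExpansion.

(** * Asymptotics *)

Section BigO.
Variable R : realType.
Local Notation C := R[i].
Local Notation Re := (@complex.Re R).
Local Notation Im := (@complex.Im R).
Local Notation "z ^*" := (conjc z) : ring_scope.

Lemma complex_eqP (z w : C) : Re z = Re w -> Im z = Im w -> z = w.
Proof. by case: z w => [a b] [c d] /= -> ->. Qed.

(** The scale is y = - Re l, and the constant is uniform over all of D, imaginary parts included. *)
Definition bigO (D : C -> Prop) (k : nat) (f : C -> C) : Prop :=
  exists2 M, 0 <= M & forall l, D l ->
    `|Re (f l)| <= M * (- Re l) ^+ k /\ `|Im (f l)| <= M * (- Re l) ^+ k.

Variable D : C -> Prop.
Hypothesis D_Re : forall l, D l -> 1 <= - Re l.
Hypothesis D_Im : forall l, D l -> `|Im l| <= - Re l.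

Lemma bigO_ext k f g : (forall l, D l -> f l = g l) -> bigO D k f -> bigO D k g.
Proof. by move=> fg [M M0 Mf]; exists M => // l Dl; rewrite -fg //; exact: Mf. Qed.

Lemma bigO_le k k' f : (k <= k')%N -> bigO D k f -> bigO D k' f.
Proof.
move=> kk [M M0 Mf]; exists M => // l Dl; have [f1 f2] := Mf l Dl.
have kk' : M * (- Re l) ^+ k <= M * (- Re l) ^+ k'.
  by rewrite ler_wpM2l // ler_weXn2l // D_Re.
by split; [exact: le_trans f1 kk'|exact: le_trans f2 kk'].
Qed.

Lemma bigO_cst (c : C) : bigO D 0 (fun=> c).
Proof.
exists (`|Re c| + `|Im c|); first by rewrite addr_ge0.
by move=> l _; rewrite mulr1 lerDl lerDr !normr_ge0.
Qed.

Lemma bigO_id : bigO D 1 id.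
Proof.
exists 1 => // l Dl; rewrite mul1r expr1; split; last exact: D_Im.
by rewrite -normrN ger0_norm // (le_trans ler01) // D_Re.
Qed.

Lemma bigO_conj k f : bigO D k f -> bigO D k (fun l => (f l)^*).
Proof.
move=> [M M0 Mf]; exists M => // l Dl; have := Mf l Dl.
by case: (f l) => a b /=; rewrite normrN.
Qed.

Lemma bigOD k f g : bigO D k f -> bigO D k g -> bigO D k (fun l => f l + g l).
Proof.
move=> [M M0 Mf] [N N0 Ng]; exists (M + N); first exact: addr_ge0.
move=> l Dl; have [f1 f2] := Mf l Dl; have [g1 g2] := Ng l Dl.
rewrite mulrDl ReD ImD.
by split; apply: le_trans (ler_normD _ _) _; exact: lerD.
Qed.

Lemma bigOM k k' f g : bigO D k f -> bigO D k' g ->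
  bigO D (k + k') (fun l => f l * g l).
Proof.
move=> [M M0 Mf] [N N0 Ng]; exists (2 * (M * N)); first by rewrite mulr_ge0 // mulr_ge0.
move=> l Dl; have [f1 f2] := Mf l Dl; have [g1 g2] := Ng l Dl.
have y0 : 0 <= - Re l by rewrite (le_trans ler01) // D_Re.
have bnd (x y : R) : `|x| <= M * (- Re l) ^+ k -> `|y| <= N * (- Re l) ^+ k' ->
    `|x * y| <= M * N * (- Re l) ^+ (k + k').
  by move=> xM yN; rewrite normrM exprD mulrACA ler_pM.
rewrite -mulrA mulr_natl mulr2n ReM ImM.
split; last by apply: le_trans (ler_normD _ _) _; apply: lerD; exact: bnd.
by apply: le_trans (ler_normB _ _) _; apply: lerD; exact: bnd.
Qed.

Lemma bigOZ k (c : C) f : bigO D k f -> bigO D k (fun l => c * f l).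
Proof. by move=> fk; exact: bigOM (bigO_cst c) fk. Qed.

Lemma bigOX k f n : bigO D k f -> bigO D (n * k) (fun l => f l ^+ n).
Proof.
move=> fk; elim: n => [|n IH]; first exact: bigO_cst.
by rewrite mulSn; apply: bigO_ext (bigOM fk IH) => l _; rewrite exprS.
Qed.

Lemma bigO_inv f : (forall l, D l -> 2^-1 <= Re (f l)) -> bigO D 0 f ->
  bigO D 0 (fun l => (f l)^-1).
Proof.
move=> f2 [M M0 Mf]; exists (4 * M); first by rewrite mulr_ge0.
move=> l Dl; have := f2 l Dl; have := Mf l Dl; rewrite !mulr1.
case: (f l) => a b /= [aM bM] a2.
have ab : 4^-1 <= a ^+ 2 + b ^+ 2.
  by have := sqr_ge0 b; nra.
have ab0 : 0 < a ^+ 2 + b ^+ 2 by rewrite (lt_le_trans _ ab) // invr_gt0.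
have nn x : `|x| <= M -> `|x / (a ^+ 2 + b ^+ 2)| <= 4 * M.
  move=> xM; rewrite normrM normfV (gtr0_norm ab0) ler_pdivrMr //.
  apply: (le_trans xM); rewrite mulrAC -[leLHS]mul1r ler_wpM2r //.
  by rewrite mulrC -ler_pdivrMr // mul1r.
by split; [exact: nn|rewrite normrN; exact: nn].
Qed.

End BigO.

(** * Normalized charges near the large complex structure limit *)

Section Asymptotics.
Variable R : realType.
Local Notation C := R[i].
Local Notation Re := (@complex.Re R).
Local Notation Im := (@complex.Im R).
Local Notation "z ^*" := (conjc z) : ring_scope.

(* The last row of [M_infty ^+ d], of period 5 in d. *)
Definition charge_row (d : nat) : seq int :=
  nth [::] [:: [:: 0; 0; 0; 1]; [:: 5; -8; 1; -4]; [:: -10; 19; -3; 6];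
               [:: 10; -14; 3; -4]; [:: -5; 3; -1; 1]] (d %% 5).

Lemma charge_row_modn n : charge_row n = charge_row (n %% 5).
Proof. by rewrite /charge_row modn_mod. Qed.

Lemma charge_row_modnS n : charge_row n.+1 = charge_row (n %% 5).+1.
Proof. by rewrite /charge_row -[(n %% 5).+1]addn1 modnDml addn1. Qed.

Lemma M_infty_row d (j : 'I_4) :
  (M_infty R ^+ d) ord_max j = ((charge_row d)`_j)%:~R.
Proof.
elim: d j => [|d IH] j.
  by rewrite expr0 mxE; case: j => [[|[|[|[|j]]]]] jlt //=.
rewrite exprSr mxE; under eq_bigr do rewrite IH /M_infty mxE -intrM.
rewrite -(rmorph_sum (intmul 1)) /=; congr (_%:~R).
rewrite charge_row_modnS (charge_row_modn d).
(* Five residues and four columns remain, each an identity of integers settled by computation. *)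
have : (d %% 5 < 5)%N by rewrite ltn_mod.
move: (d %% 5)%N; do 5![case=> [_|]; first by
  rewrite !big_ord_recr big_ord0; case: j => [[|[|[|[|j]]]]] jlt].
by move=> r; rewrite !ltnS ltn0.
Qed.

Definition Z_norm (d : nat) (l : C) : C :=
  \sum_(j < 4) ((charge_row d)`_j)%:~R * quotient_B l j.

Lemma Z_normE d l : Z_norm d l = (M_infty R ^+ d *m Pi_B l) ord_max 0 / Pi_B l 0 0.
Proof.
rewrite mxE mulr_suml; apply: eq_bigr => j _.
by rewrite M_infty_row /quotient_B mulrA.
Qed.

Variables (d B K A L : R).
Hypothesis d0 : 0 < d.
Hypothesis B0 : 0 <= B.
Hypothesis K0 : 0 <= K.
Hypothesis coef_jet : forall n, jet d 3 (@hyp_coef R n) (B * K ^+ n).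
Hypothesis L1 : 1 <= L.
Hypothesis LA : A <= L.
Hypothesis LK : K * expR (- L) <= 2^-1.
Hypothesis LBK : 2 * (B * (K * expR (- L))) <= 2^-1.

(** [LA] makes l itself of order y here, [LK] makes the series geometric with ratio 1/2, and [LBK]
    keeps the tail of H below 1/2, against its constant term 1. *)
Definition strip (l : C) : Prop := L <= - Re l /\ `|Im l| <= A.

Lemma strip_Re l : strip l -> 1 <= - Re l.
Proof. by case=> Ll _; exact: le_trans Ll. Qed.

Lemma strip_Im l : strip l -> `|Im l| <= - Re l.
Proof. by case=> Ll /le_trans; apply; exact: le_trans Ll. Qed.

Lemma strip_expR l : strip l -> expR (Re l) <= expR (- L).
Proof. by case=> Ll _; rewrite ler_expR; lra. Qed.

Lemma strip_small l : strip l -> K * expR (Re l) <= 2^-1.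
Proof. by move=> /strip_expR ll; apply: le_trans LK; rewrite ler_wpM2l. Qed.

Definition hyp_series (j : nat) (l : C) : C := period_series j l 0.

Let z0 : `|0 : R| < d. Proof. by rewrite normr0. Qed.

Lemma hyp_series_bigO j : (j <= 3)%N -> bigO strip 0 (hyp_series j).
Proof.
move=> j3; exists (2 * B); first by rewrite mulr_ge0.
move=> l sl; rewrite mulr1 Re_period_series Im_period_series.
by split; apply: geo_bounded_lim;
  apply: (coef_geo B0 K0 coef_jet (strip_small sl) j3 z0) => n;
  have [] := ler_expC n l.
Qed.

Lemma geo_bounded_recl c (u : nat -> R) : geo_bounded c u ->
  limn (series u) = u 0%N + limn (series (fun n => u n.+1)).
Proof.
move=> uc; have cu := geo_bounded_cvg uc.
have -> : series (fun n => u n.+1) = (fun n => series u n.+1 - u 0%N).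
  by apply/funext => n; rewrite /series /= big_nat_recl // addrC addKr.
have lim : (series u n.+1 - u 0%N @[n --> \oo] --> limn (series u) - u 0%N)%classic.
  by apply: cvgB; [rewrite (cvg_shiftS (series u))|exact: cvg_cst].
by rewrite (cvg_lim _ lim) // addrC subrK.
Qed.

Lemma hyp_series0_ge l : strip l -> 2^-1 <= Re (hyp_series 0 l).
Proof.
move=> sl; rewrite Re_period_series.
have xl n : `|Re (expC (n%:R%:C * l))| <= expR (Re l) ^+ n by have [] := ler_expC n l.
set u := fun n => _.
have uB : geo_bounded B u by exact: (coef_geo B0 K0 coef_jet (strip_small sl) _ z0 xl).
rewrite (geo_bounded_recl uB).
have u0 : u 0%N = 1.
  by rewrite /u mul0r expC0 mulr1 (_ : derive1n 0 _ 0 = hyp_coef 0 0) // hyp_coef0.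
have u1 : geo_bounded (B * (K * expR (- L))) (fun n => u n.+1).
  move=> n; rewrite /u normrM.
  have c1 := coef_le coef_jet n.+1 (isT : (0 <= 3)%N) z0.
  apply: (@le_trans _ _ (B * K ^+ n.+1 * expR (Re l) ^+ n.+1)).
    by apply: ler_pM.
  rewrite -mulrA -exprMn exprS -[leRHS]mulrA ler_wpM2l //.
  have ke0 : 0 <= K * expR (Re l) by rewrite mulr_ge0 // expR_ge0.
  apply: ler_pM => //; first exact: exprn_ge0.
    by apply: ler_wpM2l => //; exact: strip_expR.
  by apply: lerXn2r; rewrite ?nnegrE ?invr_ge0 //; exact: strip_small.
have := geo_bounded_lim u1; rewrite u0 ler_norml.
by move: (limn _) LBK => x; lra.
Qed.

Lemma hyp_series0_neq0 l : strip l -> hyp_series 0 l != 0.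
Proof.
move=> /hyp_series0_ge h2; apply/eqP => h0; move: h2; rewrite h0 /=.
by rewrite leNgt invr_gt0 ltr0n.
Qed.

Definition hyp_quot (j : nat) (l : C) : C := hyp_series j l / hyp_series 0 l.

Lemma hyp_quot_bigO j : (j <= 3)%N -> bigO strip 0 (hyp_quot j).
Proof.
move=> j3; apply: (bigOM strip_Re (hyp_series_bigO j3)).
by apply: bigO_inv (hyp_series_bigO _) => // l; exact: hyp_series0_ge.
Qed.

(* [quot1], [quot2], [quot3] are the quotients Pi_B[i] / Pi_B[1] for i = 2, 3, 4,
   the last two split into the leading power of [l] and a remainder. *)
Definition lead2 : C := 5 / (2 * two_pi_i R ^+ 2).
Definition lead3 : C := - (5 / (6 * two_pi_i R ^+ 3)).
Definition quot1 (l : C) : C := (two_pi_i R)^-1 * (l + hyp_quot 1 l).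
Definition err2 (l : C) :
  C := lead2 * (2 * l * hyp_quot 1 l + hyp_quot 2 l) + 11 / 2 * quot1 l.
Definition err3 (l : C) : C :=
  lead3 * (3 * l ^+ 2 * hyp_quot 1 l + 3 * l * hyp_quot 2 l + hyp_quot 3 l) + - (50 /
    12) * quot1 l.
Definition quot2 (l : C) : C := lead2 * l ^+ 2 + err2 l.
Definition quot3 (l : C) : C := lead3 * l ^+ 3 + err3 l.

Lemma two_pi_i_neq0 : two_pi_i R != 0.
Proof. by rewrite eq_complex /= negb_and mulf_neq0 ?orbT // gt_eqF ?pi_gt0. Qed.

Lemma Z_norm_quot n l : strip l ->
  Z_norm n l = ((charge_row n)`_0)%:~R + ((charge_row n)`_1)%:~R * quot1 l
    + ((charge_row n)`_2)%:~R * quot2 l + ((charge_row n)`_3)%:~R * quot3 l.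
Proof.
move=> sl; have [e0 e1 e2 e3] := w_expansion d0 B0 K0 coef_jet (strip_small sl).
have hn := hyp_series0_neq0 sl.
rewrite /Z_norm !big_ord_recl big_ord0 addr0 !addrA /quotient_B /Pi_B !mxE /=.
rewrite -/(hyp_series 0 l) in hn; rewrite e0 e1 e2 e3 -!/(hyp_series _ l) divff // mulr1.
rewrite /bump /= /quot2 /quot3 /err2 /err3 /quot1 /lead2 /lead3 /hyp_quot.
have := two_pi_i_neq0.
move: hn; move: (hyp_series 0 l) (hyp_series 1 l) (hyp_series 2 l) (hyp_series 3 l)
  (two_pi_i R).
move: (_%:~R) (_%:~R) (_%:~R) (_%:~R) => m0 m1 m2 m3 x0 x1 x2 x3 tau x00 tau0.
by field; rewrite x00 tau0.
Qed.

(** The moduli of the leading coefficients: [lead2] is - kappa2 and [lead3] is - i kappa3. *)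
Definition kappa2 : R := 5 / (8 * pi ^+ 2).
Definition kappa3 : R := 5 / (48 * pi ^+ 3).

Lemma kappa2_gt0 : 0 < kappa2.
Proof. by rewrite divr_gt0 // mulr_gt0 // exprn_gt0 // pi_gt0. Qed.

Lemma kappa3_gt0 : 0 < kappa3.
Proof. by rewrite divr_gt0 // mulr_gt0 // exprn_gt0 // pi_gt0. Qed.

Lemma two_pi_iE : two_pi_i R = (2 * pi)%:C * (0 +i* 1).
Proof. by apply: complex_eqP; rewrite /= ?mul0r; ring. Qed.

Lemma imaginary2 : (0 +i* 1 : C) ^+ 2 = -1.
Proof. by apply: complex_eqP; rewrite /= ; ring. Qed.

Lemma lead2E : lead2 = (- kappa2)%:C.
Proof.
have p0 : (pi : R)%:C != 0 by rewrite eq_complex /= negb_and gt_eqF ?pi_gt0.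
rewrite /lead2 two_pi_iE exprMn imaginary2 /kappa2 rmorphN fmorph_div !rmorphM
  ?rmorphXn !rmorph_nat /=.
by move: (pi%:C) p0 => q q0; field.
Qed.

Lemma lead3E : lead3 = (- kappa3)%:C * (0 +i* 1).
Proof.
have p0 : (pi : R)%:C != 0 by rewrite eq_complex /= negb_and gt_eqF ?pi_gt0.
have i0 : (0 +i* 1 : C) != 0 by rewrite eq_complex /= negb_and oner_neq0 orbT.
have i4 := imaginary2.
rewrite /lead3 two_pi_iE exprMn [(0 +i* 1) ^+ 3]exprS i4 /kappa3 rmorphN fmorph_div.
rewrite !rmorphM ?rmorphXn !rmorph_nat /=.
have -> : (0 +i* 1 : C) * -1 = (0 +i* 1)^-1.
  by apply: (mulfI i0); rewrite divff // mulrA -expr2 i4; ring.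
by move: (pi%:C) p0 (0 +i* 1) i0 => q q0 j j0; field; rewrite q0 j0.
Qed.

Local Notation O := (bigO strip).

Let OM k k' f g : O k f -> O k' g -> O (k + k') (fun l => f l * g l).
Proof. by move=> a b; exact: (bigOM strip_Re a b). Qed.
Let OD k f g : O k f -> O k g -> O k (fun l => f l + g l).
Proof. by move=> a b; exact: (bigOD a b). Qed.
Let OZ k c f : O k f -> O k (fun l => c * f l).
Proof. by move=> a; exact: (bigOZ strip_Re c a). Qed.
Let OW k k' f : (k <= k')%N -> O k f -> O k' f.
Proof. by move=> kk a; exact: (bigO_le strip_Re kk a). Qed.
Let OI : O 1 id.
Proof. exact: bigO_id strip_Re strip_Im. Qed.
Let OX n : O n (fun l => l ^+ n).
Proof. by have := bigOX strip_Re n OI; rewrite muln1. Qed.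
Let Oquot j : (j <= 3)%N -> O 0 (hyp_quot j).
Proof. exact: hyp_quot_bigO. Qed.
Let OC k f : O k f -> O k (fun l => (f l)^*).
Proof. exact: bigO_conj. Qed.

Lemma quot1_bigO : O 1 quot1.
Proof. by apply: OZ; apply: OD => //; apply: OW (Oquot _). Qed.

Lemma err2_bigO : O 1 err2.
Proof.
apply: OD; last by apply: OZ; exact: quot1_bigO.
apply: OZ; apply: OD; last by apply: OW (Oquot _).
by apply: (OM (k := 1) (k' := 0)); [exact: OZ|exact: Oquot].
Qed.

Lemma err3_bigO : O 2 err3.
Proof.
apply: OD; last by apply: OZ; apply: OW quot1_bigO.
apply: OZ; apply: OD; last by apply: OW (Oquot _).
apply: OD; first by apply: (OM (k := 2) (k' := 0)); [apply: OZ; exact: OX|exact: Oquot].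
by apply: (OW (k := 1)) => //; apply: (OM (k := 1) (k' := 0)); [exact: OZ|exact: Oquot].
Qed.

Lemma quot2_bigO : O 2 quot2.
Proof. by apply: OD; [apply: OZ; exact: OX|apply: OW err2_bigO]. Qed.

Lemma quot3_bigO : O 3 quot3.
Proof. by apply: OD; [apply: OZ; exact: OX|apply: OW err3_bigO]. Qed.

Definition cross (l : C) : C := quot2 l * (quot3 l)^*.

(** The leading term is - i kappa2 kappa3 |l|^4 conj l, with imaginary part kappa2 kappa3 y |l|^4
    and |l| >= y. Every other term contains an error factor and is O(y^4). *)
Lemma Im_cross : exists2 M, 0 <= M & forall l, strip l ->
  kappa2 * kappa3 * (- Re l) ^+ 5 - M * (- Re l) ^+ 4 <= Im (cross l).
Proof.
have lead l : Im (lead2 * l ^+ 2 * (lead3 * l ^+ 3)^*) =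
    kappa2 * kappa3 * (- Re l) * (Re l ^+ 2 + Im l ^+ 2) ^+ 2.
  by rewrite lead2E lead3E; case: l => a b /=; ring.
have [M M0 HM] : O 4 (fun l => lead2 * l ^+ 2 * (err3 l)^* + err2 l * (lead3 * l ^+ 3)^*
    + err2 l * (err3 l)^*).
  apply: OD; first apply: OD.
  - by apply: (OM (k := 2) (k' := 2)); [apply: OZ; exact: OX|apply: OC; exact: err3_bigO].
  - by apply: (OM (k := 1) (k' := 3)); [exact: err2_bigO|apply: OC; apply: OZ; exact: OX].
  - by apply: (OW (k := 3)) => //; apply: (OM (k := 1) (k' := 2));
      [exact: err2_bigO|apply: OC; exact: err3_bigO].
exists M => // l sl; have [_ ] := HM l sl; set E := (X in Im X) => EM.
have -> : cross l = lead2 * l ^+ 2 * (lead3 * l ^+ 3)^* + E.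
  by rewrite /cross /quot2 /quot3 rmorphD /= /E; ring.
rewrite ImD lead.
have y0 : 0 <= - Re l := le_trans ler01 (strip_Re sl); move: EM;
  rewrite ler_norml => /andP[EM _].
have y5 : kappa2 * kappa3 * (- Re l) ^+ 5 <= kappa2 * kappa3 * (- Re l) * (Re l ^+ 2 +
  Im l ^+ 2) ^+ 2.
  rewrite exprS mulrA ler_wpM2l //.
    by rewrite mulr_ge0 // mulr_ge0 // ltW // (kappa2_gt0, kappa3_gt0).
  rewrite (exprM _ 2 2) sqrrN; apply: lerXn2r; rewrite ?nnegrE ?addr_ge0 ?sqr_ge0 //.
  by rewrite lerDl sqr_ge0.
by move: (Im E) EM y5 => e EM y5; lra.
Qed.

Definition Z_step (n : nat) (l : C) : C := Z_norm n.+1 l * (Z_norm n l)^*.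

Lemma conj_int (m : int) : (m%:~R : C)^* = m%:~R.
Proof. by rewrite -(rmorph_int (@real_complex R)); apply: complex_eqP;
  rewrite /= ?oppr0. Qed.

Lemma conjD (z w : C) : (z + w)^* = z^* + w^*.
Proof. by case: z w => [a b] [c e]; apply: complex_eqP; rewrite //= opprD. Qed.

Lemma conjM (z w : C) : (z * w)^* = z^* * w^*.
Proof. by case: z w => [a b] [c e]; apply: complex_eqP => /=; ring. Qed.

Lemma Im_int (m : int) (z : C) : Im (m%:~R * z) = m%:~R * Im z.
Proof. by rewrite -(rmorph_int (@real_complex R)) Im_coef. Qed.

Definition charge_minor (n : nat) : int :=
  (charge_row n.+1)`_2 * (charge_row n)`_3 - (charge_row n.+1)`_3 * (charge_row n)`_2.

(** By periodicity there are only five minors: 1, 6, 6, 1, 1. *)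
Lemma charge_minor_ge1 n : 1 <= charge_minor n.
Proof.
rewrite /charge_minor charge_row_modnS (charge_row_modn n).
have : (n %% 5 < 5)%N by rewrite ltn_mod.
by move: (n %% 5)%N; do 5![case=> [//|]].
Qed.

(* In the product the coefficients of [quot3 * quot3^*] are real, and those of [quot2]
   against [quot3] combine to the minor of two consecutive rows. *)
Lemma Z_step_expansion n : exists2 E, O 4 E & forall l, strip l ->
  Im (Z_step n l) = (charge_minor n)%:~R * Im (cross l) + Im (E l).
Proof.
pose m i : C := ((charge_row n)`_i)%:~R; pose m' i : C := ((charge_row n.+1)`_i)%:~R.
pose eta l := m 0%N + m 1%N * quot1 l; pose eta' l := m' 0%N + m' 1%N * quot1 l.
have Oeta : O 1 eta.
  by apply: OD; [apply: OW (bigO_cst _ _)|apply: OZ; exact: quot1_bigO].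
have Oeta' : O 1 eta'.
  by apply: OD; [apply: OW (bigO_cst _ _)|apply: OZ; exact: quot1_bigO].
have O2 (c : C) : O 3 (fun l => c * quot2 l) by apply: (OW (k := 2)) => //; apply: OZ;
  exact: quot2_bigO.
have O3 (c : C) : O 3 (fun l => c * quot3 l) by apply: OZ; exact: quot3_bigO.
exists (fun l => eta' l * (eta l + m 2%N * quot2 l + m 3%N * quot3 l)^*
  + (m' 2%N * quot2 l + m' 3%N * quot3 l) * (eta l)^* + (m' 2%N * quot2 l) * (m 2%N *
      quot2 l)^*).
  apply: OD; first apply: OD.
  - by apply: (OM (k := 1) (k' := 3)) => //; apply: OC; apply: OD => //;
      apply: OD => //; apply: OW Oeta.
  - by apply: (OM (k := 3) (k' := 1)); [exact: OD|exact: OC].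
  - apply: (OM (k := 2) (k' := 2)); first by apply: OZ; exact: quot2_bigO.
    by apply: OC; apply: OZ; exact: quot2_bigO.
move=> l sl; rewrite /Z_step !Z_norm_quot // -!/(m _) -!/(m' _) -/(eta l) -/(eta' l).
have mC i : (m i)^* = m i by exact: conj_int.
set E := (X in _ + Im X).
have -> : (eta' l + m' 2%N * quot2 l + m' 3%N * quot3 l) * (eta l + m 2%N * quot2 l + m
  3%N * quot3 l)^* =
    m' 2%N * m 3%N * cross l + m' 3%N * m 2%N * (cross l)^* + m' 3%N * m 3%N * (quot3 l
      * (quot3 l)^*) + E.
  rewrite /E /cross [(_ + m 3%N * quot3 l)^*]conjD [(eta l + m 2%N * quot2 l)^*]conjD.
  rewrite [(m 2%N * quot2 l)^*]conjM [(m 3%N * quot3 l)^*]conjM.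
  rewrite [(quot2 l * _)^*]conjM (mC 2%N) (mC 3%N) conjcK.
  move: (eta l) (eta' l) (quot2 l) (quot3 l) (m 2%N) (m' 2%N) (m 3%N) (m' 3%N) (eta
    l)^* (quot2 l)^* (quot3 l)^*.
  by move=> *; ring.
have Im0 (z : C) : Im (z * z^*) = 0 by case: z => a b /=; ring.
have ImC (z : C) : Im (z^*) = - Im z by case: z.
rewrite !ImD -!rmorphM /= !Im_int Im0 ImC /charge_minor rmorphB /= !rmorphM /=.
ring.
Qed.

Lemma Im_Z_step_gt0 : exists Y, forall n l, strip l -> Y <= - Re l -> 0 < Im (Z_step n l).
Proof.
have [M M0 HM] := Im_cross.
have kk0 : 0 < kappa2 * kappa3 by rewrite mulr_gt0 // (kappa2_gt0, kappa3_gt0).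
have Yn n : exists Y, forall l, strip l -> Y <= - Re l -> 0 < Im (Z_step n l).
  have [E [N N0 HN] HE] := Z_step_expansion n.
  (* Beyond this threshold the cross term is at least (N + 1) y^4, more than the error N y^4. *)
  exists ((M + N + 1) / (kappa2 * kappa3)) => l sl; rewrite ler_pdivrMr // => yM.
  have [_ EN] := HN l sl; have := HM l sl; rewrite HE //.
  move: EN; rewrite ler_norml => /andP[EN _].
  have m1 : 1 <= (charge_minor n)%:~R :> R by rewrite ler1z charge_minor_ge1.
  have y1 := strip_Re sl;
    have y4 : 0 < (- Re l) ^+ 4 by rewrite exprn_gt0 // (lt_le_trans ltr01).
  rewrite exprSr; move: (Im (cross l)) (Im (E l)) EN => x e EN xM.
  have {}xM : (N + 1) * (- Re l) ^+ 4 <= x.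
    apply: le_trans xM; rewrite [leRHS](_ :
      _ = (kappa2 * kappa3 * (- Re l) - M) * (- Re l) ^+ 4); last by ring.
    by apply: ler_wpM2r; [exact: ltW|lra].
  have x0 : 0 <= x by apply: le_trans xM; apply: mulr_ge0; [exact: addr_ge0|exact: ltW].
  have : x <= (charge_minor n)%:~R * x by rewrite ler_peMl.
  by move: (_%:~R * x) => mx; lra.
(* [Z_step n] depends on n mod 5 only, so five thresholds suffice; the sum of their absolute values
   bounds each of them. *)
have [Y HY] := fin_all_exists (fun n : 'I_5 => Yn n).
exists (\sum_(n < 5) `|Y n|) => n l sl yl.
have -> : Z_step n l = Z_step (n %% 5) l.
  by rewrite /Z_step /Z_norm charge_row_modnS (charge_row_modn n).
have n5 : (n %% 5 < 5)%N by rewrite ltn_mod.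
apply: (HY (Ordinal n5)) => //; apply: le_trans yl; apply: le_trans (ler_norm _) _.
by rewrite (bigD1 (Ordinal n5)) //= lerDl sumr_ge0.
Qed.

Lemma Z_norm0E l : strip l -> Z_norm 0 l = quot3 l.
Proof. by move=> sl; rewrite Z_norm_quot // /charge_row /= mulr0z mulr1z !mul0r !add0r
  mul1r. Qed.

Lemma Z_norm1E l : strip l -> Z_norm 1 l = 5 + (-8) * quot1 l + quot2 l + (-4) * quot3 l.
Proof. by move=> sl; rewrite Z_norm_quot // /charge_row /= mulr1z mul1r. Qed.

(** The leading term - i kappa3 l^3 has imaginary part kappa3 (y^3 - 3 y (Im l)^2). As |Im l| <= A,
    the cube dominates both the subtracted term and the error O(y^2). *)
Lemma Im_Z_norm0_gt0 : exists Y, forall l, strip l -> Y <= - Re l -> 0 < Im (Z_norm 0 l).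
Proof.
have [M M0 HM] := err3_bigO.
exists ((3 * kappa3 * A ^+ 2 + M + 1) / kappa3) => l sl;
  rewrite ler_pdivrMr ?kappa3_gt0 // => yM.
rewrite Z_norm0E // /quot3 ImD.
have -> : Im (lead3 * l ^+ 3) = kappa3 * (- Re l) * ((- Re l) ^+ 2 - 3 * Im l ^+ 2).
  by rewrite lead3E; case: (l) => a b /=; ring.
have [_ ] := HM l sl; rewrite ler_norml => /andP[EM _].
have y1 := strip_Re sl; have [_ lA] := sl.
have b2 : Im l ^+ 2 <= A ^+ 2 by rewrite -real_normK ?num_real // lerXn2r // nnegrE
  (le_trans _ lA).
have kappa30 := kappa3_gt0.
move: (Im (err3 l)) EM => e EM; move: (- Re l) y1 yM EM => y y1 yM EM.
have y2 : 0 < y ^+ 2 by rewrite exprn_gt0 // (lt_le_trans ltr01).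
have : (3 * kappa3 * A ^+ 2 + 1) * y ^+ 2 <= (kappa3 * y - M) * y ^+ 2.
  by apply: ler_wpM2r; [exact: ltW|lra].
have : kappa3 * y * (3 * Im l ^+ 2) <= 3 * kappa3 * A ^+ 2 * y ^+ 2.
  rewrite (_ : kappa3 * y * (3 * Im l ^+ 2) = 3 * kappa3 * (Im l ^+ 2 * y)); last by ring.
  rewrite -[leRHS]mulrA; apply: ler_wpM2l; first by rewrite mulr_ge0 // ltW.
  by apply: ler_pM; rewrite ?sqr_ge0 //; [lra|rewrite expr2 ler_peMl //; lra].
by move=> u v; lra.
Qed.

(** Rows 1 and 0 end in -4 and 1, so [Z_step 0] contains -4 |quot3|^2, a real term of order - y^6;
    all remaining terms, hence the whole imaginary part, are O(y^5). *)
Lemma Z_step0_growth : exists kappa M, [/\ 0 < kappa, 0 <= M &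
  forall l, strip l -> Re (Z_step 0 l) <= M * (- Re l) ^+ 5 - kappa * (- Re l) ^+ 6 /\
    Im (Z_step 0 l) <= M * (- Re l) ^+ 5].
Proof.
have [E [N N0 HN] HE] := Z_step_expansion 0.
have Ocross : O 5 cross.
  by apply: (OM (k := 2) (k' := 3)); [exact: quot2_bigO|apply: OC; exact: quot3_bigO].
have Oim : O 5 (fun l => (charge_minor 0)%:~R * cross l + E l).
  by apply: OD; [exact: OZ|apply: (OW (k := 4)) => //; exists N].
have [M1 M10 HM1] := Oim.
have Ore : O 5 (fun l => (5 + (-8) * quot1 l + quot2 l) * (quot3 l)^*
    + (-4) * (lead3 * l ^+ 3 * (err3 l)^* + err3 l * (lead3 * l ^+ 3)^* + err3 l *
        (err3 l)^*)).
  apply: OD.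
    apply: (OM (k := 2) (k' := 3)); last by apply: OC; exact: quot3_bigO.
    apply: OD; last exact: quot2_bigO.
    apply: OD; first by apply: OW (bigO_cst _ _).
    by apply: OZ; apply: OW quot1_bigO.
  apply: OZ; apply: OD; first apply: OD.
  - by apply: (OM (k := 3) (k' := 2)); [apply: OZ; exact: OX|apply: OC; exact: err3_bigO].
  - by apply: (OM (k := 2) (k' := 3)); [exact: err3_bigO|apply: OC; apply: OZ; exact: OX].
  - by apply: (OW (k := 4)) => //; apply: (OM (k := 2) (k' := 2));
      [exact: err3_bigO|apply: OC; exact: err3_bigO].
have [M2 M20 HM2] := Ore.
exists (4 * kappa3 ^+ 2), (M1 + M2); split=> [||l sl].
- by rewrite mulr_gt0 // exprn_gt0 // kappa3_gt0.
- exact: addr_ge0.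
have y1 := strip_Re sl.
have y5 : 0 <= (- Re l) ^+ 5 by rewrite exprn_ge0 // (le_trans ler01).
split; last first.
  rewrite HE //; have [_] := HM1 l sl; rewrite ImD Im_int ler_norml => /andP[_ h1].
  by apply: (le_trans h1); rewrite ler_wpM2r // lerDl.
have [+ _] := HM2 l sl; set F := (X in Re X) => FM.
have -> : Z_step 0 l = (-4) * (lead3 * l ^+ 3 * (lead3 * l ^+ 3)^*) + F.
  rewrite /Z_step Z_norm0E // Z_norm1E // /F /quot3 [(_ + err3 l)^*]conjD.
  move: (quot1 l) (quot2 l) (lead3 * l ^+ 3)^* (err3 l)^* (err3 l) (lead3 * l ^+ 3).
  by move=> *; ring.
rewrite ReD; have -> : Re (-4 * (lead3 * l ^+ 3 * (lead3 * l ^+ 3)^*)) =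
    - (4 * kappa3 ^+ 2) * (Re l ^+ 2 + Im l ^+ 2) ^+ 3.
  rewrite (_ : -4 = (-4 : R)%:C); last by rewrite rmorphN rmorph_nat.
  by rewrite Re_coef lead3E; case: (l) => a b /=; ring.
have y6 : (- Re l) ^+ 6 <= (Re l ^+ 2 + Im l ^+ 2) ^+ 3.
  rewrite (exprM _ 2 3) sqrrN; apply: lerXn2r; rewrite ?nnegrE ?addr_ge0 ?sqr_ge0 //.
  by rewrite lerDl sqr_ge0.
have : 4 * kappa3 ^+ 2 * (- Re l) ^+ 6 <= 4 * kappa3 ^+ 2 * (Re l ^+ 2 + Im l ^+ 2) ^+ 3.
  by rewrite ler_wpM2l // mulr_ge0 // sqr_ge0.
have : 0 <= M1 * (- Re l) ^+ 5 by exact: mulr_ge0.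
move: FM; rewrite ler_norml mulNr mulrDl => /andP[_].
by move: (Re F) => f; lra.
Qed.

End Asymptotics.

(** * Arguments and phases *)

Section Argument.
Variable R : realType.
Local Notation C := R[i].
Local Notation Re := (@complex.Re R).
Local Notation Im := (@complex.Im R).
Local Notation "z ^*" := (conjc z) : ring_scope.

Definition modc (z : C) : R := Num.sqrt (Re z ^+ 2 + Im z ^+ 2).

(** On the upper half plane this is the argument in (0, pi), and it is continuous there because
    [acos] is continuous inside (-1, 1). *)
Definition carg (z : C) : R := acos (Re z / modc z).

Section UpperHalfPlane.
Variable z : C.
Hypothesis z_up : 0 < Im z.

Let n0 : 0 < Re z ^+ 2 + Im z ^+ 2.
Proof. by rewrite ltr_wpDl ?sqr_ge0 // exprn_gt0. Qed.

Lemma modc_gt0 : 0 < modc z.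
Proof. by rewrite sqrtr_gt0. Qed.

Lemma cos_carg_lt1 : -1 < Re z / modc z < 1.
Proof.
rewrite -ltr_norml normf_div (gtr0_norm modc_gt0) ltr_pdivrMr ?modc_gt0 // mul1r.
by rewrite -sqrtr_sqr ltr_sqrt // ltrDl exprn_gt0.
Qed.

Lemma carg_gt0 : 0 < carg z.
Proof. by have /andP[h1 h2] := cos_carg_lt1; apply: acos_gt0; rewrite h2 ltW. Qed.

Lemma carg_ltpi : carg z < pi.
Proof. by have /andP[h1 h2] := cos_carg_lt1; apply: acos_ltpi; rewrite h1 ltW. Qed.

Lemma modc_carg : z = (modc z)%:C * cis (carg z).
Proof.
have /andP[h1 h2] := cos_carg_lt1.
have h12 : -1 <= Re z / modc z <= 1 by rewrite !ltW.
apply: complex_eqP; rewrite (Re_coef, Im_coef) /cis /carg /=.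
  by rewrite acosK ?in_itv //= mulrC divfK // gt_eqF ?modc_gt0.
rewrite sin_acos // -[X in X * _]gtr0_norm ?modc_gt0 // -sqrtr_sqr -sqrtrM ?sqr_ge0 //.
rewrite expr_div_n /modc sqr_sqrtr ?(ltW n0) // mulrBr mulr1 mulrC divfK ?gt_eqF //.
by rewrite addrC addKr sqrtr_sqr gtr0_norm.
Qed.

End UpperHalfPlane.

Lemma cisD (a b : R) : cis (a + b) = cis a * cis b.
Proof. by apply: complex_eqP; rewrite /cis /= (cosD, sinD); ring. Qed.

Lemma cisNr (a : R) : cis (- a) * cis a = 1.
Proof. by rewrite -cisD addNr /cis cos0 sin0. Qed.

Lemma Im_conj_neq0 (z w : C) : 0 < Im (z * w^*) -> w != 0.
Proof. by apply: contraTneq => ->; rewrite conjc0 mulr0 /= ltxx. Qed.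

Lemma divc_conj (z w : C) :
  z / w = ((Re w ^+ 2 + Im w ^+ 2)^-1)%:C * (z * w^*).
Proof. by case: z w => [a b] [c d]; apply: complex_eqP => /=; ring. Qed.

Lemma sqr_modc_gt0 (w : C) : w != 0 -> 0 < Re w ^+ 2 + Im w ^+ 2.
Proof.
case: w => a b; rewrite eq_complex /= negb_and => ab.
rewrite lt_neqAle addr_ge0 ?sqr_ge0 // andbT eq_sym paddr_eq0 ?sqr_ge0 //.
by rewrite !sqrf_eq0 negb_and.
Qed.

Lemma Im_div_gt0 (z w : C) : 0 < Im (z * w^*) -> 0 < Im (z / w).
Proof.
move=> zw; have w0 := Im_conj_neq0 zw.
by rewrite divc_conj Im_coef mulr_gt0 // invr_gt0 sqr_modc_gt0.
Qed.

(** The quotient z / w is a positive multiple of z conj w, so equal arguments make the two products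
    proportional; the conclusion states this as a vanishing determinant. *)
Lemma carg_div_inj (z w z' w' : C) : 0 < Im (z * w^*) -> 0 < Im (z' * w'^*) ->
  carg (z / w) = carg (z' / w') ->
  Im (z * w^*) * Re (z' * w'^*) = Im (z' * w'^*) * Re (z * w^*).
Proof.
move=> zw zw' ee.
have polar (x y : C) : 0 < Im (x * y^*) -> exists2 m : R,
    Re (x * y^*) = m * cos (carg (x / y)) & Im (x * y^*) = m * sin (carg (x / y)).
  move=> xy; have y0 := sqr_modc_gt0 (Im_conj_neq0 xy).
  exists ((Re y ^+ 2 + Im y ^+ 2) * modc (x / y)).
    have := congr1 Re (modc_carg (Im_div_gt0 xy)).
    rewrite [in LHS]divc_conj !Re_coef /cis /= => /(canRL (mulVKf (lt0r_neq0 y0)))->.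
    by rewrite mulrA.
  have := congr1 Im (modc_carg (Im_div_gt0 xy)).
  rewrite [in LHS]divc_conj !Im_coef /cis /= => /(canRL (mulVKf (lt0r_neq0 y0)))->.
  by rewrite mulrA.
have [m rm im] := polar _ _ zw; have [m' rm' im'] := polar _ _ zw'.
by rewrite rm im rm' im' ee; ring.
Qed.

(** Multiplication by i carries the right half plane to the upper one, where [carg] is available;
    the quarter turn is then subtracted. *)
Lemma polar_right (z : C) : 0 < Re z ->
  exists (r theta : R), 0 < r /\ r%:C * cis theta = z.
Proof.
move=> z0; pose u : C := (0 +i* 1) * z.
have u0 : 0 < Im u by rewrite ImM /= mul0r add0r mul1r.
exists (modc u), (carg u - pi / 2); split; first exact: modc_gt0.
rewrite cisD mulrA -modc_carg // /cis cosN sinN cos_pihalf sin_pihalf /u.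
by case: z {z0 u u0} => a b; apply: complex_eqP => /=; ring.
Qed.

Section PhaseSequence.
Variable z : nat -> C.
Hypothesis z0_up : 0 < Im (z 0%N).
Hypothesis z_step : forall n, 0 < Im (z n.+1 * (z n)^*).

(** A lift of the argument along the sequence: each ratio lies in the upper half plane, so each
    increment is an argument in (0, pi), although the total may exceed pi. *)
Definition phase_seq (n : nat) : R :=
  carg (z 0%N) + \sum_(j < n) carg (z j.+1 / z j).

Lemma phase_seqS n : phase_seq n.+1 = phase_seq n + carg (z n.+1 / z n).
Proof. by rewrite /phase_seq big_ord_recr addrA. Qed.

Lemma phase_seq_step n : phase_seq n < phase_seq n.+1 < phase_seq n + pi.
Proof.
have zn := Im_div_gt0 (z_step n).
by rewrite phase_seqS ltrDl ltrD2l carg_gt0 // carg_ltpi.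
Qed.

Lemma phase_seq_polar n : exists2 m : R, 0 < m & z n = m%:C * cis (phase_seq n).
Proof.
elim: n => [|n [m m0 zn]].
  by exists (modc (z 0%N));
    [exact: modc_gt0|rewrite /phase_seq big_ord0 addr0 -modc_carg].
have zz := Im_div_gt0 (z_step n).
exists (modc (z n.+1 / z n) * m); first by rewrite mulr_gt0 // modc_gt0.
have zn0 : z n != 0 := Im_conj_neq0 (z_step n).
rewrite phase_seqS addrC cisD rmorphM /= mulrACA -zn -modc_carg //.
by rewrite divfK.
Qed.

End PhaseSequence.

(** * Continuity of complex-valued functions and of their arguments *)

Local Open Scope classical_set_scope.

Definition ccontinuous (f : R -> C) : Prop :=
  continuous (fun t => Re (f t)) /\ continuous (fun t => Im (f t)).

Lemma ccontinuous_cst (c : C) : ccontinuous (fun=> c).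
Proof. by split=> t; exact: cvg_cst. Qed.

Lemma ccontinuousD f g : ccontinuous f -> ccontinuous g ->
  ccontinuous (fun t => f t + g t).
Proof.
move=> [f1 f2] [g1 g2]; split=> t.
  by rewrite (_ : (fun t => _) = (fun t => Re (f t) + Re (g t)));
    [apply: cvgD; [exact: f1|exact: g1]|apply/funext => x; rewrite ReD].
by rewrite (_ : (fun t => _) = (fun t => Im (f t) + Im (g t)));
  [apply: cvgD; [exact: f2|exact: g2]|apply/funext => x; rewrite ImD].
Qed.

Lemma ccontinuousM f g : ccontinuous f -> ccontinuous g ->
  ccontinuous (fun t => f t * g t).
Proof.
move=> [f1 f2] [g1 g2]; split=> t.
  rewrite (_ : (fun t => _) = (fun t => Re (f t) * Re (g t) - Im (f t) * Im (g t))).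
    by apply: cvgB; apply: cvgM; [exact: f1|exact: g1|exact: f2|exact: g2].
  by apply/funext => x; rewrite ReM.
rewrite (_ : (fun t => _) = (fun t => Re (f t) * Im (g t) + Im (f t) * Re (g t))).
  by apply: cvgD; apply: cvgM; [exact: f1|exact: g2|exact: f2|exact: g1].
by apply/funext => x; rewrite ImM.
Qed.

Lemma ccontinuousX f n : ccontinuous f -> ccontinuous (fun t => f t ^+ n).
Proof.
move=> fc; elim: n => [|n IH]; first exact: ccontinuous_cst.
rewrite (_ : (fun t => _) = (fun t => f t * f t ^+ n)); first exact: ccontinuousM.
by apply/funext => t; rewrite exprS.
Qed.

Lemma ccontinuous_sqr_mod f : ccontinuous f ->
  continuous (fun t => Re (f t) ^+ 2 + Im (f t) ^+ 2).
Proof.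
move=> [f1 f2] t; apply: cvgD; rewrite expr2; under eq_fun do rewrite expr2.
  by apply: cvgM; exact: f1.
by apply: cvgM; exact: f2.
Qed.

Lemma ccontinuousV f : (forall t, f t != 0) -> ccontinuous f ->
  ccontinuous (fun t => (f t)^-1).
Proof.
move=> f0 fc; have [f1 f2] := fc.
have n0 t := lt0r_neq0 (sqr_modc_gt0 (f0 t)).
split=> t.
  rewrite (_ : (fun t => _) = (fun t => Re (f t) / (Re (f t) ^+ 2 + Im (f t) ^+ 2))).
    by apply: cvgM; [exact: f1|apply: cvgV => //; exact: ccontinuous_sqr_mod].
  by apply/funext => x; case: (f x).
rewrite (_ : (fun t => _) = (fun t => - (Im (f t) / (Re (f t) ^+ 2 + Im (f t) ^+ 2)))).
  by apply: cvgN; apply: cvgM; [exact: f2|apply: cvgV => //; exact: ccontinuous_sqr_mod].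
by apply/funext => x; case: (f x).
Qed.

Lemma continuous_carg f : (forall t, 0 < Im (f t)) -> ccontinuous f ->
  continuous (fun t => carg (f t)).
Proof.
move=> fup fc t; have [f1 f2] := fc.
apply: (@continuous_comp _ _ _ (fun t => Re (f t) / modc (f t)) (@acos R)); last first.
  by apply: continuous_acos; exact: cos_carg_lt1.
apply: cvgM; first exact: f1.
apply: cvgV; first by rewrite gt_eqF // modc_gt0.
apply: (@continuous_comp _ _ _ (fun t => Re (f t) ^+ 2 + Im (f t) ^+ 2) (@Num.sqrt R)).
  exact: ccontinuous_sqr_mod.
exact: sqrt_continuous.
Qed.

End Argument.

(** * Stability conditions of the quintic *)

Section QuinticStability.
Variable R : realType.
Local Open Scope classical_set_scope.
Local Notation C := R[i].
Local Notation Re := (@complex.Re R).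
Local Notation Im := (@complex.Im R).
Local Notation "z ^*" := (conjc z) : ring_scope.

(* The retraction of the line onto the unit interval. *)
Definition clamp01 (t : R) : R := (`|t| - `|t - 1| + 1) / 2.

Lemma clamp01_itv t : 0 <= clamp01 t <= 1.
Proof.
rewrite /clamp01; have [a|a] := leP 0 t; [rewrite (ger0_norm a)|rewrite (ltr0_norm a)];
  by have [b|b] := leP 0 (t - 1); [rewrite (ger0_norm b)|rewrite (ltr0_norm b)]; lra.
Qed.

Lemma clamp01_id t : 0 <= t <= 1 -> clamp01 t = t.
Proof.
move=> /andP[t0 t1]; rewrite /clamp01 ger0_norm // ler0_norm; last by lra.
by field.
Qed.

Lemma continuous_clamp01 : continuous clamp01.
Proof.
move=> t; apply: cvgM; last exact: cvg_cst.
apply: cvgD; last exact: cvg_cst.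
apply: cvgB; first exact: norm_continuous.
apply: (@continuous_comp _ _ _ (fun t : R => t - 1) (@Num.Def.normr R R));
  last exact: norm_continuous.
by apply: cvgB; [exact: cvg_id|exact: cvg_cst].
Qed.

(** Composing with the retraction turns continuity within the unit interval into continuity on the
    line, so that paths can be handled without subspace topologies. *)
Lemma continuous_comp_clamp01 (f : R -> R) :
  {within `[0, 1]%classic, continuous f} -> continuous (f \o clamp01).
Proof.
move=> /subspace_continuousP fc t.
have cI : `[0, 1]%classic (clamp01 t) by rewrite /= in_itv /= clamp01_itv.
move=> P /(fc _ cI) fP.
have cP : \forall x \near t, `[0, 1] (clamp01 x) -> P (f (clamp01 x)).
  exact: continuous_clamp01 fP.
have : \forall x \near t, P ((f \o clamp01) x).
  by apply: filterS cP => x /= Px; apply: Px; rewrite /= in_itv /= clamp01_itv.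
exact.
Qed.

Definition phases (l : C) (n : nat) : R := phase_seq (fun j => Z_norm j l) n.

Lemma phases_diff (l : C) n :
  phases l n.+1 - phases l n = carg (Z_norm n.+1 l / Z_norm n l).
Proof. by rewrite /phases phase_seqS addrAC subrr add0r. Qed.

Definition charges_rise (l : C) : Prop :=
  0 < Im (Z_norm 0 l) /\ forall n, 0 < Im (Z_step n l).

Definition quintic_stability (l : C) (hl : charges_rise l) : stability R :=
  graded_stability (phase_seq_polar hl.1 hl.2) (phase_seq_step hl.2).

(** The member of S_0 is found by rotating back: with Pi_B[1] = r^-1 exp (- i theta), the charges
    are multiplied by Pi_B[1] and theta is subtracted from every phase, which leaves all phase
    differences unchanged. *)
Lemma quintic_stability_normalized (l : C) (hl : charges_rise l) :
  0 < Re (Pi_B l 0 0) -> normalized l (quintic_stability hl).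
Proof.
move=> P0; have Pn0 : Pi_B l 0 0 != 0.
  by apply/eqP => P00; rewrite P00 ltxx in P0.
have Pinv : 0 < Re (Pi_B l 0 0)^-1.
  move: P0 Pn0; case: (Pi_B l 0 0) => a b /= a0 /sqr_modc_gt0 /= ab.
  by rewrite divr_gt0.
have [r [theta [r0 rth]]] := polar_right Pinv.
have PE : Pi_B l 0 0 = (r^-1)%:C * cis (- theta).
  apply: (mulIf (invr_neq0 Pn0)); rewrite divff // -rth mulrACA cisNr mulr1.
  by rewrite -rmorphM /= mulVf ?gt_eqF.
have z0p n : exists2 m : R, 0 < m &
    Pi_B l 0 0 * Z_norm n l = m%:C * cis (phases l n - theta).
  have [m m0 zn] := phase_seq_polar hl.1 hl.2 n.
  exists (r^-1 * m); first by rewrite mulr_gt0 ?invr_gt0.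
  by rewrite PE zn mulrACA -rmorphM -cisD [- theta + _]addrC.
have step n : phases l n - theta < phases l n.+1 - theta < phases l n - theta + pi.
  by have := phase_seq_step hl.2 n; rewrite -/(phases l n) -/(phases l n.+1); lra.
exists (graded_stability z0p step), r, theta; split=> //.
- split.
  + move=> s; rewrite [LHS]graded_charge_simple Z_normE mulrC divfK //.
  + exact: graded_stability_stable.
  + move=> s s' ss'; rewrite !(graded_stability_phase z0p step (@simple_neq0 R _)
      (@simple_supported R _)).
    by rewrite ss'.
  + move=> s s' ss'; rewrite !(graded_stability_phase z0p step (@simple_neq0 R _)
      (@simple_supported R _)).
    apply: (homo_ltn (f := fun n => phases l n - theta) lt_trans _ ss') => n.
    by have /andP[] := step n.
- apply: graded_stability_rotation => n; last by rewrite subrK.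
  by rewrite rth mulKf.
Qed.

Lemma quintic_stability_graded (l : C) (hl : charges_rise l) :
  graded_with (phases l) (quintic_stability hl).
Proof. by split=> // n Q Q0 Qn; exact: graded_stability_phase. Qed.

Lemma vertex_degree01 : (exists v, degree v = 0%N) /\ (exists v, degree v = 1%N).
Proof.
split; first by exists [ffun=> 0]; rewrite /degree big1 // => i _; rewrite ffunE.
exists [ffun i => if i == ord0 then 1 else 0].
by rewrite /degree (bigD1 ord0) //= big1 ?ffunE // => i /negPf i0; rewrite ffunE i0.
Qed.

Lemma not_dilation_rotation_of_carg (l l' : C) (sigma sigma' : stability R) :
  graded_with (phases l) sigma -> graded_with (phases l') sigma' ->
  carg (Z_norm 1 l / Z_norm 0 l) <> carg (Z_norm 1 l' / Z_norm 0 l') ->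
  not_dilation_rotation sigma sigma'.
Proof.
move=> g g' ll'; have [[v0 deg0] [v1 deg1]] := vertex_degree01.
apply: (graded_not_dilation_rotation (s := v1) (s' := v0) g g').
rewrite deg0 deg1 => e; apply: ll'.
exact: etrans (esym (phases_diff l 0)) (etrans e (phases_diff l' 0)).
Qed.

Lemma normalized_charge (l : C) (sigma : stability R) s : normalized l sigma ->
  central_charge sigma (stalk (simple R s)) = Z_norm (degree s) l.
Proof.
move=> [sigma0 [r [theta [[Z0 _ _ _] _ rP [dr _ _]]]]].
by rewrite dr rP Z0 Z_normE mulrC.
Qed.

Lemma path_continuous_comp_clamp01 (l : R -> C) :
  continuous_on_C `[0, 1]%classic l -> ccontinuous (l \o clamp01).
Proof.
by move=> [l1 l2]; split;
  [exact: (continuous_comp_clamp01 l1)|exact: (continuous_comp_clamp01 l2)].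
Qed.

Variables (d B K A L : R).
Hypothesis d0 : 0 < d.
Hypothesis B0 : 0 <= B.
Hypothesis K0 : 0 <= K.
Hypothesis coef_jet : forall n, jet d 3 (@hyp_coef R n) (B * K ^+ n).
Hypothesis L1 : 1 <= L.
Hypothesis LA : A <= L.
Hypothesis LK : K * expR (- L) <= 2^-1.
Hypothesis LBK : 2 * (B * (K * expR (- L))) <= 2^-1.

Lemma Pi_B00 l : strip A L l -> Pi_B l 0 0 = hyp_series 0 l.
Proof.
move=> sl; have [e0 _ _ _] := w_expansion d0 B0 K0 coef_jet (strip_small K0 LK sl).
by rewrite /Pi_B mxE /= e0.
Qed.

Section Path.
Variable l : R -> C.
Hypothesis l_cont : ccontinuous l.
Hypothesis l_strip : forall t, strip A L (l t).

Lemma expC_path_continuous n : ccontinuous (fun t => expC (n%:R%:C * l t)).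
Proof.
have [l1 l2] := l_cont.
have lin (f : R -> R) : continuous f -> continuous (fun t => n%:R * f t).
  by move=> fc t; apply: cvgM; [exact: cvg_cst|exact: fc].
have ce : continuous (fun t => expR (n%:R * Re (l t))).
  by move=> t; apply: (@continuous_comp _ _ _ (fun t => n%:R * Re (l t)) (@expR R));
    [exact: lin|exact: continuous_expR].
split=> t.
  rewrite (_ : (fun t => _) = (fun t => expR (n%:R * Re (l t)) * cos (n%:R * Im (l t)))).
    by apply: cvgM; [exact: ce|apply: (@continuous_comp _ _ _ (fun t =>
      n%:R * Im (l t)) (@cos R)); [exact: lin|exact: continuous_cos]].
  by apply/funext => x; rewrite Re_expC.
rewrite (_ : (fun t => _) = (fun t => expR (n%:R * Re (l t)) * sin (n%:R * Im (l t)))).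
  by apply: cvgM; [exact: ce|apply: (@continuous_comp _ _ _ (fun t =>
    n%:R * Im (l t)) (@sin R)); [exact: lin|exact: continuous_sin]].
by apply/funext => x; rewrite Im_expC.
Qed.

Lemma hyp_series_path_continuous j : (j <= 3)%N ->
  ccontinuous (fun t => hyp_series j (l t)).
Proof.
move=> j3; have z0 : `|0 : R| < d by rewrite normr0.
have geo t (x : nat -> R) : (forall n, `|x n| <= expR (Re (l t)) ^+ n) ->
    geo_bounded B (fun n => derive1n j (@hyp_coef R n) 0 * x n).
  by move=> xl; exact: (coef_geo B0 K0 coef_jet (strip_small K0 LK (l_strip t)) j3 z0 xl).
split.
  rewrite (_ : (fun t => _) = fun t => limn (series ((fun n t =>
    derive1n j (@hyp_coef R n) 0 * Re (expC (n%:R%:C * l t)))^~ t))).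
    apply: (@series_continuous _ _ B) => [n t|t].
      by apply: cvgM; [exact: cvg_cst|have [+ _] := expC_path_continuous n; exact].
    by apply: (geo t (fun n => Re (expC (n%:R%:C * l t)))) => n;
      have [] := ler_expC n (l t).
  by apply/funext => t; rewrite Re_period_series.
rewrite (_ : (fun t => _) = fun t => limn (series ((fun n t =>
  derive1n j (@hyp_coef R n) 0 * Im (expC (n%:R%:C * l t)))^~ t))).
  apply: (@series_continuous _ _ B) => [n t|t].
    by apply: cvgM; [exact: cvg_cst|have [_] := expC_path_continuous n; exact].
  by apply: (geo t (fun n => Im (expC (n%:R%:C * l t)))) => n;
    have [] := ler_expC n (l t).
by apply/funext => t; rewrite Im_period_series.
Qed.

Lemma hyp_quot_path_continuous j : (j <= 3)%N -> ccontinuous (fun t => hyp_quot j (l t)).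
Proof.
move=> j3; apply: ccontinuousM; first exact: hyp_series_path_continuous.
apply: ccontinuousV; last exact: hyp_series_path_continuous.
by move=> t; apply: (hyp_series0_neq0 d0 B0 K0 coef_jet LK LBK (l_strip t)).
Qed.

Lemma Z_norm_path_continuous n : ccontinuous (fun t => Z_norm n (l t)).
Proof.
have cc (c : C) f : ccontinuous f -> ccontinuous (fun t => c * f t).
  by move=> fc; apply: ccontinuousM => //; exact: ccontinuous_cst.
have lX k : ccontinuous (fun t => l t ^+ k) by exact: ccontinuousX.
have o1 : ccontinuous (fun t => quot1 (l t)).
  by apply: (cc _ _); apply: ccontinuousD => //; exact: hyp_quot_path_continuous.
have o2 : ccontinuous (fun t => quot2 (l t)).
  apply: ccontinuousD; first exact: cc.
  apply: ccontinuousD; last exact: cc.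
  apply: (cc _ _); apply: ccontinuousD; last exact: hyp_quot_path_continuous.
  exact: (ccontinuousM (cc _ _ l_cont) (hyp_quot_path_continuous _)).
have o3 : ccontinuous (fun t => quot3 (l t)).
  apply: ccontinuousD; first exact: cc.
  apply: ccontinuousD; last exact: cc.
  apply: (cc _ _); apply: ccontinuousD; last exact: hyp_quot_path_continuous.
  apply: ccontinuousD; first exact: (ccontinuousM (cc _ _ (lX 2))
    (hyp_quot_path_continuous _)).
  exact: (ccontinuousM (cc _ _ l_cont) (hyp_quot_path_continuous _)).
pose c i : C := ((charge_row n)`_i)%:~R.
rewrite (_ : (fun t => _) = fun t => c 0%N + c 1%N * quot1 (l t) + c 2%N * quot2 (l t)
    + c 3%N * quot3 (l t)); last first.
  by apply/funext => t; exact: (Z_norm_quot d0 B0 K0 coef_jet LK LBK n (l_strip t)).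
apply: ccontinuousD; last exact: cc.
apply: ccontinuousD; last exact: cc.
by apply: ccontinuousD; [exact: ccontinuous_cst|exact: cc].
Qed.

Hypothesis l_rise : forall t, charges_rise (l t).

Lemma phases_path_continuous n : continuous (fun t => phases (l t) n).
Proof.
have ph0 : continuous (fun t => carg (Z_norm 0 (l t))).
  by apply: continuous_carg; [move=> t;
    have [] := l_rise t|exact: Z_norm_path_continuous].
elim: n => [|n IH].
  rewrite (_ : (fun t => _) = (fun t => carg (Z_norm 0 (l t)))) //.
  by apply/funext => t; rewrite /phases /phase_seq big_ord0 addr0.
rewrite (_ : (fun t => _) = (fun t =>
  phases (l t) n + carg (Z_norm n.+1 (l t) / Z_norm n (l t)))).
  move=> t; apply: cvgD; first exact: IH.
  apply: (@continuous_carg _ (fun t => Z_norm n.+1 (l t) / Z_norm n (l t))) => [x|].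
    by apply: Im_div_gt0; have [_] := l_rise x; exact.
  apply: ccontinuousM; first exact: Z_norm_path_continuous.
  apply: ccontinuousV; last exact: Z_norm_path_continuous.
  by move=> x; have [_ /(_ n)/Im_conj_neq0] := l_rise x.
by apply/funext => t; rewrite /phases phase_seqS.
Qed.

Lemma graded_charge_path_continuous X :
  ccontinuous (fun t => graded_charge (fun n => Z_norm n (l t)) X).
Proof.
rewrite /graded_charge; elim: (index_enum _) => [|s r IH].
  rewrite (_ : (fun t => _) = (fun=> 0)); first exact: ccontinuous_cst.
  by apply/funext => t; rewrite big_nil.
rewrite (_ : (fun t => _) = (fun t => (euler_char X s)%:~R * Z_norm (degree s) (l t)
    + \sum_(s <- r) (euler_char X s)%:~R * Z_norm (degree s) (l t))).
  apply: ccontinuousD => //; apply: ccontinuousM; first exact: ccontinuous_cst.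
  exact: Z_norm_path_continuous.
by apply/funext => t; rewrite big_cons.
Qed.

End Path.

(** A family is indexed by the whole line, but [charges_rise] is known only along the unit interval;
    the path is therefore composed with [clamp01] before the stability conditions are built. *)
Lemma path_deformation (l : R -> C) : continuous_on_C `[0, 1]%classic l ->
  (forall t, 0 <= t <= 1 -> strip A L (l t) /\ charges_rise (l t)) ->
  exists (sigma sigma' : stability R) (fam : R -> stability R),
    [/\ deforms_along l sigma sigma' fam,
        graded_with (phases (l 0)) sigma & graded_with (phases (l 1)) sigma'].
Proof.
move=> lc lI; pose m t := l (clamp01 t).
have mc : ccontinuous m by exact: path_continuous_comp_clamp01.
have ms t : strip A L (m t) by have [] := lI _ (clamp01_itv t).
have mr t : charges_rise (m t) by have [] := lI _ (clamp01_itv t).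
pose fam t := quintic_stability (mr t).
have ml t : 0 <= t <= 1 -> m t = l t by move=> tI; rewrite /m clamp01_id.
exists (fam 0), (fam 1), fam; split.
- split; [split=> //|].
  + move=> X; have [c1 c2'] := graded_charge_path_continuous mc ms X.
    by split; apply: continuous_subspaceT.
  + move=> Q; apply: continuous_subspaceT.
    (* The degree of Q does not depend on t, so its phase function is continuous whether or not Q is
       stable. *)
    have -> : (fun t => phase (fam t) Q) = (fun t => phases (m t) (rep_degree Q)) by [].
    exact: (phases_path_continuous mc ms mr).
  + move=> t tI; rewrite -ml //; apply: quintic_stability_normalized.
    rewrite (Pi_B00 (ms t));
      apply: lt_le_trans (hyp_series0_ge d0 B0 K0 coef_jet LK LBK (ms t)).
    by rewrite invr_gt0.
- by rewrite -(ml 0) ?lexx ?ler01 //; exact: quintic_stability_graded.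
- by rewrite -(ml 1) ?lexx ?ler01 //; exact: quintic_stability_graded.
Qed.

End QuinticStability.

(* With [a = Re P], [b = Im P] at a far point and [c], [x] the imaginary and real
   parts at a fixed point: [a] grows like [- y ^ 6] and [b] at most like [y ^ 5],
   so the far argument cannot equal the fixed one. *)
Lemma growth_not_proportional (R : realType) (c x a b y kappa M : R) :
  0 < c -> 0 < kappa -> 0 <= M -> 0 < y -> 0 < b ->
  a <= M * y ^+ 5 - kappa * y ^+ 6 -> b <= M * y ^+ 5 ->
  M + (M * `|x| + 1) / c <= kappa * y -> c * a <> b * x.
Proof.
move=> c0 kappa0 M0 y0 b0 + + kN cross_eq; have : 0 < y ^+ 5 by rewrite exprn_gt0.
rewrite [y ^+ 6]exprS; move: (y ^+ 5) => q q0 aB bB.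
have xN : - x <= `|x| by rewrite -normrN ler_norm.
have kN' : M * `|x| + 1 <= c * (kappa * y - M).
  by rewrite [leRHS]mulrC -ler_pdivrMr //; lra.
have h1 : c * (kappa * y - M) * q <= - (c * a).
  by rewrite -mulrA -mulrN ler_pM2l //; lra.
have h2 : - (c * a) <= M * `|x| * q.
  rewrite cross_eq -mulrN; apply: (@le_trans _ _ (b * `|x|)).
    by apply: ler_wpM2l => //; exact: ltW.
  by rewrite mulrAC; apply: ler_wpM2r.
have h3 : (M * `|x| + 1) * q <= c * (kappa * y - M) * q.
  by apply: ler_wpM2r => //; exact: ltW.
by have := le_trans h3 (le_trans h1 h2); rewrite mulrDl mul1r; lra.
Qed.

(** * Wall-crossings from the quotients of periods *)

Theorem corollary1p4 (R : realType) (A : R) (hA : 0 < A) :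
  exists2 r : R, 0 < r &
  [/\ (* normalized charges of the simple objects are integral combinations of
         1 and the quotients of periods *)
      exists a : vertex -> 'I_4 -> int,
        forall (l : R[i]) (sigma : stability R) (s : vertex),
          near0 A r l -> normalized l sigma ->
          central_charge sigma (stalk (simple R s)) =
            (a s ord0)%:~R
              + \sum_(i < 4 | i != ord0) (a s i)%:~R * quotient_B l i,
      (* letting x vary near 0 deforms the stability conditions *)
      forall l : R -> R[i], path_near0 A r l ->
        exists (sigma sigma' : stability R) (fam : R -> stability R),
          deforms_along l sigma sigma' fam
    & (* and gives wall-crossings, arbitrarily close to x = 0 *)
      forall e : R, 0 < e -> e <= r ->
        exists (l : R -> R[i]) (sigma sigma' : stability R)
               (fam : R -> stability R),
          [/\ path_near0 A e l, deforms_along l sigma sigma' fam,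
              wall_crossing2 sigma sigma'
            & not_dilation_rotation sigma sigma']].
Proof.
have [d [B [K [d0 B0 K1 coef]]]] := jet_hyp_coef R.
have K0 : 0 <= K by rewrite (le_trans ler01).
(* As exp (- L) <= 1 / L, the four summands provide in turn 1 <= L, A <= L, [LK] and [LBK]. *)
pose L := 1 + A + 2 * K + 4 * B * K.
have BK0 : 0 <= B * K by rewrite mulr_ge0.
have L1 : 1 <= L by rewrite /L; lra.
have LA : A <= L by rewrite /L; lra.
have expL : expR (- L) <= L^-1.
  rewrite expRN lef_pV2 ?posrE ?expR_gt0 //; last by lra.
  by apply: le_trans (expR_ge1Dx L); rewrite lerDr.
have LK : K * expR (- L) <= 2^-1.
  apply: (le_trans (ler_wpM2l K0 expL)); rewrite ler_pdivrMr; last by lra.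
  by rewrite /L; lra.
have LBK : 2 * (B * (K * expR (- L))) <= 2^-1.
  rewrite mulrA mulrA; apply: (@le_trans _ _ (2 * B * K * L^-1)).
    by rewrite ler_wpM2l // mulr_ge0 // mulr_ge0.
  by rewrite ler_pdivrMr; [rewrite /L; lra|lra].
have [Y HY] := Im_Z_step_gt0 d0 B0 K0 coef L1 LA LK LBK.
have [Y' HY'] := Im_Z_norm0_gt0 d0 B0 K0 coef L1 LA LK LBK.
have [kappa [M [kappa0 M0 growth]]] := Z_step0_growth d0 B0 K0 coef L1 LA LK LBK.
(* T dominates the three thresholds whatever their signs; the radius is exp (- T). *)
pose T := `|L| + `|Y| + `|Y'|.
have near l e : e <= expR (- T) -> near0 A e l -> strip A L l /\ charges_rise l.
  move=> eT [le lA].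
  have lT : complex.Re l < - T by rewrite -ltr_expR (lt_le_trans le).
  have nL := ler_norm L; have nY := ler_norm Y; have nY' := ler_norm Y'.
  have pL := normr_ge0 L; have pY := normr_ge0 Y; have pY' := normr_ge0 Y'.
  have sl : strip A L l by split=> //; move: lT; rewrite /T; lra.
  split=> //; split; first by apply: HY' => //; move: lT; rewrite /T; lra.
  by move=> n; apply: HY => //; move: lT; rewrite /T; lra.
exists (expR (- T)); first exact: expR_gt0.
split.
- exists (fun s i => (charge_row (degree s))`_i) => l sigma s nl ns.
  have [sl _] := near l _ (lexx _) nl.
  rewrite (normalized_charge s ns) /Z_norm (bigD1 ord0) //=; congr (_ + _).
  rewrite /quotient_B divff ?mulr1 // (Pi_B00 d0 B0 K0 coef LK sl).
  exact: (hyp_series0_neq0 d0 B0 K0 coef LK LBK sl).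
- move=> l [lc ln].
  have lr t : 0 <= t <= 1 -> strip A L (l t) /\ charges_rise (l t) by move=> /ln;
    exact: near.
  have [sigma [sigma' [fam [H _ _]]]] := path_deformation d0 B0 K0 coef LK LBK lc lr.
  by exists sigma, sigma', fam.
move=> e e0 er.
(* The summand 1 makes the inequalities strict, as |x| < e requires. *)
pose y0 := Num.max T (- ln e) + 1.
have yT : T < y0 by rewrite /y0 ltr_pwDr // le_max lexx.
have ye : - ln e < y0 by rewrite /y0 ltr_pwDr // le_max lexx orbT.
pose point (y : R) : R[i] := (- y)%:C.
have point_near y : y0 <= y -> near0 A e (point y).
  move=> yy; split; last by rewrite /= normr0 ltW.
  by rewrite /= -[ltRHS](lnK (x := e)) ?posrE // ltr_expR; lra.
have point_good y : y0 <= y -> strip A L (point y) /\ charges_rise (point y).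
  by move=> /point_near; exact: near.
have [s0 r0] := point_good _ (lexx y0).
pose P y := Z_step 0 (point y).
pose c := complex.Im (P y0); have c0 : 0 < c by have [_] := r0; exact.
(* Beyond N the growth estimate forces the argument of Z_1 / Z_0 to differ from its value at y0. *)
pose N := (M + (M * `|complex.Re (P y0)| + 1) / c) / kappa + y0.
have [y1 [y01 yN]] : exists y1 : R, y0 <= y1 /\ N <= y1.
  by exists (Num.max y0 N); rewrite !le_max !lexx orbT.
have [s1 r1] := point_good _ y01.
have T0 : 0 <= T by rewrite addr_ge0 ?addr_ge0 ?normr_ge0.
have y0_gt0 : 0 < y0 := le_lt_trans T0 yT.
have y1_gt0 : 0 < y1 := lt_le_trans y0_gt0 y01.
have kN : M + (M * `|complex.Re (P y0)| + 1) / c <= kappa * y1.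
  rewrite [leRHS]mulrC -ler_pdivrMr //; apply: le_trans yN.
  by rewrite lerDl ltW.
have differ : carg (Z_norm 1 (point y0) / Z_norm 0 (point y0)) <>
    carg (Z_norm 1 (point y1) / Z_norm 0 (point y1)).
  move=> ee; have [_ /(_ 0%N) up0] := r0; have [_ /(_ 0%N) up1] := r1.
  have y1E : - complex.Re (point y1) = y1 by rewrite /= opprK.
  have [] := growth _ s1; rewrite y1E => reB imB.
  apply: (growth_not_proportional c0 kappa0 M0 y1_gt0 up1 reB imB kN).
  exact: (carg_div_inj up0 up1 ee).
(* The path runs along the positive real ray from x = exp (- y0) towards 0, ending at exp (- y1). *)
pose l t := point (y0 + t * (y1 - y0)).
have l_near t : 0 <= t <= 1 -> y0 <= y0 + t * (y1 - y0).
  by move=> /andP[t0 _]; rewrite lerDl; apply: (mulr_ge0 t0); rewrite subr_ge0;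
    exact: y01.
have lc : continuous_on_C `[0, 1]%classic l.
  split; apply: continuous_subspaceT => t.
    rewrite (_ : (fun t => _) = (fun t => - (y0 + t * (y1 - y0)))); last by apply/funext.
    apply: cvgN; apply: cvgD; first exact: cvg_cst.
    by apply: cvgM; [exact: cvg_id|exact: cvg_cst].
  by rewrite (_ : (fun t => _) = (fun=> 0)); [exact: cvg_cst|apply/funext].
have lr t : 0 <= t <= 1 -> strip A L (l t) /\ charges_rise (l t).
  by move=> /l_near; exact: point_good.
have [sigma [sigma' [fam [H g g']]]] := path_deformation d0 B0 K0 coef LK LBK lc lr.
have l0E : l 0 = point y0 by rewrite /l mul0r addr0.
have l1E : l 1 = point y1 by rewrite /l mul1r addrC subrK.
rewrite l0E in g; rewrite l1E in g'.
have nd := not_dilation_rotation_of_carg g g' differ.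
exists l, sigma, sigma', fam; split.
- by split; [exact: lc|move=> t /l_near; exact: point_near].
- exact: H.
- exact: not_dilation_rotation_wall nd.
- exact: nd.
Qed.
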